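(* The sequence $(L^{(1)}_n)_{n\ge 1}$ satisfies the weak large deviation principle in $\mathcal P(S)$ with rate function $I^{(1)}$ given by $$I^{(1)}(\mu)=\begin{cases}(\Lambda^{(1)})^*(\mu)=J^{(1)}(\mu)=R^{(1)}(\mu) & \text{if } \mu\in\mathcal A^{(1)},\\ \infty & \text{otherwise.}\end{cases}$$ (In particular the three quantities in the first line coincide for every $\mu\in\mathcal A^{(1)}$.)
   Context: Markov chain. $S$ is a countable discrete set, and $(X_n)_{n\ge1}$ is a Markov chain on $S$ with arbitrary transition kernel $p$ and arbitrary initial distribution $\beta$; $\mathbb P,\mathbb E$ denote its law and expectation. No irreducibility or exponential tightness is assumed. The occupation measure is $L^{(1)}_n=\frac1n\sum_{i=1}^n\delta_{X_i}\in\mathcal P(S)$. Reachability. For $x,y\in S$, $x\leadsto y$ means that there are $n\ge1$ and $x=x_1,x_2,\dots,x_{n+1}=y$ in $S$ with $p(x_i,x_{i+1})>0$ for all $1\le i\le n$ (so $x\leadsto x$ may fail). An irreducible class is a maximal nonempty subset $C\subseteq S$ with $x\leadsto y$ for all $(x,y)\in C^2$; $(C_j)_{j\in\mathcal J}$ is the countable family of all irreducible classes. $C_j\leadsto C_{j'}$ means some $y\in C_{j'}$ is reachable from some $x\in C_j$. $\beta\leadsto y$ means $y\in\operatorname{supp}\beta$ or $x\leadsto y$ for some $x\in\operatorname{supp}\beta$; $\beta\leadsto C_j$ means $\beta\leadsto y$ for some $y\in C_j$. Measures. For $k\in\{1,2\}$, $\mathcal P(S^k)$ is the set of probability measures on $S^k$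 with the weak topology: the coarsest making $\mu\mapsto\langle\mu,V\rangle=\sum_uV(u)\mu(u)$ continuous for every bounded $V:S^k\to\mathbb R$ (set of such $V$: $\mathcal B(S^k)$); it is metrized by total variation. $\mu|_A$ denotes the measure $\mu(A\cap\cdot)$. $\mu\in\mathcal P(S)$ is pre-admissible if $\mu=\sum_{j\in\mathcal J_\mu}\mu|_{C_j}$ for some $\mathcal J_\mu\subseteq\mathcal J$, taken minimal, i.e. $\mathcal J_\mu=\{j:\mu(C_j)>0\}$. A pre-admissible $\mu$ is admissible if moreover $\leadsto$ is total on $(C_j)_{j\in\mathcal J_\mu}$ (for $j,j'\in\mathcal J_\mu$, $C_j\leadsto C_{j'}$ or $C_{j'}\leadsto C_j$) and $\beta\leadsto C_j$ for all $j\in\mathcal J_\mu$. $\mathcal A^{(1)}\subseteq\mathcal P(S)$ is the set of admissible measures. $\mathcal P_{\mathrm{bal}}(S^2)$ is the set of $\nu\in\mathcal P(S^2)$ with $\nu(A\times S)=\nu(S\times A)$ for all $A\subseteq S$, and $\nu^{(1)}(A)=\nu(A\times S)$. Functions. - $\Lambda^{(1)}(V)=\limsup_{n\to\infty}\frac1n\log\mathbb E[e^{n\langle L^{(1)}_n,V\rangle}]$ for $V\in\mathcal B(S)$, and $(\Lambda^{(1)})^*(\mu)=\sup_{V\in\mathcal B(S)}(\langle\mu,V\rangle-\Lambda^{(1)}(V))$. - $J^{(1)}(\mu)=\sup_f\sum_{x\in S}\mu(x)\log\frac{f(x)}{pf(x)}$ for $\mu\in\mathcal P(S)$, the supremum being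 over $f:S\to(0,\infty)$ bounded away from $0$ and $\infty$, with $pf(x)=\sum_{y\in S}p(x,y)f(y)$. - $R^{(1)}(\mu)=\inf\{R^{(2)}(\nu)\mid\nu\in\mathcal P_{\mathrm{bal}}(S^2),\ \nu^{(1)}=\mu\}$, where $R^{(2)}(\nu)=H(\nu|\nu^{(1)}\otimes p)$, $(\nu^{(1)}\otimes p)(x,y)=\nu^{(1)}(x)p(x,y)$, and $H(\mu|\nu)=\sum_u\mu(u)\log\frac{\mu(u)}{\nu(u)}$ if $\mu\ll\nu$ (with $0\log0=0$), $H(\mu|\nu)=\infty$ otherwise. Weak LDP. A sequence $(Y_n)$ of random elements of a Hausdorff space $\mathcal X$ satisfies the weak LDP with rate function $I$ if $I:\mathcal X\to[0,+\infty]$ is lower semicontinuous, $\limsup_n\frac1n\log\mathbb P(Y_n\in K)\le-\inf_KI$ for every compact $K$, and $\liminf_n\frac1n\log\mathbb P(Y_n\in U)\ge-\inf_UI$ for every open $U$. *)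

(* Defs.v *)
From HB Require Import structures.
From mathcomp Require Import all_boot all_order all_algebra.
From mathcomp Require Import all_classical all_reals all_analysis.

Set Implicit Arguments.
Unset Strict Implicit.
Unset Printing Implicit Defensive.

Import Order.TTheory GRing.Theory Num.Theory.
Import numFieldTopology.Exports numFieldNormedType.Exports.

Local Open Scope classical_set_scope.
Local Open Scope ring_scope.

(* Throughout, the countable discrete set S is a measurableType; the theorem
   assumes that S is countable and that all its subsets are measurable, so that
   measurability imposes no restriction on functions on S or on S * S, and an
   integral against a measure mu is the sum weighted by the masses mu [set x].
   The indices 1, 2, 3, ... of a sequence are shifted to 0, 1, 2, ... *)

Section weak_topology.
Context d (T : measurableType d) (R : realType).

Definition bounded_function := {V : T -> R | bounded_fun V}.

Definition pairing (mu : probability T R) (V : T -> R) : R :=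
  \int[mu]_x V x.

(* The coarsest topology making mu |-> pairing mu V continuous for all bounded
   V, as the supremum of the initial topologies of these maps. *)
Definition weak_probability : Type :=
  sup_topology (fun V : bounded_function =>
    Topological.class (initial_topology
      (fun mu : probability T R => pairing mu (projT1 V)))).

HB.instance Definition _ :=
  Topological.copy (probability T R) weak_probability.

End weak_topology.

Section occupation_measure.
Context d (S : measurableType d) (R : realType).
Variables (n : nat) (x : nat -> S).

(* (n+1)^-1 (\d_(x 0) + ... + \d_(x n)) *)
Definition empirical : set S -> \bar R :=
  mscale (n.+1%:R^-1)%:nng (msum (fun i => \d_(x i)) n.+1).

HB.instance Definition _ := Measure.on empirical.

Let empirical_setT : empirical [set: S] = 1%E.
Proof.
have -> : empirical [set: S] =
    ((n.+1%:R^-1)%:E * \sum_(i < n.+1) \d_(x i) [set: S])%E by [].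
under eq_bigr do rewrite diracT.
by rewrite sumEFin sumr_const card_ord -EFinM mulVf ?pnatr_eq0.
Qed.

HB.instance Definition _ :=
  Measure_isProbability.Build _ _ _ empirical empirical_setT.

End occupation_measure.

Section markov_chain.
Context d d' (S : measurableType d) (Omega : measurableType d') (R : realType).
Variables (P : probability Omega R) (X : nat -> {RV P >-> S}).
Variables (beta : probability S R) (p : R.-pker S ~> S).
Local Open Scope ereal_scope.

Definition markov_chain :=
  (forall x, P [set w | X 0%N w = x] = beta [set x]) /\
  (forall (n : nat) (x : nat -> S),
    P [set w | forall i, (i <= n.+1)%N -> X i w = x i] =
    P [set w | forall i, (i <= n)%N -> X i w = x i] * p (x n) [set x n.+1]).

Definition occupation (n : nat) (w : Omega) : probability S R :=
  empirical R n (fun i => X i w).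

Definition Lambda (V : S -> R) : \bar R :=
  limn_esup (fun n => (n.+1%:R^-1)%:E *
    lne 'E_P[fun w => expR (n.+1%:R * pairing (occupation n w) V)]).

Definition Lambda_star (mu : probability S R) : \bar R :=
  ereal_sup [set (pairing mu V)%:E - Lambda V | V in [set V | bounded_fun V]].

End markov_chain.

Section reachability.
Context d (S : measurableType d) (R : realType).
Variables (beta : probability S R) (p : R.-pker S ~> S).

Definition reach (x y : S) :=
  exists (n : nat) (u : nat -> S), [/\ (0 < n)%N, u 0%N = x, u n = y &
    forall i, (i < n)%N -> (0 < p (u i) [set u i.+1])%E].

Definition strongly_connected (C : set S) :=
  forall x y, C x -> C y -> reach x y.

Definition irreducible_class (C : set S) :=
  [/\ C !=set0, strongly_connected C &
    forall D, C `<=` D -> strongly_connected D -> D = C].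

Definition reach_class (C D : set S) :=
  exists x y, [/\ C x, D y & reach x y].

Definition supp : set S := [set x | (0 < beta [set x])%E].

Definition init_reach (y : S) :=
  supp y \/ exists2 x, supp x & reach x y.

Definition init_reach_class (C : set S) := exists2 y, C y & init_reach y.

(* A family of irreducible classes is identified with the set of its members. *)
Definition pre_admissible (mu : probability S R) :=
  exists2 J : set (set S), J `<=` irreducible_class &
    forall A, mu A = \esum_(C in J) mu (A `&` C).

(* The minimal family of a pre-admissible mu. *)
Definition charged_classes (mu : probability S R) : set (set S) :=
  [set C | irreducible_class C /\ (0 < mu C)%E].

Definition admissible (mu : probability S R) :=
  [/\ pre_admissible mu,
    forall C D, charged_classes mu C -> charged_classes mu D ->
      reach_class C D \/ reach_class D C &
    forall C, charged_classes mu C -> init_reach_class C].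

End reachability.

Section rate_functions.
Context d (S : measurableType d) (R : realType).
Variables (p : R.-pker S ~> S).

Definition bounded_away (f : S -> R) :=
  exists a b, 0 < a /\ forall x, a <= f x <= b.

Definition J1 (mu : probability S R) : \bar R :=
  ereal_sup [set \int[mu]_x (ln (f x / \int[p x]_y f y))%:E
            | f in bounded_away]%E.

Definition balanced (nu : probability (S * S)%type R) :=
  forall A : set S, nu (A `*` [set: S]) = nu ([set: S] `*` A).

Definition marginal1 (nu : probability (S * S)%type R) : set S -> \bar R :=
  fun A => nu (A `*` [set: S]).

(* The measure on S * S with masses mu [set x] * p x [set y]. *)
Definition kernel_product (mu : set S -> \bar R) : set (S * S) -> \bar R :=
  fun A => (\esum_(u in A) (mu [set u.1] * p u.1 [set u.2]))%E.

(* For probability measures mu and nu, the integral is the sum of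
   mu u * ln (mu u / nu u) over u, which is well defined in [0, +oo]: its
   negative part is at most 1. Points with mu u = 0 do not contribute. *)
Definition rel_entropy d' (T : measurableType d')
    (mu : {measure set T -> \bar R}) (nu : set T -> \bar R) : \bar R :=
  if `[< mu `<< nu >]
  then (\int[mu]_u (ln (fine (mu [set u]) / fine (nu [set u])))%:E)%E
  else +oo%E.

Definition R2 (nu : probability (S * S)%type R) : \bar R :=
  rel_entropy nu (kernel_product (marginal1 nu)).

Definition R1 (mu : probability S R) : \bar R :=
  ereal_inf [set R2 nu | nu in
    [set nu | balanced nu /\ marginal1 nu = mu :> (set S -> \bar R)]].

End rate_functions.

Section weak_LDP.
Context d (Omega : measurableType d) (R : realType).
Variables (P : probability Omega R) (T : topologicalType).
Local Open Scope ereal_scope.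

Definition random_elements (Y : nat -> Omega -> T) :=
  forall n A, open A -> measurable (Y n @^-1` A).

Definition log_prob (Y : nat -> Omega -> T) (A : set T) (n : nat) : \bar R :=
  (n.+1%:R^-1)%:E * lne (P (Y n @^-1` A)).

Definition weak_LDP (Y : nat -> Omega -> T) (I : T -> \bar R) :=
  [/\ hausdorff_space T /\ random_elements Y,
    (forall x, 0 <= I x) /\ lower_semicontinuous I,
    forall K, compact K ->
      limn_esup (log_prob Y K) <= - ereal_inf (I @` K) &
    forall U, open U ->
      - ereal_inf (I @` U) <= limn_einf (log_prob Y U)].

End weak_LDP.

Definition rate_function d d' (S : measurableType d)
    (Omega : measurableType d') (R : realType) (P : probability Omega R)
    (X : nat -> {RV P >-> S}) (beta : probability S R) (p : R.-pker S ~> S)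
    (mu : probability S R) : \bar R :=
  if `[< admissible beta p mu >] then Lambda_star X mu else +oo%E.

(* Main.v *)
Require Import Defs.
From HB Require Import structures.
From mathcomp Require Import all_boot all_order all_algebra.
From mathcomp Require Import all_classical all_reals all_analysis.
From mathcomp Require Import ring lra.

(* Everything follows from two local estimates at a measure mu.
   Upper: if a < I(mu), some neighbourhood U of mu has P(L_n in U) <= e^(-na)
   eventually; for admissible mu this is Chebyshev's inequality with a
   near-optimal V, and near a non-admissible mu the probability vanishes for
   large n.
   Lower: if mu is admissible and R1(mu) < a, every neighbourhood U of mu has
   P(L_n in U) >= e^(-na) eventually. Comparing the two gives Lambda* <= R1 on
   admissible measures. Conversely J1 <= Lambda*, because V = ln (f / pf) makes
   f(X_n) e^(sum of V) a martingale, and R1 <= J1: a near-maximizer g of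
   <mu, g - ln p(e^g)>, penalized to stay bounded, tilts p to a pair measure
   which is almost balanced and almost optimal, and Tychonoff's theorem gives a
   balanced limit.
   For the lower estimate, let Q be the law of words of length l of the
   stationary chain with pair measure nu. Its entropy relative to the original
   chain is l R2(nu) up to a constant. Finitely many words, with end points in a
   finite set F, carry almost all of Q. They fall into a number of classes
   independent of l, according to their end points and to their numbers of
   visits, rounded. Since nu is balanced, a word can be closed up into a loop by
   a path of bounded length; the loops of each class are iterated in proportion
   to its Q-mass, and the classes are visited in an order in which each is
   reachable from the previous one. By the log-sum inequality the resulting
   paths of the original chain have total probability about e^(-n R2(nu)). *)

Set Implicit Arguments.
Unset Strict Implicit.
Unset Printing Implicit Defensive.

Import Order.TTheory GRing.Theory Num.Theory.
Import numFieldTopology.Exports numFieldNormedType.Exports.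

Local Open Scope classical_set_scope.
Local Open Scope ring_scope.

(** * Countable discrete spaces and relative entropy density *)

(** The chain may be transient, periodic or split into infinitely many classes, so the tilted chain
    need not be ergodic, and the set where the rate is finite need not be convex: two classes may be
    charged separately but not together. Hence the lower estimate uses expectations only.
    Stationarity gives every letter of a word the law [mu], which fixes the mean number of visits
    and the entropy exactly; the average over words of different behaviour is then realized inside a
    single path, where each class of words gets a share of time proportional to its mass.
    Admissibility enters here: totality of reachability puts the loops in order, and the initial law
    must reach the first one. The comparison is a circle [R1 <= J1 <= Lambda_star <= R1]. The first
    two inequalities are proved for every measure, the last one only for admissible measures. The
    inequality [R1 <= J1] is a minimax statement without compactness. It is reduced to linear
    constraints on finitely many coordinates, which pass to coordinatewise limits, and prescribing
    both marginals keeps mass from escaping. *)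

Section countable_discrete.
Context d (T : measurableType d) (R : realType).
Hypothesis countT : countable [set: T].
Hypothesis discT : forall A : set T, measurable A.
Local Open Scope ereal_scope.

Lemma integral_esum (m : {measure set T -> \bar R}) (f : T -> \bar R) :
  (forall x, 0 <= f x) ->
  \int[m]_x f x = \esum_(x in [set: T]) (f x * m [set x]).
Proof.
move=> f0; have /countable_injP[e einj] := countT.
pose F n := [set x : T | e x = n].
have FT : \bigcup_n F n = [set: T].
  by apply/seteqP; split => // x _; exists (e x).
have tF : trivIset [set: nat] F.
  by move=> i j _ _ [x [/= <- <-]].
rewrite -{1}FT ge0_integral_bigcup//.
rewrite -[in RHS]FT nneseries_sum_bigcup//; last first.
  by move=> x; rewrite mule_ge0.
apply: eq_eseriesr => n _.
have [F0|/set0P[x Fx]] := eqVneq (F n) set0.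
  by rewrite F0 integral_set0 esum_set0.
have -> : F n = [set x].
  apply/seteqP; split => y /=; last by move=> ->.
  by move=> Fy; apply: einj; rewrite ?inE//; rewrite Fx.
rewrite esum_set1 ?mule_ge0//.
rewrite (eq_integral (cst (f x))); first by rewrite integral_cst.
by move=> y; rewrite inE => /= ->.
Qed.

Lemma measure_esum (m : {measure set T -> \bar R}) (A : set T) :
  m A = \esum_(x in A) m [set x].
Proof.
rewrite -[LHS]mul1e -integral_cst// integral_mkcond integral_esum.
  rewrite [RHS]esum_mkcond; apply: eq_esum => x _.
  by rewrite patchE; case: ifP => _; rewrite ?mul1e ?mul0e.
by move=> x; rewrite patchE; case: ifP.
Qed.

Lemma bounded_integrable (m : probability T R) (f : T -> R) :
  bounded_fun f -> m.-integrable setT (EFin \o f).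
Proof.
move=> bf; apply: measurable_bounded_integrable => //.
by apply: (le_lt_trans (probability_le1 m measurableT)); rewrite ltry.
Qed.

Definition mass (m : set T -> \bar R) (x : T) : R := fine (m [set x]).

Lemma massE (m : probability T R) x : (mass m x)%:E = m [set x].
Proof. by rewrite /mass fineK// fin_num_measure. Qed.

Lemma mass_ge0 (m : probability T R) x : (0 <= mass m x)%R.
Proof. by rewrite -lee_fin massE. Qed.

Lemma esum_mass (m : probability T R) :
  \esum_(x in [set: T]) (mass m x)%:E = 1.
Proof.
by under eq_esum do rewrite massE; rewrite -measure_esum; exact: (@probability_setT _ _ _ m).
Qed.

Lemma measure_mass (m : probability T R) (A : set T) :
  m A = \esum_(x in A) (mass m x)%:E.
Proof. by under eq_esum do rewrite massE; exact: measure_esum. Qed.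

Lemma integral_mass (m : probability T R) (f : T -> \bar R) :
  (forall x, 0 <= f x) ->
  \int[m]_x f x = \esum_(x in [set: T]) (f x * (mass m x)%:E).
Proof. by move=> f0; rewrite integral_esum//; apply: eq_esum => x _; rewrite massE. Qed.

End countable_discrete.

Section bounded_functions.
Context (T : Type) (R : realType).

Lemma bounded_fun_normP (f : T -> R) :
  bounded_fun f <-> exists M, forall x, `|f x| <= M.
Proof.
split.
  by move=> [M [_ MP]]; exists (M + 1) => x; apply: MP => //; rewrite ltrDl.
by move=> [M MP]; exists M; split; [exact: num_real|move=> N MN x _ /=; exact: le_trans (MP x) (ltW MN)].
Qed.

Lemma bounded_funI (f : T -> R) M : (forall x, `|f x| <= M) -> bounded_fun f.
Proof. by move=> fM; apply/(bounded_fun_normP f); exists M. Qed.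

End bounded_functions.

Section product_space.
Context d (S : measurableType d) (R : realType).
Hypothesis countS : countable [set: S].
Hypothesis discS : forall A : set S, measurable A.

Lemma countable_product : countable [set: S * S].
Proof. by rewrite -setXTT; exact: countableX. Qed.

Lemma discrete_product (A : set (S * S)) : measurable A.
Proof.
apply: countable_measurable; last first.
  by apply: sub_countable countable_product; exact: subset_card_le.
move=> [x y]; rewrite -(_ : [set x] `*` [set y] = [set (x, y)]).
  exact: measurableX.
by apply/seteqP; split => [[a b] [/= -> ->]|[a b] [-> ->]].
Qed.

End product_space.

Section entropy_density.
Context (R : realType).
Implicit Types a b c t x q p : R.

(* Summed over two families of total mass 1 this is the relative entropy, with
   nonnegative terms; hence the term [- a + b]. *)
Definition entf a b := a * ln (a / b) - a + b.

Lemma ln_le_sub1 x : 0 < x -> ln x <= x - 1.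
Proof.
by move=> x0; rewrite -[x in leRHS](lnK x0) lerBrDl expR_ge1Dx.
Qed.

Lemma entf0l b : entf 0 b = b.
Proof. by rewrite /entf mul0r subr0 add0r. Qed.

Lemma entf_ge0 a b : 0 <= a -> 0 <= b -> (b = 0 -> a = 0) -> 0 <= entf a b.
Proof.
rewrite le_eqVlt => /predU1P[<- b0 _|a0 b0 ab].
  by rewrite entf0l.
have {}b0 : 0 < b by rewrite lt_def b0 andbT; apply/eqP => /ab a0'; rewrite a0' ltxx in a0.
have : ln (b / a) <= b / a - 1 by apply: ln_le_sub1; rewrite divr_gt0.
rewrite -(ler_pM2l a0) mulrBr mulr1 mulrCA divff ?gt_eqF// mulr1.
rewrite /entf -(invf_div b a) lnV ?posrE ?divr_gt0// mulrN.
lra.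
Qed.

Lemma entfM c a b : 0 <= c -> entf (c * a) (c * b) = c * entf a b.
Proof.
rewrite le_eqVlt => /predU1P[<-|c0]; first by rewrite !mul0r entf0l.
rewrite /entf -mulf_div divff ?gt_eqF// mul1r; ring.
Qed.

(** Chain rule for the entropy density. The correction terms are added on both sides instead of
    being subtracted, so that every summand is nonnegative and the identity can be summed over a
    countable set. *)
Lemma entf_prod a b q p : 0 <= a -> 0 <= b -> 0 <= q -> 0 <= p ->
  (b = 0 -> a = 0) -> (p = 0 -> q = 0) ->
  entf (a * q) (b * p) + (b * q + a * p) =
  (a * entf q p + q * entf a b) + (b * p + a * q).
Proof.
rewrite le_eqVlt => /predU1P[<- _ _ _ _ _|a0 b0 q0 p0 ab pq].
  rewrite !mul0r !entf0l; ring.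
have {}b0 : 0 < b by rewrite lt_def b0 andbT; apply/eqP => /ab a0'; rewrite a0' ltxx in a0.
move: q0; rewrite le_eqVlt => /predU1P[<-|q0].
  rewrite !(mulr0, mul0r) !entf0l; ring.
have {}p0 : 0 < p by rewrite lt_def p0 andbT; apply/eqP => /pq q0'; rewrite q0' ltxx in q0.
rewrite /entf -mulf_div (@lnM _ (a / b)) ?posrE ?divr_gt0//; ring.
Qed.

(** This is [entf_ge0] at the pair [a], [b * expR t]. The left side is linear in [a], and its
    supremum over [t] is [entf a b], so an entropy bound stated in this form survives coordinatewise
    limits. *)
Lemma entf_gibbs a b t : 0 <= a -> 0 <= b -> (b = 0 -> a = 0) ->
  t * a - b * (expR t - 1) <= entf a b.
Proof.
move=> a0 b0 ab.
have : 0 <= entf a (b * expR t).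
  apply: entf_ge0 => //; first by rewrite mulr_ge0// expR_ge0.
  by move/eqP; rewrite mulf_eq0 (gt_eqF (expR_gt0 t)) orbF => /eqP.
move: a0; rewrite le_eqVlt => /predU1P[<-|a0].
  rewrite !entf0l; lra.
have {}b0 : 0 < b by rewrite lt_def b0 andbT; apply/eqP => /ab a0'; rewrite a0' ltxx in a0.
rewrite /entf invfM mulrA lnM ?posrE ?divr_gt0 ?invr_gt0 ?expR_gt0//.
rewrite lnV ?posrE ?expR_gt0// expRK mulrBr; lra.
Qed.

(** Inverting [1 - t <= expR (- t)] reduces the claim to [0 <= t ^+ 2 * (1 - 2 * t)]. *)
Lemma expR_le_quadratic t : `|t| <= 2^-1 -> expR t <= 1 + t + 2 * t ^+ 2.
Proof.
rewrite ler_norml => /andP[t1 t2].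
have := expR_ge1Dx (- t); rewrite expRN => tt.
have t3 : 0 < 1 - t by lra.
have : expR t <= (1 - t)^-1.
  by rewrite -[expR t]invrK lef_pV2// posrE// invr_gt0 expR_gt0.
move=> /le_trans; apply; rewrite -div1r ler_pdivrMr//.
have : 0 <= t ^+ 2 * (1 - 2 * t) by rewrite mulr_ge0 ?sqr_ge0//; lra.
rewrite expr2; nra.
Qed.

(** Sum [entf_ge0] over the pairs [a i], [A / B * b i]: once [b] is rescaled to the total mass [A]
    of [a], the linear terms cancel. *)
Lemma log_sum (I : eqType) (s : seq I) (a b : I -> R) :
  (forall i, i \in s -> 0 <= a i) -> (forall i, i \in s -> 0 <= b i) ->
  (forall i, i \in s -> b i = 0 -> a i = 0) ->
  0 < \sum_(i <- s) a i ->
  (\sum_(i <- s) a i) * ln ((\sum_(i <- s) a i) / (\sum_(i <- s) b i)) <=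
  \sum_(i <- s) a i * ln (a i / b i).
Proof.
move=> a0 b0 ab A0; set A := \sum_(i <- s) a i; set B := \sum_(i <- s) b i.
have B0 : 0 < B.
  rewrite lt_def /B big_seq sumr_ge0 ?andbT//; apply/eqP => /eqP.
  rewrite psumr_eq0// => /allP h; move: A0; rewrite big_seq big1 ?ltxx// => i si.
  by apply: ab => //; apply/eqP; have := h _ si; rewrite si.
have : 0 <= \sum_(i <- s) entf (a i) (A / B * b i).
  rewrite big_seq sumr_ge0// => i si; apply: entf_ge0; [exact: a0| |].
    by rewrite mulr_ge0 ?b0// divr_ge0// ltW.
  move/eqP; rewrite mulf_eq0 gt_eqF ?divr_gt0//= => /eqP; exact: ab.
have -> : \sum_(i <- s) entf (a i) (A / B * b i) =
  \sum_(i <- s) a i * ln (a i / b i) - A * ln (A / B).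
  transitivity (\sum_(i <- s) ((a i * ln (a i / b i) + b i * (A / B)) - a i * (1 + ln (A/B)))).
    apply: eq_big_seq => i si; rewrite /entf.
    have := a0 _ si; rewrite le_eqVlt => /predU1P[<-|ai0].
      rewrite !mul0r; ring.
    have bi0 : 0 < b i.
      by rewrite lt_def b0// andbT; apply/eqP => /(ab _ si) ai; rewrite ai ltxx in ai0.
    have -> : a i / (A / B * b i) = (a i / b i) / (A / B).
      by rewrite invfM mulrA mulrAC.
    rewrite ln_div ?posrE ?divr_gt0//; ring.
  rewrite sumrB big_split/= -!mulr_suml -/A -/B mulrCA divff ?gt_eqF//; ring.
lra.
Qed.

Lemma neg_xlnx_le1 x : 0 <= x -> - (x * ln x) <= 1.
Proof.
move=> x0; have := @entf_ge0 x 1 x0 ler01; rewrite /entf divr1.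
have h : 1 = 0 :> R -> x = 0 by move/eqP; rewrite oner_eq0.
move=> /(_ h); lra.
Qed.

End entropy_density.

Section esum_list.
Context (R : realType) (I : choiceType).
Implicit Types (a : I -> R) (s : seq I).
Local Open Scope ereal_scope.

Lemma sum_le_esum a (D : set I) s : uniq s -> (forall x, x \in s -> D x) ->
  (forall x, D x -> 0 <= a x)%R ->
  (\sum_(x <- s) a x)%:E <= \esum_(x in D) (a x)%:E.
Proof.
move=> us sD a0; apply: esum_ge; exists [set` s].
  by split; [exact: finite_seq|move=> x /sD].
by rewrite -fsbig_seq//= sumEFin.
Qed.

Lemma esum_le_sum a (D : set I) (c : R) :
  (forall s, uniq s -> (forall x, x \in s -> D x) -> (\sum_(x <- s) a x <= c)%R) ->
  \esum_(x in D) (a x)%:E <= c%:E.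
Proof.
move=> h; apply: ge_ereal_sup => _ [A [finA AD] <-].
rewrite fsbig_finite//= sumEFin lee_fin; apply: h => //.
by move=> x; rewrite in_fset_set// inE => /AD.
Qed.

Lemma lt_esum_sum a (D : set I) (c : R) : c%:E < \esum_(x in D) (a x)%:E ->
  exists s, [/\ uniq s, forall x, x \in s -> D x & (c < \sum_(x <- s) a x)%R].
Proof.
move=> /ereal_sup_gt[_ [A [finA AD] <-]]; rewrite fsbig_finite//= sumEFin lte_fin => h.
exists (finmap.enum_fset (fset_set A)); split => //.
by move=> x; rewrite in_fset_set// inE => /AD.
Qed.

End esum_list.

(** Separation of points in the weak topology is about Leibniz equality of packed measures. Beyond
    the underlying function the fields are propositions, so proof irrelevance identifies them. *)
Lemma eq_probability d (T : measurableType d) (R : realType)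
  (mu nu : probability T R) : (forall A, mu A = nu A) -> mu = nu.
Proof.
move: mu nu => [f cf] [g cg] /= /funext fg; subst g; congr Probability.Pack.
move: cf cg => [[a1 a2] [a3] [a4] [a5] [a6] [a7] [a8]].
move=> [[b1 b2] [b3] [b4] [b5] [b6] [b7] [b8]].
have e1 := Prop_irrelevance a1 b1; have e2 := Prop_irrelevance a2 b2; subst b1 b2.
congr Probability.Class; by f_equal; exact: Prop_irrelevance.
Qed.

(** * Weak topology *)

Section weak_convergence.
Context d (T : measurableType d) (R : realType).
Hypothesis countT : countable [set: T].
Hypothesis discT : forall A : set T, measurable A.

Lemma pairing_continuous (V : T -> R) : bounded_fun V ->
  continuous (fun mu : probability T R => pairing mu V).
Proof.
move=> bV mu.
pose i : bounded_function T R := exist _ V bV.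
have : nbhs mu --> mu by exact: cvg_id.
move=> /cvg_sup/(_ i) h A /(@initial_continuous _ _ (fun m : probability T R => pairing m V)) /h.
exact.
Qed.

Lemma pairing_gt_open (V : T -> R) (c : R) : bounded_fun V ->
  open [set mu : probability T R | c < pairing mu V].
Proof.
move=> bV; have /continuousP := pairing_continuous bV.
by move=> /(_ _ (@open_gt R c)).
Qed.

Lemma pairingDr (mu : probability T R) (V : T -> R) c : bounded_fun V ->
  pairing mu (fun x => V x + c) = pairing mu V + c.
Proof.
move=> bV; rewrite /pairing RintegralD//; last 2 first.
- exact: bounded_integrable.
- apply: bounded_integrable => //.
  exact: (@bounded_funI _ _ _ `|c|).
by rewrite Rintegral_cst//= (@probability_setT _ _ _ mu) mulr1.
Qed.

Lemma pairingN (mu : probability T R) (V : T -> R) : bounded_fun V ->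
  pairing mu (fun x => - V x) = - pairing mu V.
Proof.
move=> bV; rewrite /pairing -[RHS]mulN1r -RintegralZl//; last exact: bounded_integrable.
by apply: eq_Rintegral => x _; rewrite mulN1r.
Qed.

Lemma pairing_esum (mu : probability T R) (V : T -> R) : bounded_fun V ->
  (forall x, 0 <= V x) ->
  (pairing mu V)%:E = \esum_(x in [set: T]) (V x * mass mu x)%:E.
Proof.
move=> bV V0; rewrite /pairing /Rintegral fineK; last first.
  by apply: integrable_fin_num => //; exact: bounded_integrable.
by rewrite integral_esum//; apply: eq_esum => x _; rewrite EFinM massE.
Qed.

(** Lower bounds alone suffice: since the total mass is one, lower bounds on finitely many points
    carrying most of [mu] leave little mass for anything else. Thus the lower estimate only has to
    count visits from below. *)
Definition mass_nbhs (mu : probability T R) : set_system (probability T R) :=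
  [set U | exists s : seq T, exists2 e, 0 < e &
    forall nu : probability T R,
      (forall x, x \in s -> mass mu x - e < mass nu x) -> U nu].

#[local] Instance mass_nbhs_filter mu : Filter (mass_nbhs mu).
Proof.
split.
- by exists [::], 1.
- move=> U V [s [e e0 sU]] [t [f f0 tV]]; exists (s ++ t), (Num.min e f).
    by rewrite lt_min e0.
  move=> nu h; split; [apply: sU|apply: tV] => x xs.
    apply: le_lt_trans (h x _); last by rewrite mem_cat xs.
    by rewrite lerD2l lerN2 ge_min lexx.
  apply: le_lt_trans (h x _); last by rewrite mem_cat xs orbT.
  by rewrite lerD2l lerN2 ge_min lexx orbT.
- by move=> U V UV [s [e e0 sU]]; exists s, e => // nu h; apply/UV/sU.
Qed.

Lemma mass_nbhs_pairing (mu : probability T R) (V : T -> R) e :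
  bounded_fun V -> 0 < e ->
  mass_nbhs mu [set nu | pairing mu V - e < pairing nu V].
Proof.
move=> bV e0; have /bounded_fun_normP[M VM] := bV.
(* For the nonnegative [W], a finite part of the sum is a lower bound of [pairing nu W], and it is
   controlled by the masses on [s]. *)
pose W x := V x + M.
have W0 x : 0 <= W x by have := VM x; rewrite ler_norml /W => /andP[? _]; lra.
have W2 x : W x <= 2 * M by have := VM x; rewrite ler_norml /W => /andP[_ ?]; lra.
have bW : bounded_fun W.
  by apply: (@bounded_funI _ _ _ (2 * M)) => x; rewrite ger0_norm.
have M0 : 0 <= M by rewrite (le_trans _ (VM point)).
have : ((pairing mu W - e / 2)%:E < (pairing mu W)%:E)%E.
  by rewrite lte_fin; lra.
rewrite [ltRHS]pairing_esum// => /lt_esum_sum[s [us _ sW]].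
pose N := (size s)%:R * (2 * M) + 1.
have N0 : 0 < N by rewrite ltr_wpDl// mulr_ge0// mulr_ge0.
exists s, (e / 2 / N); first by rewrite !divr_gt0.
move=> nu h /=.
suff : pairing mu W - e < pairing nu W.
  by rewrite !pairingDr//; lra.
rewrite -lte_fin [ltRHS]pairing_esum//.
apply: lt_le_trans (sum_le_esum us _ _) => //; last first.
  by move=> x _; rewrite mulr_ge0// mass_ge0.
rewrite lte_fin.
have : \sum_(x <- s) W x * mass mu x - \sum_(x <- s) W x * mass nu x <= e / 2.
  rewrite -sumrB; apply: (@le_trans _ _ (\sum_(x <- s) (2 * M) * (e / 2 / N))).
    rewrite big_seq [leRHS]big_seq; apply: ler_sum => x xs; rewrite -mulrBr.
    apply: (@le_trans _ _ (W x * (e / 2 / N))).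
      by rewrite ler_wpM2l//; have := h x xs; lra.
    by rewrite ler_wpM2r// ltW// !divr_gt0.
  rewrite big_const_seq count_predT iter_addr addr0 -[leLHS]mulr_natl.
  rewrite [leLHS]mulrA mulrA ler_pdivrMr// mulrC ler_wpM2l//; last by rewrite /N; lra.
  by rewrite ltW// divr_gt0.
lra.
Qed.

Lemma nbhs_mass (mu : probability T R) (U : set (probability T R)) :
  nbhs mu U -> mass_nbhs mu U.
Proof.
suff : mass_nbhs mu --> mu by exact.
apply/cvg_sup => -[V bV] A /=.
rewrite (@nbhsE (initial_topology _)) => -[B [[C oC <-] /= Cmu] BA].
have [e /= e0 eC] : exists2 e, 0 < e & forall r, `|pairing mu V - r| < e -> C r.
  have : nbhs (pairing mu V) C by apply: open_nbhs_nbhs.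
  by move=> /nbhs_ballP[e e0 eC]; exists e => // r /eC.
have bV' : bounded_fun (fun x => - V x).
  have /bounded_fun_normP[M VM] := bV.
  by apply: (@bounded_funI _ _ _ (M)) => x; rewrite normrN.
apply: (@filterS _ _ _ ([set nu | pairing mu V - e < pairing nu V] `&`
  [set nu | pairing mu (fun x => - V x) - e < pairing nu (fun x => - V x)])).
  move=> nu [/= h1 h2]; apply/BA/eC; move: h2; rewrite !pairingN// => h2.
  by rewrite ltr_norml; apply/andP; split; lra.
by apply: filterI; exact: mass_nbhs_pairing.
Qed.

Lemma bounded_fun_indic (A : set T) : bounded_fun (\1_A : T -> R).
Proof.
apply: (@bounded_funI _ _ _ (1)) => x; rewrite indicE.
by case: (_ \in _); rewrite ?normr1 ?normr0.
Qed.

Lemma pairing_indic (mu : probability T R) (A : set T) :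
  pairing mu \1_A = fine (mu A).
Proof. by rewrite /pairing /Rintegral integral_indic// setIT. Qed.

Lemma probability_hausdorff : hausdorff_space (probability T R).
Proof.
move=> mu nu clmn.
have mass_le (m n : probability T R) : cluster (nbhs m) n ->
    forall A, fine (n A) <= fine (m A).
  move=> cl A; rewrite leNgt; apply/negP => mn.
  (* The masses of [A] below and above this midpoint define disjoint open sets around [m] and
     [n]. *)
  pose c := (fine (m A) + fine (n A)) / 2.
  have [||k []] := cl [set k | - c < pairing k (fun x => - \1_A x)]
     [set k | c < pairing k \1_A].
  - apply: open_nbhs_nbhs; split.
      apply: pairing_gt_open; have /(bounded_fun_normP \1_A)[M VM] := bounded_fun_indic A.
      by apply: (@bounded_funI _ _ _ (M)) => x; rewrite normrN.
    by rewrite /= pairingN ?pairing_indic /c; [lra|exact: bounded_fun_indic].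
  - apply: open_nbhs_nbhs; split.
      by apply: pairing_gt_open; exact: bounded_fun_indic.
    by rewrite /= pairing_indic /c; lra.
  by rewrite /= pairingN; [lra|exact: bounded_fun_indic].
apply: eq_probability => A; apply/eqP; rewrite eq_le.
have cl2 : cluster (nbhs nu) mu by move=> B C nB nC; rewrite setIC; exact: clmn.
rewrite -[mu A]fineK ?fin_num_measure// -[nu A]fineK ?fin_num_measure//.
by rewrite !lee_fin !mass_le.
Qed.

End weak_convergence.

Section esum_extra.
Context (R : realType).
Local Open Scope ereal_scope.

Lemma esumZl (I : choiceType) (D : set I) (c : R) (a : I -> \bar R) :
  (0 <= c)%R -> (forall i, 0 <= a i) ->
  \esum_(i in D) (c%:E * a i) = c%:E * \esum_(i in D) a i.
Proof.
move=> c0 a0; rewrite /esum -ereal_supZl//; last first.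
  by apply/set0P; exists 0, set0; [exact: fsets_set0|rewrite fsbig_set0].
congr ereal_sup; rewrite image_comp; apply: eq_imagel => A [finA _] /=.
by rewrite ge0_mule_fsumr// => i; rewrite a0.
Qed.

Lemma esum_pair (I J : choiceType) (a : I -> J -> \bar R) :
  (forall i j, 0 <= a i j) ->
  \esum_(u in [set: I * J]) a u.1 u.2 =
  \esum_(i in [set: I]) \esum_(j in [set: J]) a i j.
Proof.
by move=> a0; rewrite esum_esum//; congr esum; apply/seteqP; split.
Qed.

Lemma esum_exchange (I J : choiceType) (a : I -> J -> \bar R) :
  (forall i j, 0 <= a i j) ->
  \esum_(i in [set: I]) \esum_(j in [set: J]) a i j =
  \esum_(j in [set: J]) \esum_(i in [set: I]) a i j.
Proof.
move=> a0; rewrite -!esum_pair//.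
rewrite (reindex_esum [set: J * I] [set: I * J] (fun u => (u.2, u.1)))//.
split => //; first by move=> [i j] [k l] _ _ [-> ->].
by move=> [i j] _; exists (j, i).
Qed.

Lemma esum_eq0 (I : choiceType) (a : I -> \bar R) (D : set I) : (forall i, 0 <= a i) ->
  \esum_(i in D) a i = 0 -> forall i, D i -> a i = 0.
Proof.
move=> a0 aD i Di; apply/eqP; rewrite eq_le a0 andbT -aD.
by rewrite -(@esum_set1 _ _ i a)//; apply: esum_ge; exists [set i];
  [split => // _ -> |rewrite fsbig_set1 esum_set1].
Qed.

End esum_extra.

(** * Relative entropy as a sum *)

Section relative_entropy.
Context d (T : measurableType d) (R : realType).
Hypothesis countT : countable [set: T].
Hypothesis discT : forall A : set T, measurable A.
Variables (nu : probability T R) (k : T -> R).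
Hypothesis k0 : forall u, 0 <= k u.
Hypothesis k1 : (\esum_(u in [set: T]) (k u)%:E = 1)%E.
Local Open Scope ereal_scope.
Let kappa (A : set T) := \esum_(u in A) (k u)%:E.

Lemma null_dominates_mass : nu `<< kappa <-> forall u, k u = 0%R -> mass nu u = 0%R.
Proof.
split=> [nuk u ku|nuk A kA B _ BA].
  have : kappa.-null_set [set u].
    move=> A _ Au; rewrite /kappa esum1// => i /Au ->; by rewrite ku.
  by move=> /nuk/(_ [set u] (discT _)) /(_ (@subset_refl _ _)); rewrite /mass => ->.
rewrite measure_esum// esum1// => u Bu.
rewrite (_ : _ [set u] = (mass nu u)%:E); last by rewrite massE.
rewrite nuk//.
have uA : [set u] `<=` A by move=> _ ->; exact: BA.
by have := kA [set u] (discT _) uA; rewrite /kappa esum_set1 ?lee_fin// => -[].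
Qed.

(** The integral is a difference of two sums. The negative part is at most the total mass of [k],
    because [a * ln (a / b) >= a - b]; being finite, it can be moved to the other side, where all
    terms are nonnegative. *)
Lemma integral_log_ratio : (forall u, k u = 0%R -> mass nu u = 0%R) ->
  \int[nu]_u (ln (mass nu u / k u))%:E =
  \esum_(u in [set: T]) (entf (mass nu u) (k u))%:E.
Proof.
move=> ac; set g := fun u => (ln (mass nu u / k u))%:E.
have m0 := @mass_ge0 _ _ R discT nu.
rewrite integralE !integral_mass//.
set A := \esum_(x in _) (g^\+ x * _); set B := \esum_(x in _) (g^\- x * _).
set H := \esum_(x in _) _.
have H0 : 0 <= H by apply: esum_ge0 => u _; rewrite lee_fin entf_ge0//; exact: ac.
have B0 : 0 <= B by apply: esum_ge0 => u _; rewrite mule_ge0 ?lee_fin//.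
have Blt : B \is a fin_num.
  rewrite ge0_fin_numE//; apply: (@le_lt_trans _ _ 1); last exact: ltry.
  rewrite -k1; apply: le_esum => u _; rewrite /g funenegE/=.
  have [mu0|mu0] := eqVneq (mass nu u) 0%R; first by rewrite mu0 mule0 lee_fin.
  rewrite -EFin_max -EFinM lee_fin.
  have := m0 u; rewrite le_eqVlt eq_sym (negbTE mu0)/= => {}mu0.
  have ku0 : (0 < k u)%R.
    by rewrite lt_def k0 andbT; apply/eqP => /ac mu0'; rewrite mu0' ltxx in mu0.
  have [_|h] := leP (- ln (mass nu u / k u))%R 0%R; first by rewrite mul0r.
  have := @entf_ge0 _ _ _ (ltW mu0) (ltW ku0) (@ac u); rewrite /entf; nra.
(* The [1] on the left is the mass of [k], the one on the right the mass of [nu]; termwise this is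
   the definition of [entf]. *)
have : A + 1 = H + 1 + B.
  rewrite -[in LHS]k1 -[in RHS](esum_mass countT discT nu).
  have e0 u : 0 <= (entf (mass nu u) (k u))%:E.
    by rewrite lee_fin entf_ge0//; exact: ac.
  have p0 u : 0 <= g^\+ u * (mass nu u)%:E by rewrite mule_ge0 ?lee_fin.
  have n0 u : 0 <= g^\- u * (mass nu u)%:E by rewrite mule_ge0 ?lee_fin.
  rewrite -!esumD//;
    try (by move=> u _; rewrite adde_ge0 ?e0 ?lee_fin);
    try (by move=> u _; rewrite lee_fin).
  apply: eq_esum => u _; rewrite /g funeposE funenegE/=.
  rewrite -!EFin_max -!EFinM -!EFinD; congr EFin.
  rewrite /entf; case: (leP 0%R (ln (mass nu u / k u))%R) => h.
    by rewrite max_r ?oppr_le0//; ring.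
  by rewrite max_l ?oppr_ge0 1?ltW//; ring.
rewrite addeAC => /(congr1 (fun z => z - 1)).
by rewrite !addeK// => ->; rewrite addeK.
Qed.

Lemma rel_entropyE : rel_entropy nu kappa =
  if `[< forall u, k u = 0%R -> mass nu u = 0%R >]
  then \esum_(u in [set: T]) (entf (mass nu u) (k u))%:E else +oo.
Proof.
rewrite /rel_entropy; have -> : `[< nu `<< kappa >] =
    `[< forall u, k u = 0%R -> mass nu u = 0%R >].
  by apply: asbool_equiv_eq; exact: null_dominates_mass.
case: asboolP => // ac; rewrite -integral_log_ratio//.
apply: eq_integral => u _; rewrite /mass /kappa esum_set1 ?lee_fin//=.
Qed.

End relative_entropy.

Section kernel_masses.
Context d (S : measurableType d) (R : realType).
Variable p : R.-pker S ~> S.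

(** A constant to which a probability structure can be attached, so that [mass], [pairing] and their
    lemmas apply to the rows of [p]. *)
Definition kernel_at (x : S) : set S -> \bar R := p x.

HB.instance Definition _ x := Measure.on (kernel_at x).

Let kernel_at_setT x : kernel_at x [set: S] = 1%E.
Proof. exact: prob_kernel. Qed.

HB.instance Definition _ x :=
  Measure_isProbability.Build _ _ _ (kernel_at x) (kernel_at_setT x).

Definition pmass (x y : S) : R := mass (kernel_at x) y.

End kernel_masses.

Section pair_entropy.
Context d (S : measurableType d) (R : realType).
Hypothesis countS : countable [set: S].
Hypothesis discS : forall A : set S, measurable A.
Variable p : R.-pker S ~> S.

Lemma pmassE x y : (pmass p x y)%:E = p x [set y].
Proof. exact: (massE discS (kernel_at p x)). Qed.

Lemma pmass_ge0 x y : 0 <= pmass p x y.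
Proof. exact: (mass_ge0 discS (kernel_at p x)). Qed.

Lemma esum_pmass x : (\esum_(y in [set: S]) (pmass p x y)%:E = 1)%E.
Proof. exact: (esum_mass countS discS (kernel_at p x)). Qed.

Lemma pmass_gt0 x y : (0 < pmass p x y) = (0 < p x [set y])%E.
Proof. by rewrite -pmassE lte_fin. Qed.

Lemma esum_kernel_product (mu : probability S R) :
  (\esum_(u in [set: S * S]) (mass mu u.1 * pmass p u.1 u.2)%:E = 1)%E.
Proof.
rewrite (esum_pair (a := fun x y => (mass mu x * pmass p x y)%:E)); last first.
  by move=> x y; rewrite lee_fin mulr_ge0 ?pmass_ge0 ?mass_ge0.
rewrite -(esum_mass countS discS mu); apply: eq_esum => x _.
under eq_esum do rewrite EFinM.
by rewrite esumZl ?esum_pmass ?mule1 ?mass_ge0// => y; rewrite lee_fin pmass_ge0.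
Qed.

Section balanced_pairs.
Variables (mu : probability S R) (nu : probability (S * S)%type R).
Hypothesis nu1 : marginal1 nu = mu :> (set S -> \bar R).

Lemma esum_marginal1 x :
  (\esum_(y in [set: S]) (mass nu (x, y))%:E = (mass mu x)%:E)%E.
Proof.
rewrite massE// -nu1 /marginal1 (measure_esum (countable_product countS) (discrete_product countS discS)).
rewrite (reindex_esum [set: S] ([set x] `*` [set: S]) (fun y => (x, y))).
  by apply: eq_esum => y _; rewrite massE//; exact: discrete_product.
by split => // [a b _ _ [//]|[a b] [/= -> _]]; exists b.
Qed.

Lemma esum_marginal2 y : balanced nu ->
  (\esum_(x in [set: S]) (mass nu (x, y))%:E = (mass mu y)%:E)%E.
Proof.
move=> bal; rewrite massE// -nu1 /marginal1 bal.
rewrite (measure_esum (countable_product countS) (discrete_product countS discS)).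
rewrite (reindex_esum [set: S] ([set: S] `*` [set y]) (fun x => (x, y))).
  by apply: eq_esum => x _; rewrite massE//; exact: discrete_product.
by split => // [a b _ _ [//]|[a b] [/= _ ->]]; exists a.
Qed.

Lemma R2E : R2 p nu =
  if `[< forall u, mass mu u.1 * pmass p u.1 u.2 = 0 -> mass nu u = 0 >]
  then (\esum_(u in [set: S * S])
     (entf (mass nu u) (mass mu u.1 * pmass p u.1 u.2))%:E)%E else +oo%E.
Proof.
rewrite /R2 nu1 -rel_entropyE.
- congr rel_entropy; apply/funext => A; apply: eq_esum => u _.
  by rewrite EFinM pmassE massE.
- exact: countable_product.
- exact: discrete_product.
- by move=> u; rewrite mulr_ge0 ?pmass_ge0 ?mass_ge0.
- exact: esum_kernel_product.
Qed.

End balanced_pairs.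

End pair_entropy.

Section bounded_closure.
Context (T : Type) (R : realType).
Implicit Types f g : T -> R.

Lemma bounded_fun_cst (c : R) : bounded_fun (fun _ : T => c).
Proof. exact: (@bounded_funI _ _ _ `|c|). Qed.

Lemma bounded_fun_add f g : bounded_fun f -> bounded_fun g ->
  bounded_fun (fun x => f x + g x).
Proof.
move=> /(bounded_fun_normP f)[M fM] /(bounded_fun_normP g)[N gN].
apply: (@bounded_funI _ _ _ (M + N)) => x.
by apply: le_trans (ler_normD _ _) _; exact: lerD.
Qed.

Lemma bounded_fun_mul f g : bounded_fun f -> bounded_fun g ->
  bounded_fun (fun x => f x * g x).
Proof.
move=> /(bounded_fun_normP f)[M fM] /(bounded_fun_normP g)[N gN].
apply: (@bounded_funI _ _ _ (M * N)) => x.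
by rewrite normrM ler_pM.
Qed.

Lemma bounded_fun_opp f : bounded_fun f -> bounded_fun (fun x => - f x).
Proof.
move=> /(bounded_fun_normP f)[M fM].
by apply: (@bounded_funI _ _ _ M) => x; rewrite normrN.
Qed.

Lemma bounded_fun_sum (I : Type) (s : seq I) (F : I -> T -> R) :
  (forall i, bounded_fun (F i)) -> bounded_fun (fun x => \sum_(i <- s) F i x).
Proof.
move=> bF; elim: s => [|i s IH].
  rewrite (_ : (fun x => _) = (fun=> 0)); first exact: bounded_fun_cst.
  by apply/funext => x; rewrite big_nil.
rewrite (_ : (fun x => _) = (fun x => F i x + \sum_(j <- s) F j x)).
  exact: bounded_fun_add.
by apply/funext => x; rewrite big_cons.
Qed.

End bounded_closure.

Section pairing_linear.
Context d (T : measurableType d) (R : realType).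
Hypothesis discT : forall A : set T, measurable A.
Variable m : probability T R.
Implicit Types f g : T -> R.

Lemma pairing_cst c : pairing m (fun=> c) = c.
Proof. by rewrite /pairing Rintegral_cst//= (@probability_setT _ _ _ m) mulr1. Qed.

Lemma pairingD f g : bounded_fun f -> bounded_fun g ->
  pairing m (fun x => f x + g x) = pairing m f + pairing m g.
Proof. by move=> bf bg; rewrite /pairing RintegralD//; exact: bounded_integrable. Qed.

Lemma pairingZ c f : bounded_fun f ->
  pairing m (fun x => c * f x) = c * pairing m f.
Proof. by move=> bf; rewrite /pairing RintegralZl//; exact: bounded_integrable. Qed.

Lemma pairing_sum (I : Type) (s : seq I) (F : I -> T -> R) :
  (forall i, bounded_fun (F i)) ->
  pairing m (fun x => \sum_(i <- s) F i x) = \sum_(i <- s) pairing m (F i).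
Proof.
move=> bF; elim: s => [|i s IH].
  rewrite big_nil (_ : (fun x => _) = (fun=> 0)) ?pairing_cst//.
  by apply/funext => x; rewrite big_nil.
rewrite big_cons (_ : (fun x => _) = (fun x => F i x + \sum_(j <- s) F j x)).
  by rewrite pairingD ?IH//; exact: bounded_fun_sum.
by apply/funext => x; rewrite big_cons.
Qed.

Lemma le_pairing f g : bounded_fun f -> bounded_fun g ->
  (forall x, f x <= g x) -> pairing m f <= pairing m g.
Proof. by move=> bf bg fg; apply: le_Rintegral => //; exact: bounded_integrable. Qed.

Lemma pairing_indic1 x : pairing m \1_[set x] = mass m x.
Proof. by rewrite pairing_indic. Qed.

End pairing_linear.

Section finitely_supported.
Context (T : choiceType) (R : realType).
Variable s : seq T.
Hypothesis us : uniq s.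

Lemma support_sum (g : T -> R) : (forall x, x \notin s -> g x = 0) ->
  g = (fun x => \sum_(y <- s) g y * \1_[set y] x).
Proof.
move=> gs; apply/funext => x.
have [xs|xs] := boolP (x \in s).
  rewrite (bigD1_seq x)//= big1 ?addr0; last first.
    move=> y yx; rewrite indicE memNset ?mulr0//= => xy.
    by rewrite xy eqxx in yx.
  by rewrite indicE mem_set// mulr1.
rewrite gs// big_seq big1// => y ys; rewrite indicE memNset ?mulr0//= => xy.
by rewrite xy ys in xs.
Qed.

Lemma bounded_support (g : T -> R) : (forall x, x \notin s -> g x = 0) -> bounded_fun g.
Proof.
move=> /support_sum ->; apply: bounded_fun_sum => y; apply: bounded_fun_mul.
  exact: bounded_fun_cst.
apply: (@bounded_funI _ _ _ 1) => x; rewrite indicE.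
by case: (_ \in _); rewrite ?normr1 ?normr0.
Qed.

End finitely_supported.

(** * Tilted kernels and the inequality R1 <= J1 *)

(** Arithmetic of one coordinate step in [near_maximizer]: [a] and [a'] are the free energies before
    and after a move by [t], [e * b] is the penalty, [v] the distance to the supremum, and [m - n]
    the gradient to be bounded. *)
Lemma penalty_step (R : realType) (a a' b e t g m n u v : R) :
  a' - e * (b + 2 * t * g + t ^+ 2) <= a - e * b + v -> a + t * m - u <= a' ->
  u <= t * n + 2 * t ^+ 2 -> e * t ^+ 2 <= t ^+ 2 ->
  t * (m - n) <= 2 * e * t * g + 3 * t ^+ 2 + v.
Proof. lra. Qed.

Section tilted_kernel.
Context d (S : measurableType d) (R : realType).
Hypothesis countS : countable [set: S].
Hypothesis discS : forall A : set S, measurable A.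
Variables (p : R.-pker S ~> S) (mu : probability S R).
Implicit Types (g : S -> R) (x y : S).

Definition ptilt g x := pairing (kernel_at p x) (fun y => expR (g y)).

Definition tilt g x y := pmass p x y * expR (g y) / ptilt g x.

(** The functional maximized in [J1], at [f = expR g]. In this variable it is concave. *)
Definition free_energy g := pairing mu (fun x => g x - ln (ptilt g x)).

Lemma bounded_expR g : bounded_fun g -> bounded_fun (fun y => expR (g y)).
Proof.
move=> /(bounded_fun_normP g)[M gM]; apply: (@bounded_funI _ _ _ (expR M)) => x.
by rewrite ger0_norm ?expR_ge0// ler_expR (le_trans _ (gM x))// ler_norm.
Qed.

Lemma ptilt_bounds g M : (forall y, `|g y| <= M) ->
  forall x, expR (- M) <= ptilt g x <= expR M.
Proof.
move=> gM x; have bg : bounded_fun g by exact: bounded_funI gM.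
have h y : expR (- M) <= expR (g y) <= expR M.
  by rewrite !ler_expR -ler_norml.
apply/andP; split.
  rewrite -(pairing_cst discS (kernel_at p x) (expR (- M))).
  apply: le_pairing => //; [exact: bounded_fun_cst|exact: bounded_expR|].
  by move=> y; have /andP[] := h y.
rewrite -(pairing_cst discS (kernel_at p x) (expR M)).
apply: le_pairing => //; [exact: bounded_expR|exact: bounded_fun_cst|].
by move=> y; have /andP[] := h y.
Qed.

Lemma ptilt_gt0 g x : bounded_fun g -> 0 < ptilt g x.
Proof.
move=> /(bounded_fun_normP g)[M /ptilt_bounds/(_ x)/andP[h _]].
exact: lt_le_trans (expR_gt0 _) h.
Qed.

Lemma bounded_ln_ptilt g : bounded_fun g -> bounded_fun (fun x => ln (ptilt g x)).
Proof.
move=> bg; have /(bounded_fun_normP g)[M gM] := bg.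
apply: (@bounded_funI _ _ _ M) => x; have /andP[h1 h2] := ptilt_bounds gM x.
have Z0 := ptilt_gt0 x bg.
rewrite ler_norml -ler_expR lnK ?posrE// h1 /=.
by rewrite -ler_expR lnK ?posrE.
Qed.

Lemma tilt_ge0 g x y : bounded_fun g -> 0 <= tilt g x y.
Proof.
by move=> bg; rewrite divr_ge0 ?mulr_ge0 ?expR_ge0 ?pmass_ge0// ltW// ptilt_gt0.
Qed.

Lemma esum_tilt g x : bounded_fun g ->
  (\esum_(y in [set: S]) (tilt g x y)%:E = 1)%E.
Proof.
move=> bg; have Z0 := ptilt_gt0 x bg.
under eq_esum do rewrite /tilt mulrC [pmass _ _ _ * _]mulrC EFinM.
rewrite esumZl ?invr_ge0 ?ltW//; last first.
  by move=> y; rewrite lee_fin mulr_ge0 ?expR_ge0// pmass_ge0.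
have := pairing_esum countS discS (kernel_at p x) (bounded_expR bg) (fun _ => expR_ge0 _).
by rewrite -/(ptilt g x) => <-; rewrite -EFinM mulVf// gt_eqF.
Qed.

Lemma tilt_le1 g x y : bounded_fun g -> tilt g x y <= 1.
Proof.
move=> bg; rewrite -lee_fin -(esum_tilt x bg).
rewrite -[leLHS](@esum_set1 _ _ y (fun y => (tilt g x y)%:E)) ?lee_fin ?tilt_ge0//.
rewrite esum_mkcond; apply: le_esum => z _; case: ifP => // _.
by rewrite lee_fin tilt_ge0.
Qed.

Lemma bounded_tilt g y : bounded_fun g -> bounded_fun (fun x => tilt g x y).
Proof.
move=> bg; apply: (@bounded_funI _ _ _ 1) => x.
by rewrite ger0_norm ?tilt_ge0// tilt_le1.
Qed.

(** Second marginal of the pair measure with masses [mass mu x * tilt g x y], whose first marginal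
    is [mu]. The derivative of [free_energy] in the coordinate [g y] is [mass mu y - tilt2 g y], so
    a critical point would give a balanced pair measure. *)
Definition tilt2 g y := pairing mu (fun x => tilt g x y).

Lemma tilt2_ge0 g y : bounded_fun g -> 0 <= tilt2 g y.
Proof. by move=> bg; apply: Rintegral_ge0 => x _; exact: tilt_ge0. Qed.

Lemma tilt2_le1 g y : bounded_fun g -> tilt2 g y <= 1.
Proof.
move=> bg; rewrite -(pairing_cst discS mu 1).
apply: le_pairing => //; [exact: bounded_tilt|exact: bounded_fun_cst|].
by move=> x; exact: tilt_le1.
Qed.

Lemma esum_tilt2 g y : bounded_fun g ->
  (\esum_(x in [set: S]) (mass mu x * tilt g x y)%:E = (tilt2 g y)%:E)%E.
Proof.
move=> bg; rewrite pairing_esum//; last by move=> x; exact: tilt_ge0.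
  by apply: eq_esum => x _; rewrite mulrC.
exact: bounded_tilt.
Qed.

Lemma ptilt_perturb g t y x : bounded_fun g ->
  ptilt (fun z => g z + t * \1_[set y] z) x =
  ptilt g x * (1 + (expR t - 1) * tilt g x y).
Proof.
move=> bg; have Z0 := ptilt_gt0 x bg.
have -> : ptilt g x * (1 + (expR t - 1) * tilt g x y) =
    ptilt g x + ((expR t - 1) * expR (g y)) * pmass p x y.
  by rewrite /tilt; field; rewrite gt_eqF.
rewrite -[pmass p x y]/(mass (kernel_at p x) y) -pairing_indic1//.
rewrite -pairingZ//; last exact: bounded_fun_indic.

rewrite -pairingD//; last 2 first.
- exact: bounded_expR.
- by apply: bounded_fun_mul; [exact: bounded_fun_cst|exact: bounded_fun_indic].
congr pairing; apply/funext => z; rewrite expRD indicE.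
have [->|zy] := eqVneq z y.
  by rewrite mem_set// !mulr1; ring.
by rewrite memNset ?mulr0 ?expR0 ?addr0 ?mulr1//= => /eqP; rewrite (negbTE zy).
Qed.

(** The move multiplies [ptilt g x] by [1 + (expR t - 1) * tilt g x y], and the logarithm of this
    factor is at most the factor minus one. *)
Lemma free_energy_perturb g t y : bounded_fun g ->
  free_energy g + t * mass mu y - (expR t - 1) * tilt2 g y <=
  free_energy (fun z => g z + t * \1_[set y] z).
Proof.
move=> bg; have bi : bounded_fun (fun z => t * \1_[set y] z).
  by apply: bounded_fun_mul; [exact: bounded_fun_cst|exact: bounded_fun_indic].
have bt : bounded_fun (fun x => - ((expR t - 1) * tilt g x y)).
  by apply/bounded_fun_opp/bounded_fun_mul; [exact: bounded_fun_cst|exact: bounded_tilt].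
have bf h : bounded_fun h -> bounded_fun (fun x => h x - ln (ptilt h x)).
  by move=> bh; apply: bounded_fun_add => //; apply: bounded_fun_opp; exact: bounded_ln_ptilt.
have bg' : bounded_fun (fun z => g z + t * \1_[set y] z) by exact: bounded_fun_add.
rewrite /free_energy -(pairing_indic1 discS mu) -pairingZ//; last exact: bounded_fun_indic.
rewrite -pairingD//; last exact: bf.
rewrite /tilt2 -pairingZ//; last exact: bounded_tilt.
rewrite -pairingN//; last by apply: bounded_fun_mul; [exact: bounded_fun_cst|exact: bounded_tilt].
rewrite -pairingD//; last by apply: bounded_fun_add => //; exact: bf.
apply: le_pairing => //.
- by apply: bounded_fun_add => //; apply: bounded_fun_add => //; exact: bf.
- exact: bf.
move=> x; have Z0 := ptilt_gt0 x bg; have := ptilt_gt0 x bg'.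
rewrite ptilt_perturb// pmulr_rgt0// => q0.
rewrite lnM ?posrE//.
have := ln_le_sub1 q0; lra.
Qed.

Lemma free_energy0 : free_energy (fun=> 0) = 0.
Proof.
rewrite /free_energy; under [X in pairing _ X]eq_fun do
  rewrite /ptilt expR0 pairing_cst// ln1 subr0.
by rewrite pairing_cst.
Qed.

Section tilt_entropy.
Variables (g : S -> R) (s : seq S).
Hypothesis us : uniq s.
Hypothesis gs : forall x, x \notin s -> g x = 0.

Let bg : bounded_fun g. Proof. exact: bounded_support gs. Qed.

Let tilt_entf x y : entf (tilt g x y) (pmass p x y) =
  (expR (g y) * g y / ptilt g x - (1 + ln (ptilt g x)) / ptilt g x * expR (g y) + 1)
  * pmass p x y.
Proof.
have Z0 := ptilt_gt0 x bg.
rewrite -[X in entf _ X]mulr1 /tilt -mulrA entfM ?pmass_ge0// mulrC; congr (_ * _).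
rewrite /entf divr1 ln_div ?posrE ?expR_gt0// expRK; ring.
Qed.

Lemma esum_tilt_entf x :
  (\esum_(y in [set: S]) (entf (tilt g x y) (pmass p x y))%:E =
  (\sum_(y <- s) tilt g x y * g y - ln (ptilt g x))%:E)%E.
Proof.
have Z0 := ptilt_gt0 x bg; have bE := bounded_expR bg.
have b1 : bounded_fun (fun y => expR (g y) * g y / ptilt g x).
  by apply: bounded_fun_mul; [exact: bounded_fun_mul|exact: bounded_fun_cst].
have b2 : bounded_fun (fun y => (1 + ln (ptilt g x)) / ptilt g x * expR (g y)).
  by apply: bounded_fun_mul => //; exact: bounded_fun_cst.
have b3 : bounded_fun (fun y => expR (g y) * g y / ptilt g x -
    (1 + ln (ptilt g x)) / ptilt g x * expR (g y)).
  by apply: bounded_fun_add => //; exact: bounded_fun_opp.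
under eq_esum do rewrite tilt_entf.
rewrite -(pairing_esum countS discS (kernel_at p x)); last 2 first.
- by apply: bounded_fun_add => //; exact: bounded_fun_cst.
- move=> y.
  have := @entf_ge0 _ (expR (g y) / ptilt g x) 1; rewrite /entf divr1.
  rewrite ln_div ?posrE ?expR_gt0// expRK => h.
  have {}h : 0 <= expR (g y) / ptilt g x * (g y - ln (ptilt g x)) -
      expR (g y) / ptilt g x + 1.
    apply: h => //; first by rewrite divr_ge0 ?expR_ge0// ltW.
    by move/eqP; rewrite oner_eq0.
  apply: le_trans h _; rewrite le_eqVlt; apply/orP; left; apply/eqP; ring.
congr EFin; rewrite pairingDr// pairingD//; last exact: bounded_fun_opp.
rewrite pairingN// pairingZ// -/(ptilt g x).
have -> : pairing (kernel_at p x) (fun y => expR (g y) * g y / ptilt g x) =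
    \sum_(y <- s) tilt g x y * g y.
  rewrite (@support_sum _ _ s us (fun y => expR (g y) * g y / ptilt g x)); last first.
    by move=> y /gs ->; rewrite mulr0 mul0r.
  rewrite pairing_sum//; last first.
    by move=> y; apply: bounded_fun_mul; [exact: bounded_fun_cst|exact: bounded_fun_indic].
  apply: eq_bigr => y _; rewrite pairingZ ?pairing_indic1//; last exact: bounded_fun_indic.
  by rewrite /tilt /pmass; ring.
by field; rewrite gt_eqF.
Qed.

(** The log-density of [tilt] with respect to [p] is [g y - ln (ptilt g x)]. Averaging it gives the
    free energy, except that [g] is integrated against the second marginal instead of [mu]; the sum
    is that defect of balance. *)
Lemma tilt_entropy :
  (\esum_(u in [set: S * S])
    (entf (mass mu u.1 * tilt g u.1 u.2) (mass mu u.1 * pmass p u.1 u.2))%:E =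
  (free_energy g + \sum_(y <- s) (tilt2 g y - mass mu y) * g y)%:E)%E.
Proof.
have e0 x y : 0 <= entf (tilt g x y) (pmass p x y).
  apply: entf_ge0; [exact: tilt_ge0|exact: pmass_ge0|].
  by rewrite /tilt => ->; rewrite !mul0r.
under eq_esum do rewrite entfM ?mass_ge0//.
rewrite (esum_pair (a := fun x y => (mass mu x * entf (tilt g x y) (pmass p x y))%:E)); last first.
  by move=> x y; rewrite lee_fin mulr_ge0 ?mass_ge0.
have e1 x : 0 <= \sum_(y <- s) tilt g x y * g y - ln (ptilt g x).
  by rewrite -lee_fin -esum_tilt_entf esum_ge0// => y _; rewrite lee_fin.
transitivity (\esum_(x in [set: S])
  ((\sum_(y <- s) tilt g x y * g y - ln (ptilt g x)) * mass mu x)%:E)%E.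
  apply: eq_esum => x _; under eq_esum do rewrite EFinM.
  rewrite esumZl ?mass_ge0//; last by move=> y; rewrite lee_fin.
  by rewrite esum_tilt_entf -EFinM mulrC.
have bl := bounded_ln_ptilt bg.
have bs : bounded_fun (fun x => \sum_(y <- s) tilt g x y * g y).
  apply: bounded_fun_sum => y; apply: bounded_fun_mul; [exact: bounded_tilt|exact: bounded_fun_cst].
rewrite -(pairing_esum countS discS mu)//; last first.
  by apply: bounded_fun_add => //; exact: bounded_fun_opp.
congr EFin; rewrite /free_energy !pairingD//; try exact: bounded_fun_opp.
have -> : pairing mu g = \sum_(y <- s) mass mu y * g y.
  rewrite {1}(support_sum us gs) pairing_sum//; last first.
    by move=> y; apply: bounded_fun_mul; [exact: bounded_fun_cst|exact: bounded_fun_indic].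
  by apply: eq_bigr => y _; rewrite pairingZ ?pairing_indic1 1?mulrC//; exact: bounded_fun_indic.
rewrite pairing_sum//; last first.
  by move=> y; apply: bounded_fun_mul; [exact: bounded_tilt|exact: bounded_fun_cst].
rewrite addrAC; congr (_ + _); rewrite -big_split/=; apply: eq_bigr => y _.
under [X in pairing _ X]eq_fun do rewrite mulrC.
by rewrite pairingZ//; [rewrite -/(tilt2 g y); ring|exact: bounded_tilt].
Qed.

End tilt_entropy.

(* The quadratic penalty keeps a near maximizer of the free energy bounded, and
   near maximality in each coordinate direction makes both the gradient
   [mass mu y - tilt2 g y] and its pairing with [g] small. *)
Lemma near_maximizer (j : R) (s : seq S) (eta : R) :
  (forall g, bounded_fun g -> free_energy g <= j) -> uniq s -> 0 < eta ->
  exists g, [/\ forall x, x \notin s -> g x = 0,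
  forall y, y \in s -> `|tilt2 g y - mass mu y| <= eta &
  free_energy g + \sum_(y <- s) (tilt2 g y - mass mu y) * g y <= j + eta].
Proof.
move=> fej us eta0; have j0 : 0 <= j by rewrite -free_energy0 fej//; exact: bounded_fun_cst.
(* The penalty [eps * g y ^+ 2] bounds [g y ^+ 2] only by [(j + 1) / eps], while its own gradient
   [2 * eps * g y] must stay below [eta / 2]. With [eps = eta / (4 * K)] the first bound is [A * K],
   and [K >= A] turns it into [K ^+ 2]; then [2 * eps * K] is exactly [eta / 2]. *)
have [A [A0 AE]] : exists A : R, 0 <= A /\ A = 4 * (j + 1) / eta.
  exists (4 * (j + 1) / eta); split=> //.
  by rewrite divr_ge0 ?ltW// mulr_gt0// ltr_wpDl.
pose K := A + eta + 1.
have K0 : 0 < K by rewrite /K; lra.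
pose eps := eta / (4 * K).
have eps0 : 0 < eps by rewrite divr_gt0// mulr_gt0.
have eps1 : eps <= 1 by rewrite ler_pdivrMr ?mulr_gt0// /K; lra.
have epsK : 2 * eps * K <= eta / 2.
  by rewrite /eps le_eqVlt; apply/orP; left; apply/eqP; field; rewrite gt_eqF.
have epsV : eps^-1 * (j + 1) = A * K.
  by rewrite /eps AE; field; rewrite !gt_eqF.
have AK : A <= K by rewrite /K; lra.
clearbody eps K.
pose N : R := (size s)%:R.
have N0 : 0 <= N by exact: ler0n.
(* Trial moves have size [sg], and [g] is chosen within [sg ^+ 2] of the supremum, so dividing by
   [sg] leaves an error [4 * sg] in the gradient. The three bounds serve [expR_le_quadratic], the
   gradient, and the sum over [s] of the errors [4 * sg * K]. *)
pose sg := Num.min (2^-1) (Num.min (eta / 8) (eta / (4 * (N + 1) * K))).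
have sg0 : 0 < sg.
  rewrite !lt_min invr_gt0 ltr0n/= !divr_gt0// !mulr_gt0//; lra.
have sg1 : sg <= 2^-1 by rewrite ge_min lexx.
have sg2 : sg <= eta / 8 by rewrite !ge_min lexx orbT.
have sg3 : sg <= eta / (4 * (N + 1) * K) by rewrite !ge_min lexx !orbT.
clearbody sg.
pose psi g := free_energy g - eps * \sum_(y <- s) g y ^+ 2.
pose supported g := forall x, x \notin s -> g x = 0.
pose E := [set psi g | g in supported].
have psi_j g : supported g -> psi g <= j.
  move=> gs; have := fej _ (bounded_support us gs).
  have : 0 <= eps * \sum_(y <- s) g y ^+ 2.
    apply: mulr_ge0; first exact: ltW.
    by apply: sumr_ge0 => y _; exact: sqr_ge0.
  rewrite /psi; lra.
have psi0 : psi (fun=> 0) = 0.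
  by rewrite /psi free_energy0 big1 ?mulr0 ?subr0// => y _; rewrite expr0n.
have supE : has_sup E.
  split; first by exists 0, (fun=> 0).
  by exists j => _ [g gs <-]; exact: psi_j.
have [_ [g gs <-] gsup] := sup_adherent (exprn_gt0 2 sg0) supE.
have bg := bounded_support us gs.
have psi_g h : supported h -> psi h <= psi g + sg ^+ 2.
  move=> hs; rewrite -lerBlDr (le_trans _ (ltW gsup))// lerD2r.
  by apply: ub_le_sup; [have [] := supE|exists h].
have sg2_1 : sg ^+ 2 <= 1 by rewrite expr_le1// ?ltW//; lra.
have gK y : y \in s -> `|g y| <= K.
  move=> ys; rewrite -(@ler_pXn2r _ 2)// ?nnegrE ?(ltW K0)// real_normK ?num_real//.
  have h1 : eps * \sum_(y <- s) g y ^+ 2 <= j + 1.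
    have := psi_g (fun=> 0) (fun _ _ => erefl); rewrite psi0 {1}/psi.
    have := fej _ bg; lra.
  have h2 : g y ^+ 2 <= \sum_(y <- s) g y ^+ 2.
    by rewrite (bigD1_seq y)//= lerDl sumr_ge0// => z _; exact: sqr_ge0.
  have : eps * g y ^+ 2 <= j + 1 by rewrite (le_trans _ h1)// ler_pM2l.
  rewrite -ler_pdivlMl// => h3. apply: le_trans h3 _.
  by rewrite epsV expr2 ler_pM2r.
have main y t : y \in s -> `|t| <= 2^-1 ->
    t * (mass mu y - tilt2 g y) <= 2 * eps * t * g y + 3 * t ^+ 2 + sg ^+ 2.
  move=> ys th; pose g' z := g z + t * \1_[set y] z.
  have g's : supported g'.
    move=> x xs; rewrite /g' gs// add0r indicE memNset ?mulr0//= => xy.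
    by rewrite xy ys in xs.
  have sq : \sum_(z <- s) g' z ^+ 2 = \sum_(z <- s) g z ^+ 2 + 2 * t * g y + t ^+ 2.
    rewrite (bigD1_seq y)//= [in RHS](bigD1_seq y)//=.
    rewrite (eq_bigr (fun z => g z ^+ 2)); last first.
      move=> z zy; rewrite /g' indicE memNset ?mulr0 ?addr0//= => zy'.
      by rewrite zy' eqxx in zy.
    by rewrite /g' indicE mem_set// mulr1; ring.
  have h1 := psi_g _ g's; have h2 := free_energy_perturb t y bg.
  have h3 : (expR t - 1) * tilt2 g y <= t * tilt2 g y + 2 * t ^+ 2.
    have n0 := tilt2_ge0 y bg; have n1 := tilt2_le1 y bg.
    apply: (@le_trans _ _ ((t + 2 * t ^+ 2) * tilt2 g y)).
      by rewrite ler_wpM2r// lerBlDl addrA; exact: expR_le_quadratic.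
    by rewrite mulrDl lerD2l ler_piMr// mulr_ge0// sqr_ge0.
  have h4 : eps * t ^+ 2 <= t ^+ 2 by rewrite ler_piMl// sqr_ge0.
  move: h1; rewrite /psi sq => h1; exact: penalty_step h1 h2 h3 h4.
clear psi_g gsup psi_j supE psi0.
have sgn : `|sg| <= 2^-1 by rewrite gtr0_norm.
have up y : y \in s -> mass mu y - tilt2 g y <= 4 * sg + 2 * eps * g y.
  move=> ys; rewrite -(ler_pM2l sg0); have := main y sg ys sgn; lra.
have lo y : y \in s -> tilt2 g y - mass mu y <= 4 * sg - 2 * eps * g y.
  move=> ys; rewrite -(ler_pM2l sg0).
  have := main y (- sg) ys; rewrite normrN => /(_ sgn); rewrite sqrrN; lra.
exists g; split => //.
  move=> y ys; have := gK y ys; have := up y ys; have := lo y ys.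
  rewrite !ler_norml => h1 h2 /andP[h3 h4].
  have : 2 * eps * g y <= 2 * eps * K by rewrite ler_pM2l// mulr_gt0.
  have : 2 * eps * - K <= 2 * eps * g y by rewrite ler_pM2l// mulr_gt0.
  by move=> h5 h6; apply/andP; split; lra.
rewrite lerD// ?fej//; apply: (@le_trans _ _ (\sum_(y <- s) 4 * sg * K)).
  rewrite big_seq [leRHS]big_seq; apply: ler_sum => y ys.
  have := gK y ys; rewrite ler_norml => /andP[g1 g2].
  have h1 := up y ys; have h2 := lo y ys.
  (* For either sign of [g y] the penalty contributes [- 2 * eps * g y ^+ 2], which is dropped;
     multiplied by the possibly large [g y], only the error [4 * sg] remains. *)
  have [gy0|gy0] := leP 0 (g y).
    apply: (@le_trans _ _ ((4 * sg - 2 * eps * g y) * g y)); first by rewrite ler_wpM2r.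
    have : 0 <= 2 * eps * g y * g y by rewrite !mulr_ge0// ltW.
    have : 4 * sg * g y <= 4 * sg * K by rewrite ler_pM2l// mulr_gt0.
    lra.
  have gy0' : 0 <= - g y by lra.
  rewrite -mulrNN opprB.
  apply: (@le_trans _ _ ((4 * sg + 2 * eps * g y) * - g y)); first by rewrite ler_wpM2r.
  have : 0 <= 2 * eps * (- g y) * - g y by rewrite !mulr_ge0// ltW.
  have : 4 * sg * - g y <= 4 * sg * K by rewrite ler_pM2l ?mulr_gt0//; lra.
  lra.
rewrite big_const_seq count_predT iter_addr addr0 -[leLHS]mulr_natl -/N.
have : sg * (4 * (N + 1) * K) <= eta by rewrite -ler_pdivlMr// !mulr_gt0//; lra.
have : 0 <= sg * K by rewrite mulr_ge0// ltW.
lra.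
Qed.

End tilted_kernel.

(** * Compactness: from almost balanced to balanced pair measures *)

Section measure_of_masses.
Context d (T : measurableType d) (R : realType).
Local Open Scope ereal_scope.

Definition esum_measure (v : T -> {nonneg R}) (A : set T) : \bar R :=
  \esum_(x in A) (v x)%:num%:E.

Section instance.
Variable v : T -> {nonneg R}.

Let esum_measure0 : esum_measure v set0 = 0.
Proof. by rewrite /esum_measure esum_set0. Qed.

Let esum_measure_ge0 A : 0 <= esum_measure v A.
Proof. by apply: esum_ge0 => x _; rewrite lee_fin. Qed.

Let esum_measure_additive : semi_sigma_additive (esum_measure v).
Proof.
move=> F mF tF mUF; rewrite /esum_measure nneseries_sum_bigcup//.
by apply: is_cvg_nneseries => n _ _; exact: esum_measure_ge0.
Qed.

HB.instance Definition _ := isMeasure.Build _ _ _ (esum_measure v)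
  esum_measure0 esum_measure_ge0 esum_measure_additive.

End instance.

(** Normalization supplies the probability structure; since the total mass is already one, it
    changes nothing and its default Dirac measure is never reached. *)
Lemma probability_of_masses (v : T -> R) : (forall x, (0 <= v x)%R) ->
  \esum_(x in [set: T]) (v x)%:E = 1 ->
  exists nu : probability T R, forall A, nu A = \esum_(x in A) (v x)%:E.
Proof.
move=> v0 v1; pose w x := NngNum (v0 x).
exists (mnormalize (esum_measure w) \d_(point : T)) => A.
rewrite -[LHS]/(mnormalize (esum_measure w) \d_(point : T) A) /mnormalize.
have e B : (esum_measure w : {measure set T -> \bar R}) B =
    \esum_(x in B) (v x)%:E by [].
rewrite !e v1 /=.
by rewrite onee_eq0/= e invr1 mule1.
Qed.

End measure_of_masses.

(** Turns the inequalities that the marginals of the limit satisfy into equalities, once no mass is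
    known to be lost. *)
Lemma esum_le_eq (R : realType) (I : choiceType) (a b : I -> R) :
  (forall i, 0 <= a i) -> (forall i, a i <= b i) ->
  (\esum_(i in [set: I]) (a i)%:E = 1)%E -> (\esum_(i in [set: I]) (b i)%:E = 1)%E ->
  a = b.
Proof.
move=> a0 ab a1 b1.
have : (\esum_(i in [set: I]) (b i)%:E = \esum_(i in [set: I]) (a i)%:E +
    \esum_(i in [set: I]) (b i - a i)%:E)%E.
  rewrite -esumD => [|i _|i _]; [|by rewrite lee_fin|by rewrite lee_fin subr_ge0].
  by apply: eq_esum => i _; rewrite -EFinD addrC subrK.
rewrite a1 b1 => h.
have h0 : (\esum_(i in [set: I]) (b i - a i)%:E = 0)%E.
  move: h; case: (esum _ _) => [r|//|//]; rewrite -EFinD => -[h]; congr EFin; lra.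
apply/funext => i.
have d0 k : (0 <= (b k - a k)%:E)%E by rewrite lee_fin subr_ge0.
have [h1] := esum_eq0 d0 h0 (Logic.I : [set: I] i).
by apply/esym/eqP; rewrite -subr_eq0 h1.
Qed.

Section linear_constraints.
Context (R : realType) (I : choiceType).
Local Notation X := (prod_topology (fun _ : I => R)).

Lemma continuous_linear (l : seq I) (c : I -> R) :
  continuous (fun f : X => \sum_(i <- l) c i * f i).
Proof.
elim: l => [|i l IH] f.
  rewrite (_ : (fun f : X => _) = (fun=> 0)); first exact: cst_continuous.
  by apply/funext => g; rewrite big_nil.
rewrite (_ : (fun f : X => _) =
    (fun f : X => c i * f i + \sum_(j <- l) c j * f j)); last first.
  by apply/funext => g; rewrite big_cons.
have h : continuous (fun g : X => c i * g i).
  move=> g; apply: (@continuous_comp _ _ _ (fun f : X => f i) ( *%R (c i))).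
    exact: (@proj_continuous I (fun=> R) i).
  exact: mulrl_continuous.
exact: (@cvgD _ _ _ _ _ (fun g : X => c i * g i) _ _ _ (h f) (IH f)).
Qed.

(** A weak inequality between finitely many coordinates is closed in the product topology; this is
    how each constraint reaches the limit. *)
Lemma cluster_linear (F : set_system X) (f : X) (l : seq I) (c : I -> R) (b : R) :
  Filter F -> cluster F f -> F [set g : X | \sum_(i <- l) c i * g i <= b] ->
  \sum_(i <- l) c i * f i <= b.
Proof.
move=> FF Ff Fb; rewrite leNgt; apply/negP => bf.
have [||g [/= g1 g2]] := Ff [set g : X | \sum_(i <- l) c i * g i <= b]
  [set g : X | b < \sum_(i <- l) c i * g i] => //.
  have /continuousP/(_ _ (@open_gt R b)) h := @continuous_linear l c.
  by apply: open_nbhs_nbhs; split.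
by rewrite ltNge g1 in g2.
Qed.

End linear_constraints.

Section balanced_of_J1.
Context d (S : measurableType d) (R : realType).
Hypothesis countS : countable [set: S].
Hypothesis discS : forall A : set S, measurable A.
Variables (p : R.-pker S ~> S) (mu : probability S R).

Let kap (u : S * S) := mass mu u.1 * pmass p u.1 u.2.

Let kap_ge0 u : 0 <= kap u.
Proof. by rewrite mulr_ge0 ?mass_ge0 ?pmass_ge0. Qed.

Lemma free_energy_le_J1 g : bounded_fun g -> ((free_energy p mu g)%:E <= J1 p mu)%E.
Proof.
move=> bg; have /(bounded_fun_normP g)[M gM] := bg.
apply: ereal_sup_ubound; exists (fun x => expR (g x)).
  exists (expR (- M)), (expR M); split=> [|x]; first exact: expR_gt0.
  by rewrite !ler_expR -ler_norml.
rewrite /free_energy /pairing /Rintegral fineK; last first.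
  apply: integrable_fin_num => //; apply: bounded_integrable => //.
  by apply: bounded_fun_add => //; apply: bounded_fun_opp; exact: bounded_ln_ptilt.
apply: eq_integral => x _; congr EFin.
rewrite -[X in _ / X]/(ptilt p g x) ln_div ?posrE ?expR_gt0 ?expRK//.
exact: ptilt_gt0.
Qed.

(* Linear constraints satisfied, up to [eta], by an almost optimal pair measure
   whose second marginal is correct on [s]; the last but one is the dual form of
   the entropy bound and the last one prevents loss of mass. *)
Definition almost_balanced (j : R) (s : seq S) (eta : R) (w : S * S -> R) :=
  [/\ [/\ forall u, 0 <= w u <= 1,
    forall x l, uniq l -> \sum_(y <- l) w (x, y) <= mass mu x &
    forall u, kap u = 0 -> w u = 0],
    forall y l, y \in s -> uniq l -> \sum_(x <- l) w (x, y) <= mass mu y + eta,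
    forall l (t : S * S -> R), uniq l ->
      \sum_(u <- l) t u * w u <= \sum_(u <- l) kap u * (expR (t u) - 1) + (j + eta) &
    forall l l', uniq l -> uniq l' -> {subset l' <= s} ->
      \sum_(y <- l') (mass mu y - eta) - (1 - \sum_(x <- l) mass mu x) <=
      \sum_(u <- [seq (x, y) | x <- l, y <- l']) w u].

Lemma sum_mass_le1 (l : seq S) : uniq l -> \sum_(x <- l) mass mu x <= 1.
Proof.
move=> ul; rewrite -lee_fin -(esum_mass countS discS mu).
by apply: sum_le_esum => // x _; exact: mass_ge0.
Qed.

(** The witness is the pair measure of the kernel tilted by a near maximizer: [tilt_entropy]
    computes its entropy and [entf_gibbs] puts the bound into dual form. *)
Lemma almost_balanced_exists (j : R) (s : seq S) (eta : R) :
  (J1 p mu <= j%:E)%E -> 0 < eta -> exists w, almost_balanced j s eta w.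
Proof.
move=> Jj eta0.
have [|g [gs ge gj]] := near_maximizer countS discS _ (undup_uniq s) eta0 (p := p) (mu := mu) (j := j).
  by move=> g bg; rewrite -lee_fin (le_trans (free_energy_le_J1 bg)).
have bg : bounded_fun g := bounded_support (undup_uniq s) gs.
pose w (u : S * S) := mass mu u.1 * tilt p g u.1 u.2.
have t0 x y : 0 <= tilt p g x y by exact: tilt_ge0.
have w0 u : 0 <= w u by rewrite mulr_ge0 ?mass_ge0.
have w1 u : w u <= 1.
  rewrite mulr_ile1 ?mass_ge0 ?tilt_le1//.
  have := @sum_mass_le1 [:: u.1] isT; by rewrite big_seq1.
have wk u : kap u = 0 -> w u = 0.
  rewrite /kap /w /tilt => /eqP; rewrite mulf_eq0 => /orP[/eqP -> |/eqP ->].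
    by rewrite mul0r.
  by rewrite !mul0r mulr0.
exists w; split; first split.
- by move=> u; rewrite w0 w1.
- move=> x l ul; rewrite -lee_fin.
  have <- : (\esum_(y in [set: S]) (w (x, y))%:E = (mass mu x)%:E)%E.
    rewrite /w /=; under eq_esum do rewrite EFinM.
    by rewrite esumZl ?mass_ge0 ?esum_tilt ?mule1// => y; rewrite lee_fin.
  by apply: sum_le_esum.
- exact: wk.
- move=> y l ys ul; apply: (@le_trans _ _ (tilt2 p mu g y)).
    by rewrite -lee_fin -esum_tilt2//; apply: sum_le_esum => // x _; exact: w0 (x, y).
  have := ge y; rewrite mem_undup => /(_ ys); rewrite ler_norml => /andP[_].
  by rewrite lerBlDl.
- move=> l t ul; rewrite -lerBlDl -sumrB.
  apply: le_trans gj; rewrite -lee_fin -tilt_entropy//; last exact: undup_uniq.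
  apply: (@le_trans _ _ (\sum_(u <- l) entf (w u) (kap u))%:E).
    rewrite lee_fin; apply: ler_sum => u _.
    by apply: entf_gibbs => //; exact: wk.
  by apply: sum_le_esum => // u _; apply: entf_ge0 => //; exact: wk.
- move=> l l' ul ul' l's.
  have Ege x : 0 <= \sum_(y <- l') tilt p g x y by apply: sumr_ge0.
  have Ele x : \sum_(y <- l') tilt p g x y <= 1.
    by rewrite -lee_fin -(esum_tilt countS discS p x bg); apply: sum_le_esum.
  rewrite big_allpairs/=.
  apply: (@le_trans _ _ (\sum_(y <- l') tilt2 p mu g y - (1 - \sum_(x <- l) mass mu x))).
    rewrite lerD2r big_seq [leRHS]big_seq; apply: ler_sum => y yl'.
    have := ge y; rewrite mem_undup => /(_ (l's _ yl')); rewrite ler_norml => /andP[h _].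
    by move: h; rewrite lerBrDl.
  have bt y : bounded_fun (fun x => tilt p g x y) by exact: bounded_tilt.
  rewrite lerBlDr -(pairing_sum discS mu)//.
  (* On [l] this is the sum of [tilt p g x y] over [l'], elsewhere its trivial bound [1]. Its mean
     is therefore the mass that [w] gives to the finite rectangle plus the mass of [mu] outside
     [l]. *)
  pose G x := 1 + \sum_(z <- l) (\sum_(y <- l') tilt p g z y - 1) * \1_[set z] x.
  have bG : bounded_fun (fun x => \sum_(z <- l) (\sum_(y <- l') tilt p g z y - 1) * \1_[set z] x).
    by apply: bounded_fun_sum => z; apply: bounded_fun_mul;
      [exact: bounded_fun_cst|exact: bounded_fun_indic].
  apply: (@le_trans _ _ (pairing mu G)).
    apply: le_pairing => //.
    - exact: bounded_fun_sum.
    - by apply: bounded_fun_add => //; exact: bounded_fun_cst.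
    move=> x; rewrite /G; have [xl|xl] := boolP (x \in l).
      rewrite [X in 1 + X](bigD1_seq x)//= [X in 1 + (_ + X)]big1 ?addr0; last first.
        move=> z zx; rewrite indicE memNset ?mulr0//= => xz.
        by rewrite xz eqxx in zx.
      by rewrite indicE mem_set// mulr1 addrC subrK.
    rewrite [X in 1 + X]big_seq [X in 1 + X]big1 ?addr0// => z zl; rewrite indicE memNset ?mulr0//= => xz.
    by rewrite xz zl in xl.
  rewrite /G pairingD//; last exact: bounded_fun_cst.
  rewrite pairing_cst// pairing_sum//; last first.
    by move=> z; apply: bounded_fun_mul; [exact: bounded_fun_cst|exact: bounded_fun_indic].
  rewrite addrCA lerD2l lerBrDr -big_split/=.
  apply: ler_sum => z _; rewrite pairingZ; last exact: bounded_fun_indic; last by [].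
  rewrite pairing_indic1//.
  rewrite (_ : \sum_(y <- l') w (z, y) = mass mu z * \sum_(y <- l') tilt p g z y).
    by rewrite le_eqVlt; apply/orP; left; apply/eqP; ring.
  by rewrite mulr_sumr.
Qed.

End balanced_of_J1.

Section R1_le_J1.
Context d (S : measurableType d) (R : realType).
Hypothesis countS : countable [set: S].
Hypothesis discS : forall A : set S, measurable A.
Variables (p : R.-pker S ~> S) (mu : probability S R).
Local Notation X := (prod_topology (fun _ : S * S => R)).
Local Notation kap := (fun u : S * S => mass mu u.1 * pmass p u.1 u.2).

Lemma almost_balanced_mono j (s s' : seq S) (e e' : R) w :
  {subset s <= s'} -> e' <= e ->
  almost_balanced p mu j s' e' w -> almost_balanced p mu j s e w.
Proof.
move=> ss ee [h1 h2 h3 h4]; split => //.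
- by move=> y l /ss ys ul; apply: le_trans (h2 y l ys ul) _; rewrite lerD2l.
- move=> l t ul; apply: le_trans (h3 l t ul) _; by rewrite !lerD2l.
- move=> l l' ul ul' l's; apply: le_trans (h4 l l' ul ul' _); last first.
    by move=> y /l's /ss.
  by rewrite lerD2r; apply: ler_sum => y _; rewrite lerD2l lerN2.
Qed.

Definition almost_balanced_filter j : set_system X :=
  [set U | exists s : seq S, exists2 e, 0 < e &
     forall w, almost_balanced p mu j s e w -> U w].

Lemma almost_balanced_filter_proper j : (J1 p mu <= j%:E)%E ->
  ProperFilter (almost_balanced_filter j).
Proof.
move=> Jj; split.
  move=> [s [e e0 h]]; have [w /h] := almost_balanced_exists countS discS s Jj e0.
  by [].
split.
- by exists [::], 1.
- move=> U V [s [e e0 sU]] [s' [e' e0' sV]].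
  exists (s ++ s'), (Num.min e e'); first by rewrite lt_min e0.
  move=> w h; split; [apply: sU|apply: sV]; apply: almost_balanced_mono h.
  + by move=> x xs; rewrite mem_cat xs.
  + by rewrite ge_min lexx.
  + by move=> x xs; rewrite mem_cat xs orbT.
  + by rewrite ge_min lexx orbT.
- by move=> U V UV [s [e e0 sU]]; exists s, e => // w /sU /UV.
Qed.

(** A cluster point in the compact cube of all [[0, 1]]-valued families, as [s] grows and [eta]
    decreases to zero. The errors vanish because each constraint involves finitely many coordinates
    at a time. *)
Lemma balanced_masses j : (J1 p mu <= j%:E)%E -> exists v : S * S -> R,
  [/\ forall u, 0 <= v u,
   [/\ forall x l, uniq l -> \sum_(y <- l) v (x, y) <= mass mu x,
    forall y l, uniq l -> \sum_(x <- l) v (x, y) <= mass mu y &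
    forall u, kap u = 0 -> v u = 0],
    forall l (t : S * S -> R), uniq l ->
      \sum_(u <- l) t u * v u <= \sum_(u <- l) kap u * (expR (t u) - 1) + j &
    forall l, uniq l -> \sum_(y <- l) mass mu y - (1 - \sum_(x <- l) mass mu x) <=
      \sum_(u <- [seq (x, y) | x <- l, y <- l]) v u].
Proof.
move=> Jj; have FF := almost_balanced_filter_proper Jj.
pose F := almost_balanced_filter j.
have /(_ F FF) : compact [set f : X | forall i, `[(0 : R), 1]%classic (f i)].
  exact: (@tychonoff _ (fun=> R) (fun=> `[(0 : R), 1]%classic)
    (fun=> @segment_compact R 0 1)).
case.
  exists [::], 1 => // w [[w01 _ _] _ _ _] u /=.
  by rewrite in_itv /= w01.
move=> v [v01 vF].
have lin l c b : F [set g : X | \sum_(u <- l) c u * g u <= b] ->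
    \sum_(u <- l) c u * v u <= b by exact: cluster_linear.
have lin1 l b : F [set g : X | \sum_(u <- l) g u <= b] -> \sum_(u <- l) v u <= b.
  have e g : \sum_(u <- l) 1 * g u = \sum_(u <- l) g u :> R.
    by apply: eq_bigr => u _; rewrite mul1r.
  move=> Fb; rewrite -e; apply: (lin l (fun=> 1)); apply: filterS Fb => g /=.
  by rewrite e.
have v0 u : 0 <= v u by have := v01 u; rewrite /= in_itv /= => /andP[].
exists v; split => //; first split.
- move=> x l ul; rewrite -(big_map (fun y => (x, y)) xpredT v); apply: lin1.
  by exists [::], 1 => // w [[_ h _] _ _ _] /=; rewrite big_map; exact: h.
- move=> y l ul; apply/ler_addgt0Pr => e e0.
  rewrite -(big_map (fun x => (x, y)) xpredT v); apply: lin1.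
  exists [:: y], e => // w [_ h _ _] /=; rewrite big_map; apply: h => //.
  by rewrite inE.
- move=> u ku; apply/eqP; rewrite eq_le v0 andbT.
  have := lin1 [:: u] 0; rewrite big_seq1; apply.
  by exists [::], 1 => // w [[_ _ h] _ _ _] /=; rewrite big_seq1 h.
- move=> l t ul; apply/ler_addgt0Pr => e e0; apply: lin.
  exists [::], e => // w [_ _ h _] /=; rewrite -addrA; exact: h.
- move=> l ul; apply/ler_addgt0Pr => e e0.
  pose n : R := (size l)%:R.
  have n0 : 0 < n + 1 by rewrite ltr_wpDl.
  have e1 : 0 < e / (n + 1) by rewrite divr_gt0.
  set B := [seq (x, y) | x <- l, y <- l].
  have eN (g : S * S -> R) : \sum_(u <- B) -1 * g u = - \sum_(u <- B) g u.
    by rewrite -sumrN; apply: eq_bigr => u _; rewrite mulN1r.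
  have h : \sum_(y <- l) (mass mu y - e / (n + 1)) - (1 - \sum_(x <- l) mass mu x) <=
      \sum_(u <- B) v u.
    rewrite -lerN2 -eN; apply: (lin B (fun=> -1)).
    exists l, (e / (n + 1)) => // w [_ _ _ h] /=.
    by rewrite eN lerN2; exact: h.
  rewrite -lerBlDr; apply: le_trans h.
  rewrite sumrB big_const_seq count_predT iter_addr addr0 -[e / (n + 1) *+ _]mulr_natl -/n.
  rewrite addrAC lerD2r lerD2l lerN2 mulrA ler_pdivrMr// mulrC.
  by rewrite ler_pM2l// lerDl.
Qed.

Lemma esum_setXT (v : S * S -> R) (A : set S) : (forall u, 0 <= v u) ->
  (\esum_(u in A `*` [set: S]) (v u)%:E =
   \esum_(x in A) \esum_(y in [set: S]) (v (x, y))%:E)%E.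
Proof.
move=> v0; rewrite (@esum_esum _ _ _ A (fun=> [set: S]) (fun x y => (v (x, y))%:E)).
  by apply: eq_esum => -[].
by move=> x y _ _; rewrite lee_fin.
Qed.

Lemma esum_setTX (v : S * S -> R) (A : set S) : (forall u, 0 <= v u) ->
  (\esum_(u in [set: S] `*` A) (v u)%:E =
   \esum_(y in A) \esum_(x in [set: S]) (v (x, y))%:E)%E.
Proof.
move=> v0; rewrite -(@esum_setXT (fun u => v (u.2, u.1)))//.
rewrite (reindex_esum (A `*` [set: S]) ([set: S] `*` A) (fun u => (u.2, u.1)))//.
split; first by move=> [x y] [].
  by move=> [x y] [x' y'] _ _ [-> ->].
by move=> [x y] [_ Ay]; exists (y, x).
Qed.

Lemma R1_le_J1 : (R1 p mu <= J1 p mu)%E.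
Proof.
have J0 : (0%:E <= J1 p mu)%E.
  rewrite -(free_energy0 discS p mu); apply: free_energy_le_J1 => //.
  exact: bounded_fun_cst.
case Jj : (J1 p mu) J0 => [j||] // _; last exact: leey.
have {}Jj : (J1 p mu <= j%:E)%E by rewrite Jj.
have [v [v0 [vr vc vk] vt vm]] := balanced_masses Jj.
have m0 := mass_ge0 discS mu.
have k0 u : 0 <= kap u by rewrite mulr_ge0 ?pmass_ge0.
pose row x : \bar R := (\esum_(y in [set: S]) (v (x, y))%:E)%E.
pose col y : \bar R := (\esum_(x in [set: S]) (v (x, y))%:E)%E.
have row0 x : (0 <= row x)%E by apply: esum_ge0 => y _; rewrite lee_fin.
have col0 y : (0 <= col y)%E by apply: esum_ge0 => x _; rewrite lee_fin.
have rowm x : (row x <= (mass mu x)%:E)%E by apply: esum_le_sum => l ul _; exact: vr.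
have colm y : (col y <= (mass mu y)%:E)%E.
  by apply: (@esum_le_sum _ _ (fun x => v (x, y))) => l ul _; exact: vc.
have rowE x : (fine (row x))%:E = row x.
  by rewrite fineK// ge0_fin_numE//; apply: le_lt_trans (rowm x) (ltry _).
have colE y : (fine (col y))%:E = col y.
  by rewrite fineK// ge0_fin_numE//; apply: le_lt_trans (colm y) (ltry _).
have vrow : (\esum_(u in [set: S * S]) (v u)%:E = \esum_(x in [set: S]) (fine (row x))%:E)%E.
  by rewrite -setXTT esum_setXT//; apply: eq_esum => x _; rewrite rowE.
have vcol : (\esum_(u in [set: S * S]) (v u)%:E = \esum_(y in [set: S]) (fine (col y))%:E)%E.
  by rewrite -setXTT esum_setTX//; apply: eq_esum => x _; rewrite colE.
have v1 : (\esum_(u in [set: S * S]) (v u)%:E = 1)%E.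
  apply/eqP; rewrite eq_le; apply/andP; split.
    rewrite vrow -(esum_mass countS discS mu); apply: le_esum => x _.
    by rewrite rowE.
  (* No mass is lost: on a finite [l] carrying more than [1 - e / 2] of [mu], the bound [vm] leaves
     at least [1 - e] to [v]. *)
  apply/lee_addgt0Pr => e e0.
  have : ((1 - e / 2)%:E < \esum_(x in [set: S]) (mass mu x)%:E)%E.
    by rewrite esum_mass// lte_fin ltrBlDr ltrDl divr_gt0.
  move=> /lt_esum_sum[l [ul _ lm]].
  have us : uniq [seq (x, y) | x <- l, y <- l].
    by apply: allpairs_uniq => // -[a b] [a' b'] _ _.
  apply: (@le_trans _ _ ((\sum_(u <- [seq (x, y) | x <- l, y <- l]) v u)%:E + e%:E)%E).
    by rewrite -EFinD lee_fin; have := vm l ul; lra.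
  by rewrite leeD2r// sum_le_esum.
(* Rows and columns lie below the masses of [mu] and have the same total, so both marginals are
   equal to [mu]. *)
have rmu : (fun x => fine (row x)) = mass mu.
  apply: esum_le_eq => [x|x||]; rewrite -?vrow ?esum_mass ?fine_ge0//.
  by rewrite -lee_fin rowE.
have cmu : (fun x => fine (col x)) = mass mu.
  apply: esum_le_eq => [x|x||]; rewrite -?vcol ?esum_mass ?fine_ge0//.
  by rewrite -lee_fin colE.
have [nu nuE] := probability_of_masses v0 v1.
have numu A : nu (A `*` [set: S]) = mu A.
  rewrite nuE esum_setXT// (measure_mass countS discS mu).
  by apply: eq_esum => x _; rewrite -rmu rowE.
have numu2 A : nu ([set: S] `*` A) = mu A.
  rewrite nuE esum_setTX// (measure_mass countS discS mu).
  by apply: eq_esum => x _; rewrite -cmu colE.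
have numass u : mass nu u = v u by rewrite /mass nuE esum_set1 ?lee_fin.
have nu1 : marginal1 nu = mu :> (set S -> \bar R) by apply/funext => A; exact: numu.
apply: (@le_trans _ _ (R2 p nu)).
  apply: ereal_inf_lbound; exists nu => //; split => // A.
  by rewrite numu numu2.
rewrite (R2E countS discS p nu1).
case: asboolP => [_|]; last first.
  by case => u ku; rewrite numass vk.
apply: esum_le_sum => l ul _; apply/ler_addgt0Pr => e e0.
(* The maximizer in [entf_gibbs]. Where [v u] vanishes it would be minus infinity; [ln e] instead
   costs [e * kap u], at most [e] in total. *)
pose t u := if v u == 0 then ln e else ln (v u / kap u).
have k1 : \sum_(u <- l) kap u <= 1.
  by rewrite -lee_fin -(esum_kernel_product countS discS p mu); apply: sum_le_esum.
apply: (@le_trans _ _ (\sum_(u <- l) (t u * v u - kap u * (expR (t u) - 1) + e * kap u))).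
  apply: ler_sum => u _; rewrite numass /t.
  have [vu|vu] := eqVneq (v u) 0.
    rewrite vu entf0l lnK ?posrE// le_eqVlt; apply/orP; left; apply/eqP; ring.
  have vu0 : 0 < v u by rewrite lt_def vu v0.
  have ku0 : 0 < kap u.
    by rewrite lt_def k0 andbT; apply: contra_neq vu => /vk.
  rewrite lnK ?posrE ?divr_gt0// /entf.
  have -> : kap u * (v u / kap u - 1) = v u - kap u.
    by rewrite mulrBr mulr1 mulrC divfK// gt_eqF.
  have := mulr_ge0 (ltW e0) (k0 u); lra.
rewrite big_split/= sumrB -mulr_sumr.
have := vt l t ul; have : e * \sum_(u <- l) kap u <= e by rewrite ler_piMr// ltW.
lra.
Qed.

End R1_le_J1.

(** * Words and the law of the occupation measure *)

Section exponential_rates.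
Context (R : realType).
Implicit Types (u : nat -> \bar R) (c : \bar R) (E : \bar R) (a : R).
Local Open Scope ereal_scope.

Lemma limn_esup_le_near u c : (\forall n \near \oo, u n <= c) -> limn_esup u <= c.
Proof.
move=> uc; apply: (@le_trans _ _ (ereal_sup (u @` [set n | u n <= c]))).
  by apply: ereal_inf_lbound; exists [set n | u n <= c].
by apply: ge_ereal_sup => _ [n /= unc <-].
Qed.

Lemma limn_esup_lt_near u c : limn_esup u < c -> \forall n \near \oo, u n < c.
Proof.
move=> /ereal_inf_lt[_ [V Voo <-] Vc]; apply: filterS Voo => n Vn.
by apply: le_lt_trans Vc; apply: ereal_sup_ubound; exists n.
Qed.

Lemma limn_einf_ge_near u c : (\forall n \near \oo, c <= u n) -> c <= limn_einf u.
Proof.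
move=> cu; rewrite /limn_einf leeNr; apply: limn_esup_le_near.
by apply: filterS cu => n; rewrite leeN2.
Qed.

Lemma lne_le_expR E a : 0 <= E -> (lne E <= a%:E) = (E <= (expR a)%:E).
Proof.
move=> E0; rewrite -[in LHS](expRK a) -lne_EFin ?expR_gt0// lee_lne//.
  by rewrite in_itv /= E0 leey.
by rewrite in_itv /= lee_fin expR_ge0 leey.
Qed.

Lemma lne_ge_expR E a : 0 <= E -> (a%:E <= lne E) = ((expR a)%:E <= E).
Proof.
move=> E0; rewrite -[in LHS](expRK a) -lne_EFin ?expR_gt0// lee_lne//.
  by rewrite in_itv /= lee_fin expR_ge0 leey.
by rewrite in_itv /= E0 leey.
Qed.

Lemma rate_le_expR E a n : 0 <= E ->
  ((n.+1%:R^-1)%:E * lne E <= a%:E) = (E <= (expR (n.+1%:R * a))%:E).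
Proof.
by move=> E0; rewrite -lne_le_expR// lee_pdivrMl ?ltr0n.
Qed.

Lemma rate_ge_expR E a n : 0 <= E ->
  (a%:E <= (n.+1%:R^-1)%:E * lne E) = ((expR (n.+1%:R * a))%:E <= E).
Proof.
by move=> E0; rewrite -lne_ge_expR// lee_pdivlMl ?ltr0n.
Qed.

End exponential_rates.

Section discrete_image.
Context d (T : measurableType d) (R : realType) (W : choiceType).
Variables (P : probability T R) (e : T -> W).
Hypothesis countW : countable [set: W].
Hypothesis me : forall w, measurable (e @^-1` [set w]).
Local Open Scope ereal_scope.

Lemma discrete_preimage (A : set W) : measurable (e @^-1` A).
Proof.
rewrite (_ : _ @^-1` _ = \bigcup_w (if w \in A then e @^-1` [set w] else set0)).
  by apply: countable_bigcupT_measurable => // w; case: ifP.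
apply/seteqP; split => [t At|t [w _]].
  by exists (e t) => //; rewrite mem_set.
by case: ifPn => //; rewrite inE => Aw /= ->.
Qed.

Lemma integral_discrete (g : W -> \bar R) : (forall w, 0 <= g w) ->
  \int[P]_t g (e t) = \esum_(w in [set: W]) (g w * P (e @^-1` [set w])).
Proof.
move=> g0; have /countable_injP[f finj] := countW.
pose F n := [set t : T | f (e t) = n].
have FT : \bigcup_n F n = [set: T].
  by apply/seteqP; split => // x _; exists (f (e x)).
have tF : trivIset [set: nat] F by move=> i j _ _ [x [/= <- <-]].
have mF n : measurable (F n) by exact: (discrete_preimage [set w | f w = n]).
rewrite -{1}FT ge0_integral_bigcup//; last first.
  by move=> _ B _; rewrite setIidr; [exact: (discrete_preimage (g @^-1` B))|rewrite FT].
pose D n := [set w : W | f w = n].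
have DT : \bigcup_n D n = [set: W].
  by apply/seteqP; split => // w _; exists (f w).
have tD : trivIset [set: nat] D by move=> i j _ _ [x [/= <- <-]].
rewrite -[in RHS]DT nneseries_sum_bigcup//; last by move=> w; rewrite mule_ge0.
apply: eq_eseriesr => n _.
have [D0|/set0P[w Dw]] := eqVneq (D n) set0.
  have -> : F n = set0 by rewrite -[F n]/(e @^-1` D n) D0 preimage_set0.
  by rewrite integral_set0 D0 esum_set0.
have Dn : D n = [set w].
  apply/seteqP; split => y /=; last by move=> ->.
  by move=> Dy; apply: finj; rewrite ?inE//; rewrite Dw.
rewrite Dn esum_set1 ?mule_ge0//.
rewrite (eq_integral (cst (g w))); first by rewrite integral_cst// -[F n]/(e @^-1` D n) Dn.
move=> y; rewrite inE => yF; have : D n (e y) by exact: yF.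
by rewrite Dn /= => ->.
Qed.

Lemma measure_discrete (A : set W) :
  P (e @^-1` A) = \esum_(w in A) P (e @^-1` [set w]).
Proof.
rewrite -[LHS]mul1e -integral_cst; last exact: discrete_preimage.
rewrite integral_mkcond.
rewrite (_ : _ \_ _ = (fun t => (cst 1 \_ A) (e t))).
  rewrite integral_discrete; last by move=> w; rewrite patchE; case: ifP.
  rewrite [RHS]esum_mkcond; apply: eq_esum => x _.
  by rewrite patchE; case: ifP => _; rewrite ?mul1e ?mul0e.
apply/funext => t; rewrite !patchE.
by rewrite (_ : (t \in e @^-1` A) = (e t \in A))//; apply/idP/idP; rewrite !inE.
Qed.

End discrete_image.

Section words.
Context (S : choiceType) (R : realType).

(* Words have [n + 1] letters and grow on the right. *)
Fixpoint word n : choiceType := if n is m.+1 then (word m * S)%type else S.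

Fixpoint wlast n : word n -> S :=
  match n with 0 => fun w => w | m.+1 => fun w => w.2 end.

Fixpoint wnth n : word n -> nat -> S :=
  match n with
  | 0 => fun w _ => w
  | m.+1 => fun w i => if (i <= m)%N then wnth w.1 i else w.2
  end.

Fixpoint wmass (m : S -> R) (q : S -> S -> R) n : word n -> R :=
  match n with
  | 0 => m
  | k.+1 => fun w => wmass m q w.1 * q (wlast w.1) w.2
  end.

Fixpoint wsum (V : S -> R) n : word n -> R :=
  match n with 0 => V | k.+1 => fun w => wsum V w.1 + V w.2 end.

Fixpoint wpath T (X : nat -> T -> S) n : T -> word n :=
  match n with
  | 0 => X 0%N
  | k.+1 => fun t => (wpath X k t, X k.+1 t)
  end.

Lemma wlastE n (w : word n) : wlast w = wnth w n.
Proof. by case: n w => [|n] w //=; rewrite ltnn. Qed.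

Lemma wsum_wnth V n (w : word n) : wsum V w = \sum_(i < n.+1) V (wnth w i).
Proof.
elim: n w => [|n IH] w; first by rewrite big_ord1.
rewrite big_ord_recr /= IH ltnn; congr (_ + _).
by apply: eq_bigr => i _; rewrite -ltnS ltn_ord.
Qed.

Lemma wnth_wpath T (X : nat -> T -> S) n t i : (i <= n)%N ->
  wnth (wpath X n t) i = X i t.
Proof.
elim: n => [|n IH] /=; first by rewrite leqn0 => /eqP ->.
by rewrite leq_eqVlt ltnS => /predU1P[->|ij]; rewrite ?ltnn// ij IH.
Qed.

Lemma wpath_eq T (X : nat -> T -> S) n t (w : word n) :
  wpath X n t = w <-> forall i, (i <= n)%N -> X i t = wnth w i.
Proof.
split=> [<- i ij|]; first by rewrite wnth_wpath.
elim: n w => [|n IH] w h; first exact: h.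
rewrite (surjective_pairing w) /=; congr pair.
  by apply: IH => i ij; rewrite h ?(leq_trans ij)//= ij.
by rewrite h//= ltnn.
Qed.

Lemma countable_word n : countable [set: S] -> countable [set: word n].
Proof.
by move=> cS; elim: n => [//|n IH]; rewrite /= -setXTT; exact: countableX.
Qed.

Lemma wmass_ge0 m q n (w : word n) : (forall x, 0 <= m x) ->
  (forall x y, 0 <= q x y) -> 0 <= wmass m q w.
Proof. by move=> m0 q0; elim: n w => [//|n IH] w /=; rewrite mulr_ge0. Qed.

End words.

Section word_occupation.
Context d (S : measurableType d) (R : realType).
Hypothesis discS : forall A : set S, measurable A.

Definition word_occupation n (w : word S n) : probability S R :=
  empirical R n (wnth w).

Lemma empiricalE n (x : nat -> S) A : (empirical R n x : probability S R) A =
  ((n.+1%:R^-1)%:E * \sum_(i < n.+1) \d_(x i) A)%E.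
Proof. by []. Qed.

Lemma empirical_ext n (x y : nat -> S) : (forall i, (i <= n)%N -> x i = y i) ->
  empirical R n x = empirical R n y :> probability S R.
Proof.
move=> xy; apply: eq_probability => A; rewrite !empiricalE.
by congr (_ * _)%E; apply: eq_bigr => i _; rewrite xy// -ltnS.
Qed.

Lemma empirical_mass n (x : nat -> S) y :
  mass (empirical R n x) y = n.+1%:R^-1 * \sum_(i < n.+1) (x i == y)%:R.
Proof.
rewrite /mass (empiricalE n x).
rewrite (eq_bigr (fun i : 'I_n.+1 => ((x i == y)%:R)%:E)) ?sumEFin//.
by move=> i _; rewrite diracE; congr ((nat_of_bool _)%:R%:E); apply/idP/eqP; rewrite inE.
Qed.

Lemma pairing_empirical n (x : nat -> S) (V : S -> R) : bounded_fun V ->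
  pairing (empirical R n x) V = n.+1%:R^-1 * \sum_(i < n.+1) V (x i).
Proof.
move=> bV; have /(bounded_fun_normP V)[M VM] := bV.
(* The integration rules for scaled and summed measures are applied to nonnegative functions, hence
   the shift by [M]. *)
suff h : pairing (empirical R n x) (fun y => V y + M) =
    n.+1%:R^-1 * \sum_(i < n.+1) (V (x i) + M).
  apply: (@addIr _ M); rewrite -(pairingDr discS)// h big_split/= sumr_const card_ord.
  by rewrite mulrDr -[M *+ _]mulr_natl [X in _ + X = _]mulrA mulVf ?mul1r// pnatr_eq0.
have V0 y : 0 <= V y + M by have := VM y; rewrite ler_norml -subr_ge0 opprK => /andP[].
rewrite /pairing /Rintegral.
rewrite (ge0_integral_mscale (msum (fun i => \d_(x i)) n.+1) measurableT
  (n.+1%:R^-1)%:nng (f := fun y => (V y + M)%:E)).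
- rewrite ge0_integral_measure_sum//.
  + rewrite (eq_bigr (fun i : 'I_n.+1 => (V (x i) + M)%:E)) ?sumEFin//.
    by move=> i _; rewrite integral_dirac ?diracT ?mul1e.
  + by move=> y _; rewrite lee_fin.
- by move=> _ B _; exact: discS.
- by move=> y _; rewrite lee_fin.
Qed.

Lemma pairing_word_occupation n (w : word S n) (V : S -> R) : bounded_fun V ->
  n.+1%:R * pairing (word_occupation w) V = wsum V w.
Proof.
by move=> bV; rewrite pairing_empirical// mulrA mulfV ?pnatr_eq0// mul1r wsum_wnth.
Qed.

End word_occupation.

(** * Law of the occupation measure, upper estimate, and the bound of [J1] by [Lambda_star] *)

Section path_law.
Context d d' (S : measurableType d) (Omega : measurableType d') (R : realType).
Variables (P : probability Omega R) (X : nat -> {RV P >-> S}).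
Variables (beta : probability S R) (p : R.-pker S ~> S).
Hypothesis countS : countable [set: S].
Hypothesis discS : forall A : set S, measurable A.
Hypothesis chain_X : markov_chain X beta p.
Local Open Scope ereal_scope.

Let path n : Omega -> word S n := wpath (fun i => X i : Omega -> S) n.

Lemma measurable_path n (w : word S n) : measurable (path n @^-1` [set w]).
Proof.
elim: n w => [|n IH] w; first by rewrite -[_ @^-1` _]setTI; exact: measurable_funP.
rewrite (_ : _ @^-1` _ = path n @^-1` [set w.1] `&` (X n.+1 @^-1` [set w.2])).
  by apply: measurableI => //; rewrite -[X in measurable X]setTI; exact: measurable_funP.
apply/seteqP; split => t /=; first by rewrite /path /= => <-.
by rewrite /path /= => -[-> ->]; rewrite -surjective_pairing.
Qed.

Lemma path_mass n (w : word S n) :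
  P (path n @^-1` [set w]) = (wmass (mass beta) (pmass p) w)%:E.
Proof.
have cyl m (v : word S m) : path m @^-1` [set v] =
    [set t | forall i, (i <= m)%N -> X i t = wnth v i].
  by apply/seteqP; split => t /=; rewrite wpath_eq.
elim: n w => [|n IH] w; first by rewrite massE//; exact: chain_X.1.
rewrite cyl chain_X.2 /= EFinM pmassE// ltnn leqnn wlastE -IH cyl.
congr (P _ * _); apply/seteqP; split => t /= h i ij; have := h i ij; by rewrite ij.
Qed.

Lemma occupationE n t : occupation X n t = word_occupation R (path n t).
Proof. by apply: empirical_ext => i ij; rewrite wnth_wpath. Qed.

Lemma occupation_preimage n (A : set (probability S R)) :
  occupation X n @^-1` A = path n @^-1` (@word_occupation _ S R n @^-1` A).
Proof. by apply/seteqP; split => t /=; rewrite occupationE. Qed.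

Lemma measurable_occupation n (A : set (probability S R)) :
  measurable (occupation X n @^-1` A).
Proof.
rewrite occupation_preimage; apply: discrete_preimage.
  exact: countable_word.
exact: measurable_path.
Qed.

Lemma occupation_prob n (A : set (probability S R)) :
  P (occupation X n @^-1` A) = \esum_(w in @word_occupation _ S R n @^-1` A)
    (wmass (mass beta) (pmass p) w)%:E.
Proof.
rewrite occupation_preimage (measure_discrete P (countable_word _ countS) (@measurable_path n)).
by apply: eq_esum => w _; exact: path_mass.
Qed.

Lemma expectation_occupation n (V : S -> R) : bounded_fun V ->
  'E_P[fun t => expR (n.+1%:R * pairing (occupation X n t) V)] =
  \esum_(w in [set: word S n])
    ((expR (wsum V w))%:E * (wmass (mass beta) (pmass p) w)%:E).
Proof.
move=> bV; rewrite unlock.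
rewrite (eq_integral (fun t => (expR (wsum V (path n t)))%:E)); last first.
  by move=> t _; rewrite occupationE pairing_word_occupation.
rewrite (integral_discrete P (countable_word _ countS) (@measurable_path n)
  (g := fun w => (expR (wsum V w))%:E)); last by move=> w; rewrite lee_fin expR_ge0.
by apply: eq_esum => w _; rewrite path_mass.
Qed.

Lemma wmass_chain_ge0 n (w : word S n) : (0 <= wmass (mass beta) (pmass p) w)%R.
Proof. by apply: wmass_ge0; [exact: mass_ge0|exact: pmass_ge0]. Qed.

Lemma chebyshev_occupation n (V : S -> R) (c : R) : bounded_fun V ->
  P (occupation X n @^-1` [set nu | (c < pairing nu V)%R]) <=
  (expR (- (n.+1%:R * c)))%:E *
    'E_P[fun t => expR (n.+1%:R * pairing (occupation X n t) V)].
Proof.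
move=> bV; rewrite occupation_prob expectation_occupation// -esumZl ?expR_ge0//; last first.
  by move=> w; rewrite -EFinM lee_fin mulr_ge0 ?expR_ge0 ?wmass_chain_ge0.
rewrite esum_mkcond; apply: le_esum => w _; rewrite -!EFinM mulrA -expRD.
case: ifPn => [|_]; last by rewrite lee_fin mulr_ge0 ?expR_ge0 ?wmass_chain_ge0.
rewrite inE /= => cw; rewrite lee_fin ler_peMl ?wmass_chain_ge0//.
rewrite -[leLHS]expR0 ler_expR addrC subr_ge0 -pairing_word_occupation//.
by rewrite ler_pM2l ?ltr0n// ltW.
Qed.

(** The neighbourhood is a half-space for a near-optimal [V]: with [c] above [Lambda X V] but below
    [pairing mu V - a], the threshold [a + c] still holds at [mu], and the factor
    [expR (- n * (a + c))] of Chebyshev meets an expectation of at most [expR (n * c)]. *)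
Lemma Lambda_star_upper (mu : probability S R) (a : R) :
  a%:E < Lambda_star X mu -> exists U : set (probability S R),
  [/\ open U, U mu & \forall n \near \oo,
     P (occupation X n @^-1` U) <= (expR (- (n.+1%:R * a)))%:E].
Proof.
move=> /ereal_sup_gt[_ [V bV <-]] aV.
have [c ac cV] : exists2 c : R, (a < pairing mu V - c)%R & Lambda X V < c%:E.
  case: (Lambda X V) aV => [l||].
  - rewrite -EFinB lte_fin => h; exists ((l + (pairing mu V - a)) / 2)%R; first lra.
    by rewrite lte_fin; lra.
  - by rewrite /= ltNge leNye.
  - by move=> _; exists (pairing mu V - a - 1)%R; [lra|exact: ltNyr].
exists [set nu | (a + c < pairing nu V)%R]; split; first exact: pairing_gt_open.
  by rewrite /=; lra.
have := limn_esup_lt_near cV; apply: filterS => n /ltW; rewrite rate_le_expR; last first.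
  by rewrite unlock; apply: integral_ge0 => t _; rewrite lee_fin expR_ge0.
move=> En; apply: le_trans (chebyshev_occupation n _ bV) _.
apply: le_trans (lee_wpmul2l _ En) _; first by rewrite lee_fin expR_ge0.
rewrite -EFinM -expRD lee_fin ler_expR le_eqVlt; apply/orP; left; apply/eqP; ring.
Qed.

Lemma J1_le_Lambda_star (mu : probability S R) : J1 p mu <= Lambda_star X mu.
Proof.
apply: ge_ereal_sup => _ [f [a [b [a0 fab]]] <-].
have f0 x : (0 < f x)%R by have /andP[h _] := fab x; exact: lt_le_trans a0 h.
have b0 : (0 < b)%R by have /andP[_ h] := fab point; exact: lt_le_trans (f0 _) h.
have bf : bounded_fun f.
  by apply: (@bounded_funI _ _ _ b) => x; rewrite gtr0_norm//; have /andP[] := fab x.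
pose pf x := pairing (kernel_at p x) f.
have pfab x : (a <= pf x <= b)%R.
  apply/andP; split.
    rewrite -(pairing_cst discS (kernel_at p x) a); apply: le_pairing => //.
    - exact: bounded_fun_cst.
    - by move=> y; have /andP[] := fab y.
  rewrite -(pairing_cst discS (kernel_at p x) b); apply: le_pairing => //.
  - exact: bounded_fun_cst.
  - by move=> y; have /andP[] := fab y.
have pf0 x : (0 < pf x)%R by have /andP[h _] := pfab x; exact: lt_le_trans a0 h.
pose V x := ln (f x / pf x).
have bV : bounded_fun V.
  apply: (@bounded_funI _ _ _ (ln (b / a))) => x.
  have /andP[fa fb] := fab x; have /andP[pa pb] := pfab x.
  have ab : (a <= b)%R by exact: le_trans fa fb.
  rewrite ler_norml -lnV ?posrE ?divr_gt0// invf_div !ler_ln ?posrE ?divr_gt0//.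
  by apply/andP; split; apply: ler_pM;
    rewrite ?invr_ge0 ?(ltW a0) ?(ltW b0) ?(ltW (f0 x)) ?(ltW (pf0 x)) ?lef_pV2 ?posrE.
(* Since [expR (V y) * pf y = f y], summing over the last letter gives back [pf] at the previous
   one. The value is thus preserved, and it starts as the mean of [f] under [beta]. *)
have mart n : \esum_(w in [set: word S n])
    (wmass (mass beta) (pmass p) w * (expR (wsum V w) * pf (wlast w)))%:E <= b%:E.
  elim: n => [|n IH].
    rewrite -[leRHS]mule1 -(esum_mass countS discS beta) -esumZl ?(ltW b0)//; last first.
      by move=> x; rewrite lee_fin mass_ge0.
    apply: le_esum => x _; rewrite -EFinM lee_fin /= /V lnK ?posrE ?divr_gt0//.
    rewrite divfK ?gt_eqF// mulrC ler_wpM2r ?mass_ge0//.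
    by have /andP[] := fab x.
  apply: le_trans IH.
  rewrite (esum_pair (a := fun w y => ((wmass (mass beta) (pmass p) w * pmass p (wlast w) y) *
     (expR (wsum V w + V y) * pf y))%:E)); last first.
    move=> w y; rewrite lee_fin !mulr_ge0 ?expR_ge0 ?wmass_chain_ge0 ?pmass_ge0//.
    exact: ltW.
  apply: le_esum => w _.
  rewrite mulrA EFinM (pairing_esum countS discS (kernel_at p (wlast w)) bf) => [|x]; last exact: ltW.
  rewrite -esumZl; first last.
  - by move=> y; rewrite lee_fin mulr_ge0 ?(ltW (f0 _))// pmass_ge0.
  - by rewrite mulr_ge0 ?expR_ge0 ?wmass_chain_ge0.
  apply: le_esum => y _; rewrite -EFinM lee_fin expRD {2}/V lnK ?posrE ?divr_gt0//.
  rewrite le_eqVlt; apply/orP; left; apply/eqP.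
  by rewrite /pmass; field; rewrite gt_eqF.
(* As [pf >= a], the expectation is at most [b / a] for every [n], a constant that disappears at
   exponential scale. *)
have LV : Lambda X V <= 0.
  apply/lee_addgt0Pr => e e0; rewrite add0e; apply: limn_esup_le_near.
  have : \forall n \near \oo, (ln (b / a) / e <= n%:R)%R by exact: nbhs_infty_ger.
  apply: filterS => n nb; rewrite rate_le_expR; last first.
    by rewrite unlock; apply: integral_ge0 => t _; rewrite lee_fin expR_ge0.
  apply: (@le_trans _ _ (b / a)%:E); last first.
    rewrite lee_fin -[leLHS]lnK ?posrE ?divr_gt0// ler_expR -ler_pdivrMr//.
    by apply: le_trans nb _; rewrite ler_nat.
  rewrite expectation_occupation// mulrC EFinM -lee_pdivrMl ?invr_gt0// invrK.
  rewrite -esumZl ?(ltW a0)//; last first.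
    by move=> w; rewrite -EFinM lee_fin mulr_ge0 ?expR_ge0 ?wmass_chain_ge0.
  apply: le_trans (mart n); apply: le_esum => w _; rewrite -!EFinM lee_fin.
  rewrite mulrA mulrC ler_wpM2l ?wmass_chain_ge0// mulrC ler_wpM2l ?expR_ge0//.
  by have /andP[] := pfab (wlast w).
apply: (@le_trans _ _ ((pairing mu V)%:E - Lambda X V)); last first.
  by apply: ereal_sup_ubound; exists V.
rewrite -[leLHS](_ : (pairing mu V)%:E = _); last first.
  by rewrite /pairing /Rintegral fineK//; apply: integrable_fin_num => //; exact: bounded_integrable.
by rewrite leeDl// oppe_ge0.
Qed.

Lemma Lambda_star_ge0 (mu : probability S R) : 0 <= Lambda_star X mu.
Proof.
apply: le_trans (J1_le_Lambda_star mu).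
have := free_energy_le_J1 discS p mu (@bounded_fun_cst S R 0).
by rewrite free_energy0.
Qed.

End path_law.

(** * Reachability and non-admissible measures *)

Section reachability_facts.
Context d (S : measurableType d) (R : realType).
Variable p : R.-pker S ~> S.

Lemma reach_step x y : (0 < p x [set y])%E -> reach p x y.
Proof.
move=> pxy; exists 1%N, (fun i => if i == 0%N then x else y); split => //.
by move=> i; rewrite ltnS leqn0 => /eqP ->.
Qed.

Lemma reach_trans x y z : reach p x y -> reach p y z -> reach p x z.
Proof.
move=> [n [u [n0 ux uy up]]] [m [v [m0 vy vz vp]]].
exists (n + m)%N, (fun i => if (i <= n)%N then u i else v (i - n)%N); split => //.
- by rewrite addn_gt0 n0.
- by case: ifPn => [h|_]; rewrite ?addKn//; move: h; rewrite -{2}[n]addn0 leq_add2l leqNgt m0.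
- move=> i inm; case: (ltngtP i n) => [ni|ni|->].
  + by rewrite up.
  + rewrite subSn; last exact: ltnW.
    by apply: vp; rewrite ltn_subLR// ltnW.
  + by rewrite subSnn uy -vy; exact: vp.
Qed.

Lemma irreducible_class_unique C D x : irreducible_class p C ->
  irreducible_class p D -> C x -> D x -> C = D.
Proof.
move=> [_ sC mC] [_ sD mD] Cx Dx.
have sCD : strongly_connected p (C `|` D).
  move=> a b [Ca|Da] [Cb|Db]; [exact: sC| | |exact: sD].
    by apply: (@reach_trans _ x); [exact: sC|exact: sD].
  by apply: (@reach_trans _ x); [exact: sD|exact: sC].
by rewrite -(mC _ (@subsetUl _ C D) sCD); apply: mD => //; exact: subsetUr.
Qed.

Lemma irreducible_class_of x : reach p x x ->
  irreducible_class p [set y | reach p x y /\ reach p y x].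
Proof.
move=> xx; split; first by exists x.
  by move=> a b [_ ax] [xb _]; exact: reach_trans ax xb.
move=> D CD sD; apply/seteqP; split => // y Dy.
by split; apply: sD => //; exact: CD.
Qed.

Hypothesis countS : countable [set: S].
Hypothesis discS : forall A : set S, measurable A.

(** The points in mutual reach with a charged point form an irreducible class, and distinct classes
    are disjoint, so the masses can be regrouped by classes. *)
Lemma pre_admissible_recurrent (mu : probability S R) :
  (forall x, 0 < mass mu x -> reach p x x) -> pre_admissible p mu.
Proof.
move=> mur; exists (irreducible_class p) => // A.
(* Empty off the family, so that membership in [J C] alone certifies that [C] is a class. *)
pose J C := if `[< irreducible_class p C >] then A `&` C else set0.
have JE C : irreducible_class p C -> J C = A `&` C by move=> iC; rewrite /J asboolT.
have Jirr C x : J C x -> irreducible_class p C /\ C x.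
  by rewrite /J; case: asboolP => // iC [].
transitivity (\esum_(x in \bigcup_(C in irreducible_class p) J C) (mass mu x)%:E)%E.
  rewrite (measure_mass countS discS) esum_mkcond [RHS]esum_mkcond.
  apply: eq_esum => x _; case: ifPn => xA; case: ifPn => // xJ.
    rewrite (_ : mass mu x = 0)//; apply/eqP; rewrite eq_le mass_ge0// andbT leNgt.
    apply/negP => mx.
    move/negP: xJ; apply; rewrite inE.
    exists [set y | reach p x y /\ reach p y x]; first exact/irreducible_class_of/mur.
    rewrite JE; last exact/irreducible_class_of/mur.
    by split; [rewrite -inE|split; exact: mur].
  move: xJ; rewrite inE => -[C irrC]; rewrite JE// => -[Ax _].
  by move/negP: xA; rewrite inE.
transitivity (\esum_(C in irreducible_class p) \esum_(x in J C) (mass mu x)%:E)%E.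
  rewrite esum_esum => [|C x _ _]; last by rewrite lee_fin mass_ge0.
  rewrite (reindex_esum (irreducible_class p `*`` J) _ (fun u => u.2))//; split.
  - by move=> [C x] [/= irrC Jx]; exists C.
  - move=> [C x] [D y] /[!inE] -[/= irrC JC] [/= irrD JD] /= xy; subst y.
    have [_ Cx] := Jirr _ _ JC; have [_ Dx] := Jirr _ _ JD.
    by rewrite (irreducible_class_unique irrC irrD Cx Dx).
  - by move=> x [C irrC JC]; exists (C, x).
by apply: eq_esum => C irrC; rewrite JE// (measure_mass countS discS).
Qed.

End reachability_facts.

Section nonadmissible.
Context d d' (S : measurableType d) (Omega : measurableType d') (R : realType).
Variables (P : probability Omega R) (X : nat -> {RV P >-> S}).
Variables (beta : probability S R) (p : R.-pker S ~> S).
Hypothesis countS : countable [set: S].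
Hypothesis discS : forall A : set S, measurable A.
Hypothesis chain_X : markov_chain X beta p.
Local Notation cmass := (wmass (mass beta) (pmass p)).

Lemma cmass_gt0 n (w : word S n) : 0 < cmass w ->
  (0 < beta [set wnth w 0])%E /\
  forall i, (i < n)%N -> (0 < p (wnth w i) [set wnth w i.+1])%E.
Proof.
elim: n w => [|n IH] w /=.
  by rewrite -massE// lte_fin.
move=> h; have c0 := wmass_chain_ge0 beta p discS w.1.
have {}c0 : 0 < cmass w.1.
  by rewrite lt_def c0 andbT; apply: contraTneq h => ->; rewrite mul0r ltxx.
have [h1 h2] := IH _ c0; split => // i; rewrite ltnS leq_eqVlt => /predU1P[->|lin].
  by rewrite /= ltnn eqxx -pmass_gt0// -wlastE; rewrite pmulr_rgt0 in h.
by rewrite /= lin orbT; exact: h2.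
Qed.

Lemma cmass_reach n (w : word S n) i j : 0 < cmass w -> (i < j)%N -> (j <= n)%N ->
  reach p (wnth w i) (wnth w j).
Proof.
move=> /cmass_gt0[_ wp]; elim: j => [//|j IH]; rewrite ltnS leq_eqVlt => /predU1P[->|ij] jn.
  exact/reach_step/wp.
apply: reach_trans (IH ij (ltnW jn)) _.
exact/reach_step/wp.
Qed.

Lemma cmass_init_reach n (w : word S n) i : 0 < cmass w -> (i <= n)%N ->
  init_reach beta p (wnth w i).
Proof.
move=> w0; have [b0 _] := cmass_gt0 w0; case: i => [_|i lin]; first by left.
by right; exists (wnth w 0) => //; exact: cmass_reach.
Qed.

Lemma occupation_null n (U : set (probability S R)) :
  (forall w : word S n, 0 < cmass w -> ~ U (word_occupation R w)) ->
  P (occupation X n @^-1` U) = 0%E.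
Proof.
move=> h; rewrite (occupation_prob countS discS chain_X) esum1// => w /= Uw.
rewrite (_ : cmass w = 0)//; apply/eqP; rewrite eq_le wmass_chain_ge0// andbT leNgt.
apply/negP => w0.
exact: h Uw.
Qed.

Lemma word_occupation_charge n (w : word S n) (C : set S) :
  0 < fine (word_occupation R w C) -> exists2 i, (i <= n)%N & C (wnth w i).
Proof.
move=> wC; apply: contrapT => h; move: wC; rewrite (empiricalE R n) big1 ?mule0 ?ltxx//.
move=> i _; rewrite diracE memNset// => Ci; apply: h; exists i => //.
by rewrite -ltnS.
Qed.

(** Three kinds of failure. A charged point that cannot return to itself is visited at most once, so
    its occupation is at most [1 / (n + 1)]; only here must [n] be large. A charged class out of
    reach of [beta] is never visited, and two charged classes with no path either way are never both
    visited. *)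
Lemma nonadmissible_upper (mu : probability S R) : ~ admissible beta p mu ->
  exists U : set (probability S R), [/\ open U, U mu &
    \forall n \near \oo, P (occupation X n @^-1` U) = 0%E].
Proof.
have opC (C : set S) (c : R) : open [set nu : probability S R | c < fine (nu C)].
  rewrite (_ : [set _ | _] = [set nu : probability S R | c < pairing nu \1_C]).
    by apply: pairing_gt_open; exact: bounded_fun_indic.
  by apply/seteqP; split => nu /=; rewrite pairing_indic.
move=> nadm; have [rec|] := pselect (forall x, 0 < mass mu x -> reach p x x); last first.
  move=> /existsNP[x /not_implyP[mx nxx]].
  exists [set nu : probability S R | mass mu x / 2 < fine (nu [set x])]; split.
  - exact: opC.
  - by rewrite /= -/(mass mu x) ltr_pdivrMr// mulr_natr mulr2n ltrDl.
  have : \forall n \near \oo, (2 / mass mu x) <= n%:R by exact: nbhs_infty_ger.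
  apply: filterS => n nx; apply: occupation_null => w w0 /=.
  rewrite -[fine _]/(mass (empirical R n (wnth w)) x) empirical_mass.
  apply/negP; rewrite -leNgt.
  (* Two visits to [x] along a word of positive mass would give a path from [x] to itself, so at
     most one letter equals [x]. *)
  apply: (@le_trans _ _ (n.+1%:R^-1)).
    rewrite ler_piMr ?invr_ge0// -natr_sum -[leRHS]/(1%:R) ler_nat.
    have [h|/existsNP[i /not_implyP[ix _]]] :=
        pselect (forall i : 'I_n.+1, wnth w i = x -> False).
      rewrite big1// => i _; case: eqP => // /h//.
    rewrite (bigD1 i)//= ix eqxx big1// => j ji; case: eqP => // jx; exfalso.
    apply: nxx; case: (ltngtP i j) => [ij|ij|/val_inj ij].
    + by rewrite -{1}ix -jx; apply: cmass_reach => //; rewrite -ltnS.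
    + by rewrite -{1}jx -ix; apply: cmass_reach => //; rewrite -ltnS.
    + by rewrite ij eqxx in ji.
  rewrite -[leRHS]invrK lef_pV2 ?posrE ?invr_gt0 ?divr_gt0// invf_div.
  by apply: le_trans nx _; rewrite ler_nat.
have padm := pre_admissible_recurrent countS discS rec.
have chg C : charged_classes p mu C -> 0 < fine (mu C).
  by move=> [_ mC]; rewrite fine_gt0// mC -ge0_fin_numE ?fin_num_measure.
have [init|] := pselect (forall C, charged_classes p mu C -> init_reach_class beta p C);
    last first.
  move=> /existsNP[C /not_implyP[cC nC]].
  exists [set nu : probability S R | 0 < fine (nu C)]; split; [exact: opC|exact: chg|].
  apply: nearW => n; apply: occupation_null => w w0 /= /word_occupation_charge[i lin Ci].
  by apply: nC; exists (wnth w i) => //; exact: cmass_init_reach.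
have [tot|] := pselect (forall C D, charged_classes p mu C -> charged_classes p mu D ->
      reach_class p C D \/ reach_class p D C); first by exfalso; apply: nadm; split.
move=> /existsNP[C /existsNP[D /not_implyP[cC /not_implyP[cD nCD]]]].
exists ([set nu : probability S R | 0 < fine (nu C)] `&` [set nu | 0 < fine (nu D)]); split.
- by apply: openI; exact: opC.
- by split; exact: chg.
apply: nearW => n; apply: occupation_null => w w0 /= [].
move=> /word_occupation_charge[i lin Ci] /word_occupation_charge[j ljn Dj].
apply: nCD; case: (ltngtP i j) => ij.
- left; exists (wnth w i), (wnth w j); split => //; exact: cmass_reach.
- right; exists (wnth w j), (wnth w i); split => //; exact: cmass_reach.
- left; exists (wnth w i), (wnth w i); split => //; first by rewrite ij.
  by have [[_ sC _] _] := cC; exact: sC.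
Qed.

End nonadmissible.

(** * Words of the stationary chain *)

Section stationary_words.
Context (S : choiceType) (R : realType).
Variables (m : S -> R) (q k : S -> S -> R).
Hypothesis m0 : forall x, 0 <= m x.
Hypothesis m1 : (\esum_(x in [set: S]) (m x)%:E = 1)%E.
Hypothesis q0 : forall x y, 0 <= q x y.
Hypothesis q1 : forall x, 0 < m x -> (\esum_(y in [set: S]) (q x y)%:E = 1)%E.
Hypothesis mq : forall y, (\esum_(x in [set: S]) (m x * q x y)%:E = (m y)%:E)%E.
Hypothesis k0 : forall x y, 0 <= k x y.
Hypothesis k1 : forall x, (\esum_(y in [set: S]) (k x y)%:E = 1)%E.
Hypothesis kq : forall x y, m x * k x y = 0 -> m x * q x y = 0.
Variable rho : R.
Hypothesis rhoE :
  (\esum_(u in [set: S * S]) (entf (m u.1 * q u.1 u.2) (m u.1 * k u.1 u.2))%:E = rho%:E)%E.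
Local Notation Q := (wmass m q).
Local Notation K := (wmass m k).

Let Q0 n (w : word S n) : 0 <= Q w. Proof. exact: wmass_ge0. Qed.
Let K0 n (w : word S n) : 0 <= K w. Proof. exact: wmass_ge0. Qed.

Lemma esum_wlast n (g : S -> R) : (forall x, 0 <= g x) ->
  (\esum_(w in [set: word S n]) (Q w * g (wlast w))%:E =
   \esum_(x in [set: S]) (m x * g x)%:E)%E.
Proof.
elim: n g => [//|n IH] g g0.
rewrite (esum_pair (a := fun w y => (Q w * q (wlast w) y * g y)%:E)); last first.
  by move=> w y; rewrite lee_fin !mulr_ge0.
rewrite esum_exchange; last by move=> w y; rewrite lee_fin !mulr_ge0.
apply: eq_esum => y _; rewrite mulrC EFinM -mq -IH; last by move=> x.
rewrite -esumZl//; last by move=> w; rewrite lee_fin mulr_ge0.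
by apply: eq_esum => w _; rewrite -EFinM mulrC.
Qed.

Lemma esum_wmass n : (\esum_(w in [set: word S n]) (Q w)%:E = 1)%E.
Proof.
have := @esum_wlast n (fun=> 1) (fun=> ler01).
under eq_esum do rewrite mulr1; move=> ->.
by under eq_esum do rewrite mulr1.
Qed.

(** By stationarity the words ending at [y] have total mass [m y]. This confines words of positive
    mass to the points where [q] is known to be stochastic. *)
Lemma wmass_last_gt0 n (w : word S n) : 0 < Q w -> 0 < m (wlast w).
Proof.
case: n w => [//|n] w /= Qw; rewrite lt_def m0 andbT; apply: contraTneq Qw => my.
have h : (\esum_(v in [set: word S n]) (Q v * q (wlast v) w.2)%:E = 0)%E.
  by rewrite (@esum_wlast n (fun x => q x w.2))// mq my.
have h0 (v : word S n) : (0 <= (Q v * q (wlast v) w.2)%:E)%E by rewrite lee_fin mulr_ge0.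
have [->] := esum_eq0 h0 h (Logic.I : [set: word S n] w.1).
by rewrite ltxx.
Qed.

Lemma esum_wmass_next n (w : word S n) :
  (\esum_(y in [set: S]) (Q w * q (wlast w) y)%:E = (Q w)%:E)%E.
Proof.
under eq_esum do rewrite EFinM.
rewrite esumZl//; last by move=> y; rewrite lee_fin.
have := Q0 w; rewrite le_eqVlt => /predU1P[<-|Qw]; first by rewrite mul0e.
by rewrite q1 ?mule1//; exact: wmass_last_gt0.
Qed.

Lemma esum_wfirst n (g : S -> R) : (forall x, 0 <= g x) ->
  (\esum_(w in [set: word S n]) (Q w * g (wnth w 0))%:E =
   \esum_(x in [set: S]) (m x * g x)%:E)%E.
Proof.
elim: n g => [//|n IH] g g0; rewrite -IH//.
rewrite (esum_pair (a := fun w y => (Q w * q (wlast w) y * g (wnth w 0))%:E)); last first.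
  by move=> w y; rewrite lee_fin !mulr_ge0.
apply: eq_esum => w _; under eq_esum do rewrite mulrC EFinM.
by rewrite esumZl ?esum_wmass_next -?EFinM 1?mulrC// => y; rewrite lee_fin mulr_ge0.
Qed.

Lemma wsum_ge0 (g : S -> R) n (w : word S n) : (forall x, 0 <= g x) -> 0 <= wsum g w.
Proof. by move=> g0; rewrite wsum_wnth sumr_ge0. Qed.

(** Every letter has law [m], so the mean follows from linearity; this replaces an ergodic
    theorem. *)
Lemma esum_wsum n (g : S -> R) (c : R) : (forall x, 0 <= g x) ->
  (\esum_(x in [set: S]) (m x * g x)%:E = c%:E)%E ->
  (\esum_(w in [set: word S n]) (Q w * wsum g w)%:E = (n.+1%:R * c)%:E)%E.
Proof.
move=> g0 gc; elim: n => [|n IH]; first by rewrite mul1r.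
rewrite (esum_pair (a := fun w y => (Q w * q (wlast w) y * (wsum g w + g y))%:E)); last first.
  by move=> w y; rewrite lee_fin !mulr_ge0// addr_ge0// wsum_ge0.
transitivity (\esum_(w in [set: word S n]) (Q w * wsum g w)%:E +
   \esum_(w in [set: word S n.+1]) (Q w * g (wlast w))%:E)%E.
  rewrite (esum_pair (a := fun w y => (Q w * q (wlast w) y * g y)%:E)); last first.
    by move=> w y; rewrite lee_fin !mulr_ge0.
  rewrite -esumD; last 2 first.
  - by move=> w _; rewrite lee_fin mulr_ge0// wsum_ge0.
  - by move=> w _; apply: esum_ge0 => y _; rewrite lee_fin !mulr_ge0.
  apply: eq_esum => w _; under eq_esum do rewrite mulrDr EFinD.
  rewrite esumD; last 2 first.
  - by move=> y _; rewrite lee_fin !mulr_ge0// wsum_ge0.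
  - by move=> y _; rewrite lee_fin !mulr_ge0.
  congr (_ + _)%E; under eq_esum do rewrite mulrC EFinM.
  rewrite esumZl ?esum_wmass_next -?EFinM 1?mulrC// ?wsum_ge0//.
  by move=> y; rewrite lee_fin mulr_ge0.
by rewrite IH esum_wlast// gc -EFinD -[in RHS]natr1 mulrDl mul1r.
Qed.

Lemma wmass_dominated n (w : word S n) : K w = 0 -> Q w = 0.
Proof.
elim: n w => [//|n IH] w /=.
have [Qw0|Qw] := eqVneq (Q w.1) 0; first by rewrite Qw0 mul0r.
have {}Qw : 0 < Q w.1 by rewrite lt_def Qw Q0.
move/eqP; rewrite mulf_eq0 => /orP[/eqP/IH ->|/eqP kw]; first by rewrite mul0r.
have mw := wmass_last_gt0 Qw.
have := @kq (wlast w.1) w.2; rewrite kw mulr0 => /(_ erefl)/eqP.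
by rewrite mulf_eq0 gt_eqF//= => /eqP ->; rewrite mulr0.
Qed.

Let qk_dom x y : 0 < m x -> k x y = 0 -> q x y = 0.
Proof.
move=> mx kxy; have := @kq x y; rewrite kxy mulr0 => /(_ erefl)/eqP.
by rewrite mulf_eq0 gt_eqF//= => /eqP.
Qed.

Let rr x : \bar R := (\esum_(y in [set: S]) (entf (q x y) (k x y))%:E)%E.

Let e0 x y : 0 <= entf (m x * q x y) (m x * k x y).
Proof. by apply: entf_ge0; rewrite ?mulr_ge0//; exact: kq. Qed.

Let rr_finite x : 0 < m x -> (fine (rr x))%:E = rr x /\ 0 <= fine (rr x).
Proof.
move=> mx.
have r0 : (0 <= rr x)%E.
  by apply: esum_ge0 => y _; rewrite lee_fin entf_ge0//; exact: qk_dom.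
split; last exact: fine_ge0.
rewrite fineK// ge0_fin_numE//.
have : ((m x)%:E * rr x <= rho%:E)%E.
  rewrite -esumZl ?(ltW mx)//; last first.
    by move=> y; rewrite lee_fin entf_ge0//; exact: qk_dom.
  rewrite -rhoE (esum_pair (a := fun x y => (entf (m x * q x y) (m x * k x y))%:E)); last first.
    by move=> *; rewrite lee_fin.
  under eq_esum do rewrite -EFinM -entfM ?(ltW mx)//.
  rewrite -[leLHS](@esum_set1 _ _ x (fun x =>
    (\esum_(y in [set: S]) (entf (m x * q x y) (m x * k x y))%:E)%E)).
    rewrite esum_mkcond; apply: le_esum => z _; case: ifP => // _.
    by apply: esum_ge0 => y _; rewrite lee_fin.
  by apply: esum_ge0 => y _; rewrite lee_fin.
move=> h; rewrite ltey; apply/eqP => rx; move: h; rewrite rx gt0_muley ?lte_fin//.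
Qed.

Let rho_sum : (\esum_(x in [set: S]) (m x * fine (rr x))%:E = rho%:E)%E.
Proof.
rewrite -rhoE (esum_pair (a := fun x y => (entf (m x * q x y) (m x * k x y))%:E)); last first.
  by move=> *; rewrite lee_fin.
apply: eq_esum => x _; have := m0 x; rewrite le_eqVlt => /predU1P[mx|mx].
  rewrite -mx mul0r esum1// => y _; by rewrite !mul0r entf0l.
rewrite EFinM (rr_finite mx).1 -esumZl ?(ltW mx)//; last first.
  by move=> y; rewrite lee_fin entf_ge0//; exact: qk_dom.
by apply: eq_esum => y _; rewrite -EFinM entfM// ltW.
Qed.

Lemma rho_ge0 : 0 <= rho.
Proof. by rewrite -lee_fin -rhoE esum_ge0// => u _; rewrite lee_fin. Qed.

(** Conditional form of the chain rule: sum [entf_prod] over the next letter and cancel the finite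
    correction [K w + Q w]. The term added is the entropy [rr] of one step from the last letter. *)
Lemma esum_entf_next n (w : word S n) :
  (\esum_(y in [set: S]) (entf (Q w * q (wlast w) y) (K w * k (wlast w) y))%:E =
   (entf (Q w) (K w) + Q w * fine (rr (wlast w)))%:E)%E.
Proof.
have := Q0 w; rewrite le_eqVlt => /predU1P[Qw|Qw].
  rewrite -Qw mul0r addr0; under eq_esum do rewrite mul0r entf0l EFinM.
  by rewrite entf0l esumZl// ?k1 ?mule1// => y; rewrite lee_fin.
have mx := wmass_last_gt0 Qw; set x := wlast w.
have [rE r0] := rr_finite mx.
have ew : 0 <= entf (Q w) (K w) by apply: entf_ge0 => //; exact: wmass_dominated.
have exy y : 0 <= entf (q x y) (k x y) by apply: entf_ge0 => //; exact: qk_dom.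
have ewy y : 0 <= entf (Q w * q x y) (K w * k x y).
  apply: entf_ge0; rewrite ?mulr_ge0//.
  move/eqP; rewrite mulf_eq0 => /orP[/eqP/wmass_dominated ->|/eqP/qk_dom ->//].
    by rewrite mul0r.
  by rewrite mulr0.
have : (\esum_(y in [set: S]) (entf (Q w * q x y) (K w * k x y) + (K w * q x y + Q w * k x y))%:E =
  \esum_(y in [set: S]) ((Q w * entf (q x y) (k x y) + entf (Q w) (K w) * q x y)
    + (K w * k x y + Q w * q x y))%:E)%E.
  apply: eq_esum => y _; congr EFin; rewrite entf_prod//; last 2 first.
  - exact: wmass_dominated.
  - exact: qk_dom.
  by rewrite [entf (Q w) _ * _]mulrC.
have lin (c : R) (g : S -> R) : 0 <= c -> (forall y, 0 <= g y) ->
    (\esum_(y in [set: S]) (c * g y)%:E = c%:E * \esum_(y in [set: S]) (g y)%:E)%E.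
  move=> c0 g0; under eq_esum do rewrite EFinM.
  by rewrite esumZl// => y; rewrite lee_fin.
have add (f g : S -> R) : (forall y, 0 <= f y) -> (forall y, 0 <= g y) ->
    (\esum_(y in [set: S]) (f y + g y)%:E =
     \esum_(y in [set: S]) (f y)%:E + \esum_(y in [set: S]) (g y)%:E)%E.
  by move=> f0 g0; under eq_esum do rewrite EFinD; rewrite esumD// => y _; rewrite lee_fin.
have a1 y : 0 <= K w * q x y by rewrite mulr_ge0.
have a2 y : 0 <= Q w * k x y by rewrite mulr_ge0.
have a3 y : 0 <= Q w * entf (q x y) (k x y) by rewrite mulr_ge0.
have a4 y : 0 <= entf (Q w) (K w) * q x y by rewrite mulr_ge0.
have a5 y : 0 <= K w * k x y by rewrite mulr_ge0.
have a6 y : 0 <= Q w * q x y by rewrite mulr_ge0.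
have s1 y : 0 <= K w * q x y + Q w * k x y by rewrite addr_ge0.
have s2 y : 0 <= Q w * entf (q x y) (k x y) + entf (Q w) (K w) * q x y by rewrite addr_ge0.
have s3 y : 0 <= K w * k x y + Q w * q x y by rewrite addr_ge0.
rewrite (add _ _ ewy s1) (add _ _ s2 s3) (add _ _ a1 a2) (add _ _ a3 a4) (add _ _ a5 a6).
rewrite !lin// !k1 !q1// -/(rr x) -rE -!EFinM -!EFinD !mulr1.
move=> /(congr1 (fun z => z - (K w + Q w)%:E)%E).
rewrite addeK// -EFinB => ->; congr EFin; ring.
Qed.

(** The first letter has the same law under [Q] and [K] and contributes nothing; each further letter
    adds the mean of [rr] under [m], which is [rho]. *)
Lemma esum_entf n : (\esum_(w in [set: word S n]) (entf (Q w) (K w))%:E =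
  (n%:R * rho)%:E)%E.
Proof.
elim: n => [|n IH].
  rewrite mul0r esum1// => x _ /=; rewrite /entf.
  have := m0 x; rewrite le_eqVlt => /predU1P[<-|mx]; first by rewrite mul0r subrr add0r.
  by rewrite divff ?gt_eqF// ln1 mulr0 sub0r addNr.
have ew l (w : word S l) : 0 <= entf (Q w) (K w).
  by apply: entf_ge0 => //; exact: wmass_dominated.
rewrite (esum_pair (a := fun w y => (entf (Q w * q (wlast w) y) (K w * k (wlast w) y))%:E)); last first.
  by move=> w y; rewrite lee_fin; exact: (ew n.+1 (w, y)).
under eq_esum do rewrite esum_entf_next EFinD.
have Qr (w : word S n) : 0 <= Q w * fine (rr (wlast w)).
  have := Q0 w; rewrite le_eqVlt => /predU1P[<-|/wmass_last_gt0/rr_finite[_ h]].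
    by rewrite mul0r.
  by rewrite mulr_ge0.
rewrite esumD => [|w _|w _]; [|by rewrite lee_fin|by rewrite lee_fin].
rewrite IH -[in RHS]natr1 mulrDl mul1r EFinD; congr (_ + _)%E.
rewrite -rho_sum.
pose g x := if 0 < m x then fine (rr x) else 0.
transitivity (\esum_(w in [set: word S n]) (Q w * g (wlast w))%:E)%E.
  apply: eq_esum => w _; have := Q0 w; rewrite le_eqVlt => /predU1P[<-|Qw].
    by rewrite !mul0r.
  by rewrite /g wmass_last_gt0.
rewrite esum_wlast; last by rewrite /g => x; case: ifPn => // /rr_finite[].
apply: eq_esum => x _; rewrite /g; case: ifPn => // mx.
have -> : m x = 0 by apply/eqP; rewrite eq_le m0 leNgt mx.
by rewrite !mul0r.
Qed.

(** [F] is chosen before the length [n], so that paths joining its points have bounded length and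
    cost. Of the [3 * eta], each end point outside [F] costs one [eta] and the restriction to
    finitely many words another. The [1] in the entropy bound comes from the linear terms of
    [entf]. *)
Lemma word_selection (eta : R) : 0 < eta -> exists F : seq S,
  (forall x, x \in F -> 0 < m x) /\
  forall n, exists Xi : seq (word S n),
  [/\ uniq Xi, forall w, w \in Xi -> [/\ 0 < Q w, wnth w 0 \in F & wlast w \in F],
    1 - 3 * eta <= \sum_(w <- Xi) Q w <= 1,
    \sum_(w <- Xi) Q w * ln (Q w / K w) <= n%:R * rho + 1 &
    forall x, n.+1%:R * (m x - 3 * eta) <= \sum_(w <- Xi) Q w * wsum (\1_[set x]) w].
Proof.
move=> eta0.
have : ((1 - eta)%:E < \esum_(x in [set x | (0 < m x)%R]) (m x)%:E)%E.
  rewrite (_ : esum _ _ = 1%E) ?lte_fin ?ltrBlDr ?ltrDl//.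
  rewrite -m1 [in LHS]esum_mkcond; apply: eq_esum => x _; case: ifPn => //.
  by rewrite notin_setE /= => /negP; rewrite -leNgt => mx; congr EFin; apply/eqP; rewrite eq_le m0.
move=> /lt_esum_sum[F [uF Fm Feta]]; exists F; split; first exact: Fm.
move=> n.
pose f x : R := (x \notin F)%:R.
have f0 x : 0 <= f x by exact: ler0n.
have mf : (\esum_(x in [set: S]) (m x * f x)%:E <= eta%:E)%E.
  have : (\esum_(x in [set: S]) (m x * f x)%:E + \esum_(x in [set` F]) (m x)%:E = 1)%E.
    rewrite -m1 [X in (_ + X)%E]esum_mkcond -esumD.
    - apply: eq_esum => x _; rewrite /f; case: ifPn; rewrite ?inE ?notin_setE /=.
        by move=> ->; rewrite mulr0 add0e.
      by move=> /negP ->; rewrite mulr1 adde0.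
    - by move=> x _; rewrite lee_fin mulr_ge0.
    - by move=> x _; case: ifP; rewrite ?lee_fin.
  have := @sum_le_esum _ _ m [set` F] F uF (fun _ h => h) (fun x _ => m0 x).
  case: (\esum_(x in [set` F]) _)%E => [a||//]; last by move=> _; case: (esum _ _).
  case: (\esum_(x in [set: S]) _)%E => [b||//] //.
  by rewrite -EFinD !lee_fin => h1 -[h2]; lra.
pose D := [set w : word S n | [/\ 0 < Q w, wnth w 0 \in F & wlast w \in F]].
have : ((1 - 3 * eta)%:E < \esum_(w in D) (Q w)%:E)%E.
  have : (1 <= \esum_(w in D) (Q w)%:E + (eta%:E + eta%:E))%E.
    rewrite -(esum_wmass n).
    apply: (@le_trans _ _ (\esum_(w in D) (Q w)%:E +
      (\esum_(w in [set: word S n]) (Q w * f (wnth w 0))%:E +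
       \esum_(w in [set: word S n]) (Q w * f (wlast w))%:E))%E); last first.
      by rewrite leeD2l// leeD// ?esum_wfirst ?esum_wlast.
    have t1 (w : word S n) : (0 <= (Q w * f (wnth w 0))%:E)%E by rewrite lee_fin mulr_ge0.
    have t2 (w : word S n) : (0 <= (Q w * f (wlast w))%:E)%E by rewrite lee_fin mulr_ge0.
    have t3 (w : word S n) : (0 <= (Q w * f (wnth w 0))%:E + (Q w * f (wlast w))%:E)%E.
      by rewrite adde_ge0.
    have t4 (w : word S n) : (0 <= if w \in D then (Q w)%:E else 0)%E.
      by case: ifP; rewrite ?lee_fin.
    rewrite [X in (_ <= X + _)%E]esum_mkcond -!esumD//.
    apply: le_esum => w _; rewrite -EFinD.
    have fw1 := f0 (wnth w 0); have fw2 := f0 (wlast w).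
    case: ifPn => [_|]; first by rewrite -EFinD lee_fin lerDl addr_ge0// mulr_ge0.
    rewrite notin_setE /= => nD; rewrite add0e lee_fin.
    have := Q0 w; rewrite le_eqVlt => /predU1P[<-|Qw]; first by rewrite !mul0r addr0.
    rewrite -mulrDr ler_peMr// /f.
    have [h1|h1] := boolP (wnth w 0 \in F); have [h2|h2] := boolP (wlast w \in F) => /=;
      rewrite ?add0r ?addr0 ?lerDl//.
    by exfalso; apply: nD.
  case: (esum _ _) => [a||//]; last by move=> _; exact: ltry.
  by rewrite -!EFinD lee_fin lte_fin => h; lra.
move=> /lt_esum_sum[Xi [uXi XiD Xieta]]; exists Xi.
have Xi1 : \sum_(w <- Xi) Q w <= 1.
  by rewrite -lee_fin -(esum_wmass n); apply: sum_le_esum.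
split => //.
- by rewrite ltW.
- have : \sum_(w <- Xi) entf (Q w) (K w) <= n%:R * rho.
    rewrite -lee_fin -esum_entf; apply: sum_le_esum => // w _.
    by apply: entf_ge0 => //; exact: wmass_dominated.
  rewrite /entf big_split sumrB /= => h.
  have : 0 <= \sum_(w <- Xi) K w by exact: sumr_ge0.
  lra.
- move=> x; pose g := \1_[set x] : S -> R.
  have g0 y : 0 <= g y by rewrite /g indicE ler0n.
  have g1 y : g y <= 1 by rewrite /g indicE; case: (_ \in _).
  have sg (w : word S n) : wsum g w <= n.+1%:R.
    rewrite wsum_wnth (@le_trans _ _ (\sum_(i < n.+1) 1))//; last first.
      by rewrite sumr_const card_ord.
    exact: ler_sum.
  have gx : (\esum_(y in [set: S]) (m y * g y)%:E = (m x)%:E)%E.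
    rewrite -[RHS](@esum_set1 _ _ x (fun y => (m y)%:E)) ?lee_fin// [RHS]esum_mkcond.
    apply: eq_esum => y _; rewrite /g indicE.
    by case: (_ \in _); rewrite ?mulr1 ?mulr0.
  have h1 := esum_wsum n g0 gx.
  (* A partial sum is bounded by the full one only from above, so the lower bound on visits is
     obtained from the complementary count. *)
  have h2 : (\esum_(w in [set: word S n]) (Q w * (n.+1%:R - wsum g w))%:E <=
      (n.+1%:R * (1 - m x))%:E)%E.
    have : (\esum_(w in [set: word S n]) (Q w * (n.+1%:R - wsum g w))%:E +
       \esum_(w in [set: word S n]) (Q w * wsum g w)%:E = n.+1%:R%:E)%E.
      rewrite -esumD => [|w _|w _]; last 2 first.
      - by rewrite lee_fin mulr_ge0// subr_ge0.
      - by rewrite lee_fin mulr_ge0// wsum_ge0.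
      rewrite -[RHS]mule1 -(esum_wmass n) -esumZl//; last first.
        by move=> w; rewrite lee_fin.
      by apply: eq_esum => w _; rewrite -EFinD -EFinM; congr EFin; ring.
    rewrite h1; case: (esum _ _) => [a||//] //.
    by rewrite -EFinD lee_fin => -[h]; lra.
  have h3 : \sum_(w <- Xi) Q w * (n.+1%:R - wsum g w) <= n.+1%:R * (1 - m x).
    rewrite -lee_fin; apply: le_trans h2; apply: sum_le_esum => // w _.
    by rewrite mulr_ge0// subr_ge0.
  have h4 : \sum_(w <- Xi) Q w * (n.+1%:R - wsum g w) =
      n.+1%:R * \sum_(w <- Xi) Q w - \sum_(w <- Xi) Q w * wsum g w.
    by rewrite mulr_sumr -sumrB; apply: eq_bigr => w _; ring.
  have h5 : n.+1%:R * (1 - 3 * eta) <= n.+1%:R * \sum_(w <- Xi) Q w.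
    by rewrite ler_wpM2l// ltW.
  rewrite -/g; lra.
Qed.

End stationary_words.

(** * Families of paths with a given rate *)

Section path_families.
Context (S : choiceType) (R : realType).
Variable k : S -> S -> R.
Hypothesis k0 : forall x y, 0 <= k x y.

Fixpoint pprod x (u : seq S) : R :=
  if u is y :: u' then k x y * pprod y u' else 1.

Lemma pprod_ge0 x u : 0 <= pprod x u.
Proof. by elim: u x => [|y u IH] x //=; rewrite mulr_ge0. Qed.

Lemma pprod_cat x u v : pprod x (u ++ v) = pprod x u * pprod (last x u) v.
Proof. by elim: u x => [|y u IH] x /=; rewrite ?mul1r// IH mulrA. Qed.

Definition path_family x y (l : nat) (U : seq (seq S)) :=
  uniq U /\ forall u, u \in U -> size u = l /\ last x u = y.

(** Members of a family have equal length, so a concatenation determines its two parts and no path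
    is counted twice. *)
Lemma family_cat x y z l l' U V : path_family x y l U -> path_family y z l' V ->
  path_family x z (l + l') [seq u ++ v | u <- U, v <- V] /\
  \sum_(u <- [seq u ++ v | u <- U, v <- V]) pprod x u =
  (\sum_(u <- U) pprod x u) * (\sum_(v <- V) pprod y v).
Proof.
move=> [uU hU] [uV hV]; split; first split.
- apply: allpairs_uniq => // -[u v] [u' v'].
  move=> /allpairsP[[a b] [/= aU bV [-> ->]]] /allpairsP[[a' b'] [/= aU' bV' [-> ->]]] /= e.
  have sz : size a = size a' by rewrite (hU _ aU).1 (hU _ aU').1.
  by move/eqP: e; rewrite eqseq_cat// => /andP[/eqP -> /eqP ->].
- move=> _ /allpairsP[[a b] [/= aU bV ->]].
  by rewrite size_cat last_cat (hU _ aU).1 (hU _ aU).2 (hV _ bV).1 (hV _ bV).2.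
- rewrite big_allpairs_dep mulr_suml big_seq [RHS]big_seq; apply: eq_bigr => u uU'.
  rewrite mulr_sumr; apply: eq_bigr => v _.
  by rewrite pprod_cat (hU _ uU').2.
Qed.

(* For every [n] there is a family of paths from [x] to [y], of common length at
   most [theta * n] and total probability at least [exp (- n * r)], all visiting
   each [z] at least [n * v z] times, up to additive constants. *)
Definition reachable_rate (F : seq S) x y (theta : R) (v : S -> R) (r : R) :=
  exists C : R, forall n : nat, exists (l : nat) (U : seq (seq S)),
  [/\ path_family x y l U,
      forall u z, u \in U -> z \in F -> n%:R * v z - C <= (count_mem z u)%:R,
      l%:R <= n%:R * theta + C &
      expR (- (n%:R * r) - C) <= \sum_(u <- U) pprod x u].

Lemma reachable_rate_cat F x y z theta v r theta' v' r' :
  reachable_rate F x y theta v r -> reachable_rate F y z theta' v' r' ->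
  reachable_rate F x z (theta + theta') (fun a => v a + v' a) (r + r').
Proof.
move=> [C h] [C' h']; exists (C + C') => n.
have [l [U [fU cU lU pU]]] := h n; have [l' [V [fV cV lV pV]]] := h' n.
have [fUV sUV] := family_cat fU fV.
exists (l + l')%N, [seq u ++ v | u <- U, v <- V]; split => //.
- move=> _ a /allpairsP[[u w] [/= uU wV ->]] aF; rewrite count_cat natrD.
  have h1 := cU u a uU aF; have h2 := cV w a wV aF.
  rewrite mulrDr opprD addrACA; exact: lerD.
- by rewrite natrD mulrDr addrACA; exact: lerD.
- rewrite sUV mulrDr !opprD addrACA expRD; apply: ler_pM => //; exact: expR_ge0.
Qed.

(** A fixed path is absorbed by the additive constant: its length, visits and cost do not grow with
    [n]. *)
Lemma reachable_rate_path F x u : 0 < pprod x u ->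
  reachable_rate F x (last x u) 0 (fun=> 0) 0.
Proof.
move=> pu; exists ((size u)%:R + `|ln (pprod x u)|) => n.
have l0 := normr_ge0 (ln (pprod x u)).
exists (size u), [:: u]; split.
- by split => // w; rewrite inE => /eqP ->.
- move=> w z; rewrite inE => /eqP -> _; rewrite mulr0 sub0r.
  by apply: (@le_trans _ _ 0); rewrite ?oppr_le0 ?addr_ge0.
- by rewrite mulr0 add0r lerDl.
- rewrite big_seq1 mulr0 oppr0 add0r -[leRHS]lnK ?posrE// ler_expR.
  rewrite lerNl (@le_trans _ _ `|ln (pprod x u)|) ?lerDr//.
  by rewrite -normrN ler_norm.
Qed.

(** The loop family is iterated [j] times, [j] being the integer part of [n * s]. Rounding loses
    less than one loop, which [C] pays for. *)
Lemma reachable_rate_loops F x l (U : seq (seq S)) (c : S -> R) (s : R) :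
  path_family x x l U -> (forall z, 0 <= c z) ->
  (forall u z, u \in U -> z \in F -> c z <= (count_mem z u)%:R) ->
  0 < \sum_(u <- U) pprod x u -> 0 <= s ->
  reachable_rate F x x (s * l%:R) (fun z => s * c z)
    (- (s * ln (\sum_(u <- U) pprod x u))).
Proof.
move=> fU c0 cU P0 s0; set P := \sum_(u <- U) pprod x u in P0 *.
have iter j : exists V, [/\ path_family x x (j * l)%N V,
    forall u z, u \in V -> z \in F -> j%:R * c z <= (count_mem z u)%:R &
    \sum_(u <- V) pprod x u = P ^+ j].
  elim: j => [|j [V [fV cV pV]]].
    exists [:: [::]]; split; last by rewrite big_seq1.
      by split => // u; rewrite inE => /eqP ->.
    by move=> u z _ _; rewrite mul0r ler0n.
  have [fUV sUV] := family_cat fU fV.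
  exists [seq u ++ v | u <- U, v <- V]; split => //; last by rewrite sUV pV exprS.
  move=> _ a /allpairsP[[u w] [/= uU wV ->]] aF; rewrite count_cat natrD.
  by rewrite -natr1 mulrDl mul1r addrC lerD// ?cU// cV.
pose C := l%:R + \sum_(z <- F) c z + `|ln P|.
exists C => n.
have sumc z : z \in F -> c z <= \sum_(z <- F) c z.
  by move=> zF; rewrite (big_rem z)//= lerDl sumr_ge0.
have C1 := normr_ge0 (ln P).
have C2 : 0 <= \sum_(z <- F) c z by rewrite sumr_ge0.
have ns0 : 0 <= n%:R * s by rewrite mulr_ge0.
set j := Num.truncn (n%:R * s).
have /andP[j1 j2] : j%:R <= n%:R * s < j.+1%:R by rewrite truncn_itv.
have [V [fV cV pV]] := iter j.
exists (j * l)%N, V; split => //.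
- move=> u z uV zF; apply: le_trans (cV u z uV zF).
  have h : n%:R * s * c z <= j.+1%:R * c z by rewrite ler_wpM2r// ltW.
  rewrite -natr1 mulrDl mul1r in h.
  have := sumc z zF; have := ler0n R l; rewrite /C mulrA; lra.
- rewrite natrM mulrA (@le_trans _ _ (n%:R * s * l%:R))//; first by rewrite ler_wpM2r.
  by rewrite lerDl /C !addr_ge0.
- rewrite pV -[P in leRHS]lnK ?posrE// -expRM_natl ler_expR.
  have h : `|(n%:R * s - j%:R) * ln P| <= `|ln P|.
    rewrite normrM ler_piMl// ger0_norm ?subr_ge0//.
    by rewrite lerBlDr (le_trans (ltW j2))// -natr1 addrC.
  move: h; rewrite ler_norml => /andP[_ h].
  have l0 := ler0n R l; rewrite mulrBl in h; rewrite /C mulrN opprK mulrA; lra.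
Qed.

End path_families.

Section rate_to_probability.
Context d d' (S : measurableType d) (Omega : measurableType d') (R : realType).
Variables (P : probability Omega R) (X : nat -> {RV P >-> S}).
Variables (beta : probability S R) (p : R.-pker S ~> S).
Hypothesis countS : countable [set: S].
Hypothesis discS : forall A : set S, measurable A.
Hypothesis chain_X : markov_chain X beta p.

Let cyl x (u : seq S) : set Omega :=
  [set t | forall i, (i <= size u)%N -> X i t = nth x (x :: u) i].

Let cyl_rcons x u y : P (cyl x (rcons u y)) =
  (P (cyl x u) * p (last x u) [set y])%E.
Proof.
have := chain_X.2 (size u) (nth x (x :: rcons u y)).
have -> : nth x (x :: rcons u y) (size u).+1 = y by rewrite /= nth_rcons ltnn eqxx.
have -> : nth x (x :: rcons u y) (size u) = last x u.
  by rewrite -rcons_cons nth_rcons /= ltnSn (last_nth x).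
rewrite /cyl size_rcons => ->; congr (P _ * _)%E.
apply/seteqP; split => t /= h i iu; have := h i iu;
  by rewrite -rcons_cons nth_rcons /= ltnS iu.
Qed.

Let cyl_prob x u : P (cyl x u) = (mass beta x * pprod (pmass p) x u)%:E.
Proof.
elim/last_ind: u => [|u y IH].
  rewrite /= mulr1 massE// -chain_X.1; congr (P _).
  apply/seteqP; split => t /= h; first exact: h 0%N isT.
  by move=> i; rewrite leqn0 => /eqP ->.
by rewrite cyl_rcons IH -cats1 pprod_cat /= mulr1 mulrA [RHS]EFinM pmassE.
Qed.

Let measurable_cyl x u : measurable (cyl x u).
Proof.
rewrite (_ : cyl x u = \bigcap_(i in [set i | (i <= size u)%N]) (X i @^-1` [set nth x (x :: u) i])).
  by apply: bigcap_measurable => [|i _]; [exists 0%N|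
    rewrite -[X in measurable X]setTI; exact: measurable_funP].
by apply/seteqP; split => t /= h i ij; exact: h.
Qed.

(** Since [theta < 1] the paths fit into time [n]. Fixing only these first letters defines disjoint
    cylinders, and the free letters afterwards can only add visits, which are bounded from below. *)
Lemma reachable_rate_prob F x y theta v r e :
  reachable_rate (pmass p) F x y theta v r -> theta < 1 -> 0 < mass beta x -> 0 < e ->
  \forall n \near \oo, ((expR (- (n.+1%:R * (r + e))))%:E <=
   P (occupation X n @^-1` [set nu | forall z, z \in F -> (v z - e < mass nu z)%R]))%E.
Proof.
move=> [C h] th1 bx e0.
(* In turn: the paths have length at most [n]; the initial mass, [C] and the shift from [n] to
   [n + 1] are paid by the extra rate [e]; and so are the missing visits. *)
pose M := Num.max (C / (1 - theta))
  (Num.max ((C - ln (mass beta x) - r) / e) ((\sum_(z <- F) `|v z| + C) / e)).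
have : \forall n \near \oo, M <= n%:R by exact: nbhs_infty_ger.
apply: filterS => n; rewrite !ge_max => /andP[n1 /andP[n2 n3]].
have nn : n%:R <= n.+1%:R :> R by rewrite ler_nat.
have [l [U [[uU fU] cU lU pU]]] := h n.
have ln : (l <= n)%N.
  rewrite -(ler_nat R); apply: le_trans lU _; rewrite -lerBrDl.
  by move: n1; rewrite ler_pdivrMr ?subr_gt0// mulrBr mulr1.
apply: (@le_trans _ _ (\sum_(u <- U) P (cyl x u))%E).
  under eq_bigr do rewrite cyl_prob.
  rewrite sumEFin lee_fin -mulr_sumr.
  apply: (@le_trans _ _ (mass beta x * expR (- (n%:R * r) - C))); last by rewrite ler_pM2l.
  rewrite -[mass beta x]lnK ?posrE// -expRD ler_expR.
  move: n2; rewrite ler_pdivrMr// => n2.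
  have : n%:R * e <= n.+1%:R * e by rewrite ler_pM2r.
  rewrite -natr1 in nn *; lra.
rewrite fsbig_seq// -measure_fin_bigcup//; last first.
  move=> u u' /= uU' u'U' [t [/= tu tu']].
  have su := (fU _ uU').1; have su' := (fU _ u'U').1.
  apply: (@eq_from_nth _ x); first by rewrite su su'.
  by move=> i iu; have := tu i.+1 iu; rewrite tu' //= su' -su.
apply: le_measure; rewrite ?inE.
- by apply: fin_bigcup_measurable.
- exact: measurable_occupation.
move=> t [u /= uU' tu] z zF; rewrite /= [mass _ _]empirical_mass.
have := cU u z uU' zF => cu.
have su := (fU _ uU').1.
have cnt : (count_mem z u)%:R <= \sum_(i < n.+1) (X i t == z)%:R :> R.
  rewrite -natr_sum ler_nat -sum1_count big_mkcond /=.
  rewrite (big_nth x) big_mkord su big_ord_recl.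
  rewrite -(big_mkord xpredT (fun i => (X i.+1 t == z) : nat)).
  rewrite (@big_cat_nat _ _ _ l)//= big_mkord.
  rewrite addnC -addnA; apply: leq_trans (leq_addr _ _).
  apply: leq_sum => i _; have -> : nth x u i = X i.+1 t by rewrite tu// su.
  by case: eqP.
rewrite mulrC ltr_pdivlMr ?ltr0n//; apply: lt_le_trans cnt; apply: lt_le_trans cu.
have vz : v z <= \sum_(z <- F) `|v z|.
  apply: (le_trans (ler_norm _)); rewrite (big_rem z)//= lerDl sumr_ge0//.
move: n3; rewrite ler_pdivrMr// => n3.
rewrite -natr1 in nn *; lra.
Qed.

End rate_to_probability.

(** * From words to loops *)

Section word_paths.
Context (S : choiceType) (R : realType).
Variables (m : S -> R) (k : S -> S -> R).
Hypothesis m01 : forall x, 0 <= m x <= 1.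
Hypothesis k0 : forall x y, 0 <= k x y.

Fixpoint wtail n : word S n -> seq S :=
  match n with 0 => fun _ => [::] | l.+1 => fun w => rcons (wtail w.1) w.2 end.

Lemma size_wtail n (w : word S n) : size (wtail w) = n.
Proof. by elim: n w => [//|n IH] w /=; rewrite size_rcons IH. Qed.

Lemma last_wtail n (w : word S n) : last (wnth w 0) (wtail w) = wlast w.
Proof. by case: n w => [//|n] w /=; rewrite last_rcons. Qed.

Lemma wmass_wtail n (w : word S n) :
  wmass m k w = m (wnth w 0) * pprod k (wnth w 0) (wtail w).
Proof.
elim: n w => [|n IH] w /=; first by rewrite mulr1.
by rewrite -cats1 pprod_cat /= mulr1 mulrA -IH last_wtail.
Qed.

Lemma wtail_inj n (w w' : word S n) : wnth w 0 = wnth w' 0 ->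
  wtail w = wtail w' -> w = w'.
Proof.
elim: n w w' => [//|n IH] [w x] [w' y] /= h0 /rcons_inj[h1 ->].
by rewrite (IH _ _ h0 h1).
Qed.

Definition wcount z n (w : word S n) := count_mem z (wnth w 0 :: wtail w).

Lemma wcount_wsum z n (w : word S n) : (wcount z w)%:R = wsum (\1_[set z]) w :> R.
Proof.
have ind x : (x == z)%:R = \1_[set z] x :> R.
  by rewrite indicE; congr ((nat_of_bool _)%:R); apply/eqP/idP; rewrite inE.
elim: n w => [|n IH] w /=; first by rewrite /wcount /= addn0 ind.
by rewrite -IH /wcount /= -cats1 count_cat /= addn0 addnA natrD -ind.
Qed.

Lemma wcount_le z n (w : word S n) : (wcount z w <= n.+1)%N.
Proof. by rewrite (leq_trans (count_size _ _))//= size_wtail. Qed.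

Variable q : S -> S -> R.
Local Notation Q := (wmass m q).
Local Notation K := (wmass m k).

Lemma reachable_rate_mono (s0 : seq S) x y theta theta' (v v' : S -> R) r r' :
  theta <= theta' -> (forall z, z \in s0 -> v' z <= v z) -> r <= r' ->
  reachable_rate k s0 x y theta v r -> reachable_rate k s0 x y theta' v' r'.
Proof.
move=> tt vv rr [C h]; exists C => l; have [l' [V [h1 h2 h3 h4]]] := h l.
exists l', V; split => //.
- move=> u z uV zs; apply: le_trans (h2 u z uV zs); rewrite lerD2r.
  by rewrite ler_wpM2l// vv.
- by apply: le_trans h3 _; rewrite lerD2r ler_wpM2l.
- by apply: le_trans h4; rewrite ler_expR lerD2r lerN2 ler_wpM2l.
Qed.

(** The bridge [br] closes the words of [G] into loops at [a], iterated at frequency [t] times their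
    mass [M]. By [log_sum] the cost of the whole group is at most the entropy sum of its words minus
    [M * ln M]; the latter term is at most the [1] in the rate. *)
Lemma group_rate (s0 : seq S) n (G : seq (word S n)) (a b : S) (br : seq S)
    (c : S -> R) (t : R) :
  uniq G -> G != [::] ->
  (forall w, w \in G -> [/\ 0 < Q w, 0 < K w, wnth w 0 = a & wlast w = b]) ->
  0 < pprod k b br -> last b br = a -> br != [::] ->
  (forall z, 0 <= c z) ->
  (forall w z, w \in G -> z \in s0 -> c z <= (wcount z w)%:R) -> 0 <= t ->
  reachable_rate k s0 a a (t * \sum_(w <- G) Q w * (n + size br)%:R)
    (fun z => t * \sum_(w <- G) Q w * c z)
    (t * (\sum_(w <- G) Q w * ln (Q w / K w) + 1 -
          (\sum_(w <- G) Q w) * ln (pprod k b br))).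
Proof.
move=> uG Gn hG br0 bra brn c0 cG t0.
set M := \sum_(w <- G) Q w.
have [w0 w0G] : exists w, w \in G by case: (G) Gn => // w s _; exists w; rewrite inE eqxx.
have M0 : 0 < M.
  rewrite /M (big_rem w0)//= ltr_wpDr//; last by have [] := hG _ w0G.
  by rewrite big_seq sumr_ge0// => w /mem_rem/hG[/ltW].
pose U := [seq wtail w ++ br | w <- G].
have Usum : \sum_(u <- U) pprod k a u =
    (\sum_(w <- G) pprod k a (wtail w)) * pprod k b br.
  rewrite big_map mulr_suml big_seq [RHS]big_seq; apply: eq_bigr => w wG.
  have [_ _ wa wb] := hG _ wG.
  by rewrite pprod_cat -wb -wa last_wtail.
set KG := \sum_(w <- G) K w.
have KG0 : 0 < KG.
  rewrite /KG (big_rem w0)//= ltr_wpDr//; last by have [] := hG _ w0G.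
  by rewrite big_seq sumr_ge0// => w /mem_rem/hG[_ /ltW].
have KU : KG * pprod k b br <= \sum_(u <- U) pprod k a u.
  rewrite Usum ler_pM2r// /KG big_seq [leRHS]big_seq; apply: ler_sum => w wG.
  have [_ _ <- _] := hG _ wG; rewrite wmass_wtail ler_piMl ?pprod_ge0//.
  by have /andP[] := m01 (wnth w 0).
have PU : 0 < \sum_(u <- U) pprod k a u by rewrite (lt_le_trans _ KU)// mulr_gt0.
have fU : path_family a a (n + size br) U.
  split.
    rewrite map_inj_in_uniq// => w w' wG w'G.
    have [_ _ wa _] := hG _ wG; have [_ _ wa' _] := hG _ w'G.
    move=> /eqP; rewrite eqseq_cat ?size_wtail// => /andP[/eqP h _].
    by apply: wtail_inj => //; rewrite wa wa'.
  move=> _ /mapP[w wG ->]; have [_ _ wa wb] := hG _ wG.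
  by rewrite size_cat size_wtail last_cat -wa last_wtail wb bra wa.
(* The path omits the initial letter [a] of the word, but the bridge is nonempty and ends at [a], so
   no visit is lost. *)
have cU u z : u \in U -> z \in s0 -> c z <= (count_mem z u)%:R.
  move=> /mapP[w wG ->] zs; apply: (le_trans (cG _ _ wG zs)).
  rewrite ler_nat /wcount /= count_cat addnC leq_add2l.
  have [_ _ -> _] := hG _ wG; case: eqP => // <-.
  rewrite -has_count has_pred1 -bra.
  by case: (br) brn => // y s _; rewrite /= mem_last.
have tM : 0 <= t * M by rewrite mulr_ge0// ltW.
have := reachable_rate_loops fU c0 cU PU tM.
have L : - (t * M * ln (\sum_(u <- U) pprod k a u)) <=
    t * (\sum_(w <- G) Q w * ln (Q w / K w) + 1 - M * ln (pprod k b br)).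
  rewrite -mulrA -mulrN ler_wpM2l//.
  have h1 : ln KG + ln (pprod k b br) <= ln (\sum_(u <- U) pprod k a u).
    by rewrite -lnM ?posrE// ler_ln ?posrE ?mulr_gt0.
  have h2 : M * ln (M / KG) <= \sum_(w <- G) Q w * ln (Q w / K w).
    apply: log_sum => // w /hG[wq wk _ _]; [exact: ltW|exact: ltW|].
    by move=> w0'; rewrite w0' ltxx in wk.
  have h3 := neg_xlnx_le1 (ltW M0).
  have h4 : M * (ln KG + ln (pprod k b br)) <= M * ln (\sum_(u <- U) pprod k a u).
    by rewrite ler_pM2l.
  rewrite ln_div ?posrE// in h2; lra.
apply: reachable_rate_mono => // [|z _]; first by rewrite -mulr_suml mulrA.
by rewrite -mulr_suml mulrA.
Qed.

Lemma reachable_rate_chain (J : eqType) (s0 : seq S) (st : J -> S) (theta r : J -> R)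
    (v : J -> S -> R) (e : rel J) :
  (forall i j, e i j -> exists2 u, 0 < pprod k (st i) u & last (st i) u = st j) ->
  forall js i, path e i js ->
  (forall j, j \in i :: js -> reachable_rate k s0 (st j) (st j) (theta j) (v j) (r j)) ->
  reachable_rate k s0 (st i) (st (last i js)) (\sum_(j <- i :: js) theta j)
    (fun z => \sum_(j <- i :: js) v j z) (\sum_(j <- i :: js) r j).
Proof.
move=> br; elim=> [|j js IH] i /=.
  move=> _ h; have := h i (mem_head _ _).
  by apply: reachable_rate_mono => [|z _|]; rewrite big_seq1.
move=> /andP[/br[u u0 uj] pj] h.
have h1 := h i (mem_head _ _).
have h2 := reachable_rate_path s0 u0; rewrite uj in h2.
have h3 : reachable_rate k s0 (st j) (st (last j js)) (\sum_(j <- j :: js) theta j)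
    (fun z => \sum_(j <- j :: js) v j z) (\sum_(j <- j :: js) r j).
  by apply: IH => // l ljs; apply: h; rewrite inE ljs orbT.
have := reachable_rate_cat h1 (reachable_rate_cat h2 h3).
apply: reachable_rate_mono => [|z _|]; rewrite add0r.
- by rewrite [leRHS]big_cons.
- by rewrite [leLHS]big_cons.
- by rewrite [leRHS]big_cons.
Qed.

End word_paths.

Lemma sum_groups (V : nmodType) (I J : eqType) (key : I -> J) (s : seq I) (f : I -> V) :
  \sum_(j <- undup (map key s)) \sum_(i <- [seq i <- s | key i == j]) f i =
  \sum_(i <- s) f i.
Proof.
under eq_bigr do rewrite big_filter big_mkcond.
rewrite exchange_big /= big_seq [RHS]big_seq; apply: eq_bigr => i si.
rewrite (bigD1_seq (key i)) ?undup_uniq//=; last by rewrite mem_undup map_f.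
by rewrite eqxx big1 ?addr0// => j; rewrite eq_sym => /negbTE ->.
Qed.

Lemma quantized_bounds (R : realType) (c n L : nat) :
  let x := ((c * L.+1) %/ n.+1)%:R * n.+1%:R / L.+1%:R : R in
  [/\ 0 <= x, x <= c%:R & c%:R - n.+1%:R / L.+1%:R <= x].
Proof.
move=> x; have L0 : 0 < L.+1%:R :> R by rewrite ltr0n.
split; rewrite /x.
- by rewrite divr_ge0// mulr_ge0.
- by rewrite ler_pdivrMr// -!natrM ler_nat leq_trunc_div.
- rewrite -(ler_pM2r L0) mulrBl !divfK ?gt_eqF// lerBlDr -!natrM -natrD ler_nat.
  by rewrite addnC -mulSn ltnW// ltn_ceil.
Qed.

(* The number of visits of [w] to [z], rounded down to a multiple of
   [(n + 1) / (L + 1)]. *)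
Definition wlow (R : realType) (S : choiceType) L n (w : word S n) z : R :=
  ((wcount z w * L.+1) %/ n.+1)%:R * n.+1%:R / L.+1%:R.

(* [J] does not depend on the length of the words, so that splitting them into
   classes costs no exponential rate. *)
Lemma word_classes (R : realType) (S : choiceType) (F s0 : seq S) (L : nat) :
  exists J : finType, forall n, exists key : word S n -> J,
    forall w w', wnth w 0 \in F -> wlast w \in F -> wnth w' 0 \in F -> wlast w' \in F ->
    key w = key w' -> [/\ wnth w 0 = wnth w' 0, wlast w = wlast w' &
      forall z, z \in s0 -> wlow R L w z = wlow R L w' z].
Proof.
(* A count of at most [n + 1] is rounded to one of the values [0] to [L + 1], hence [L.+2] of them,
   whatever [n] is. *)
exists ('I_(size F).+1 * 'I_(size F).+1 * {ffun 'I_(size s0) -> 'I_L.+2})%type => n.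
exists (fun w => (inord (index (wnth w 0) F), inord (index (wlast w) F),
  [ffun i : 'I_(size s0) => inord ((wcount (tnth (in_tuple s0) i) w * L.+1) %/ n.+1)])).
move=> w w' a1 b1 a2 b2 [].
move=> /(congr1 val); rewrite /= !inordK ?ltnS ?index_size// => i1.
move=> /(congr1 val); rewrite /= !inordK ?ltnS ?index_size// => i2.
move=> /ffunP i3; split.
- by rewrite -[LHS](nth_index (wnth w 0) a1) i1 nth_index.
- by rewrite -[LHS](nth_index (wnth w 0) b1) i2 nth_index.
- move=> z zs; have zi : (index z s0 < size s0)%N by rewrite index_mem.
  have := i3 (Ordinal zi); rewrite !ffunE => /(congr1 val) /=.
  have qb (v : word S n) : (wcount z v * L.+1 %/ n.+1 < L.+2)%N.
    rewrite ltnS -[leqRHS](mulKn _ (ltn0Sn n)) leq_div2r//.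
    by rewrite leq_mul2r wcount_le.
  have -> : tnth (in_tuple s0) (Ordinal zi) = z by rewrite (tnth_nth z) /= nth_index.
  by rewrite !inordK// /wlow => ->.
Qed.

(** Accounting for [stationary_rate]: time lost to bridges, mass lost in [word_selection], and the
    rounding of the counts, which costs [n1 / L] per word. Here [A] is the mean number of visits and
    [M] the mass of the selected words. *)
Lemma visits_bound (R : realType) (eta e t n1 L A M mz : R) :
  0 < t -> t * n1 <= 1 -> 1 - 2 * eta <= t * n1 -> n1 * (mz - 3 * eta) <= A ->
  0 <= M <= 1 -> 0 < L -> 4 / e <= L -> 0 < e -> 20 * eta <= e -> 0 < eta -> mz <= 1 ->
  0 <= n1 -> mz - e <= t * (A - n1 / L * M).
Proof.
move=> t0 T1 T2 hA /andP[M0 M1] L0 hL e0 hb eta0 mz1 n10.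
have h1 : t * (n1 * (mz - 3 * eta)) <= t * A by rewrite ler_pM2l.
have iL : L^-1 <= e / 4 by rewrite -[leRHS]invrK invfM invrK mulrC lef_pV2 ?posrE// divr_gt0.
have h2 : t * n1 * M <= 1 by rewrite mulr_ile1// mulr_ge0// ltW.
have h3 : t * n1 * M * L^-1 <= e / 4.
  apply: le_trans iL; rewrite ler_piMl// invr_ge0 ltW//.
have h4 : 0 <= (1 - t * n1) * (1 - (mz - 3 * eta)).
  by rewrite mulr_ge0//; lra.
have -> : t * (A - n1 / L * M) = t * A - t * n1 * M * L^-1 by ring.
lra.
Qed.

(** Each of the [N] classes adds one [t] to the rate and the bridges add [C * M]; as [t] is at most
    [1 / n], a large [n] makes both negligible. *)
Lemma rate_bound (R : realType) (rho e t n E M N C : R) :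
  0 < t -> t * n <= 1 -> E <= n * rho + 1 -> 0 <= rho -> 0 <= M <= 1 -> 0 <= C ->
  N + 1 + C <= e * n -> 0 <= e -> t * (E + C * M) + N * t <= rho + e.
Proof.
move=> t0 tn hE rho0 /andP[M0 M1] C0 hN e0.
have h1 : t * E <= t * (n * rho + 1) by rewrite ler_pM2l.
have h2 : C * M <= C by rewrite ler_piMr.
have h3 : t * (C * M) <= t * C by rewrite ler_pM2l.
have h4 : t * (N + 1 + C) <= t * (e * n) by rewrite ler_pM2l.
have h5 : (t * n) * rho <= rho by rewrite ler_piMl.
have h6 : (t * n) * e <= e by rewrite ler_piMl.
lra.
Qed.

Section stationary_rate.
Context (S : choiceType) (R : realType).
Variables (m : S -> R) (q k : S -> S -> R).
Hypothesis m01 : forall x, 0 <= m x <= 1.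
Hypothesis m1 : (\esum_(x in [set: S]) (m x)%:E = 1)%E.
Hypothesis q0 : forall x y, 0 <= q x y.
Hypothesis q1 : forall x, 0 < m x -> (\esum_(y in [set: S]) (q x y)%:E = 1)%E.
Hypothesis mq : forall y, (\esum_(x in [set: S]) (m x * q x y)%:E = (m y)%:E)%E.
Hypothesis k0 : forall x y, 0 <= k x y.
Hypothesis k1 : forall x, (\esum_(y in [set: S]) (k x y)%:E = 1)%E.
Hypothesis kq : forall x y, m x * k x y = 0 -> m x * q x y = 0.
Variable rho : R.
Hypothesis rhoE :
  (\esum_(u in [set: S * S]) (entf (m u.1 * q u.1 u.2) (m u.1 * k u.1 u.2))%:E = rho%:E)%E.
Variable rch : S -> S -> Prop.
Hypothesis rch_path : forall x y, rch x y ->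
  exists u, [/\ 0 < pprod k x u, last x u = y & u != [::]].
Hypothesis rch_total : forall x y, 0 < m x -> 0 < m y -> rch x y \/ rch y x.
Hypothesis rch_return : forall n (w : word S n), 0 < wmass m q w -> rch (wlast w) (wnth w 0).
Local Notation Q := (wmass m q).
Local Notation K := (wmass m k).

Let m0 x : 0 <= m x. Proof. by have /andP[] := m01 x. Qed.

Lemma stationary_rate (s0 : seq S) (e : R) : 0 < e -> exists x y theta v r,
  [/\ 0 < m x, theta < 1, forall z, z \in s0 -> m z - e <= v z, r <= rho + e &
      reachable_rate k s0 x y theta v r].
Proof.
move=> e0.
have [eta [eta0 eta6 etae]] : exists eta : R, [/\ 0 < eta, eta <= 6^-1 & 20 * eta <= e].
  exists (Num.min (6^-1) (e / 20)); split.
  - by rewrite lt_min divr_gt0// invr_gt0 ltr0n.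
  - by rewrite ge_min lexx.
  - by rewrite mulrC -ler_pdivlMr// ge_min lexx orbT.
have [L Le] : exists L : nat, 4 / e <= L.+1%:R.
  exists (Num.truncn (4 / e)).
  have /andP[_ /ltW//] :
      (Num.truncn (4 / e))%:R <= 4 / e < (Num.truncn (4 / e)).+1%:R.
  by rewrite truncn_itv// divr_ge0// ltW.
have [F [Fm sel]] := word_selection m0 m1 q0 q1 mq k0 k1 kq rhoE eta0.
have /choice[br0 brP0] (u : S * S) : exists b : seq S, rch u.1 u.2 ->
    [/\ 0 < pprod k u.1 b, last u.1 b = u.2 & b != [::]].
  have [ru|nru] := pselect (rch u.1 u.2); last by exists [::].
  by have [b hb] := rch_path ru; exists b.
pose br b a := br0 (b, a).
have brP b a : rch b a -> [/\ 0 < pprod k b (br b a), last b (br b a) = a & br b a != [::]].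
  exact: brP0 (b, a).
pose B : nat := (\sum_(b <- F) \sum_(a <- F) size (br b a)).+1.
pose Cb : R := \sum_(b <- F) \sum_(a <- F) `|ln (pprod k b (br b a))|.
have Cb0 : 0 <= Cb by rewrite sumr_ge0// => b _; rewrite sumr_ge0.
have brB b a : b \in F -> a \in F -> (size (br b a) <= B)%N.
  move=> bF aF; rewrite /B (big_rem b)//= (big_rem a)//=.
  by rewrite -addnA; apply: leq_trans (leq_addr _ _) (leqnSn _).
have brC b a : b \in F -> a \in F -> - ln (pprod k b (br b a)) <= Cb.
  move=> bF aF; apply: (@le_trans _ _ `|ln (pprod k b (br b a))|).
    by rewrite -normrN ler_norm.
  rewrite /Cb (big_rem b)//= (big_rem a)//= -addrA lerDl addr_ge0 ?sumr_ge0//.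
  by move=> i _; rewrite sumr_ge0.
have [J keys] := word_classes R F s0 L.
pose N : R := #|J|%:R.
(* Only now is the length fixed. [F], the bridges with their bounds [B] and [Cb], and the number [N]
   of classes were chosen before it, so [n] can dominate all of them. *)
have [n nN] : exists n : nat, Num.max ((N + 1 + Cb) / e) (B%:R / eta) <= n%:R.
  exists (Num.truncn (Num.max ((N + 1 + Cb) / e) (B%:R / eta))).+1.
  set a := Num.max _ _; have a0 : 0 <= a by rewrite le_max (divr_ge0 (ler0n _ B) (ltW eta0)) orbT.
  by have := truncn_itv a0; rewrite -/a => /andP[_ /ltW].
move: nN; rewrite ge_max => /andP[nN nB].
have [Xi [uXi hXi /andP[Xi1 Xi2] Xient Xic]] := sel n.
have [ws wsXi] : exists w, w \in Xi.
  case: (Xi) Xi1 => [|w s _]; last by exists w; rewrite inE eqxx.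
  by rewrite big_nil => h; exfalso; lra.
have [key keyP0] := keys n.
pose G kk := [seq w <- Xi | key w == kk].
pose rep kk := head ws (G kk).
pose st kk := wnth (rep kk) 0.
pose en kk := wlast (rep kk).
pose ks := undup (map key Xi).
pose low (w : word S n) z : R := wlow R L w z.
have repG kk : kk \in ks -> rep kk \in G kk.
  rewrite mem_undup => /mapP[w wXi kw]; rewrite /rep.
  have : w \in G kk by rewrite mem_filter wXi kw eqxx.
  by case: (G kk) => // a l _; rewrite /= inE eqxx.
have GXi kk w : w \in G kk -> w \in Xi /\ key w = kk.
  by rewrite mem_filter => /andP[/eqP].
have keyP w w' : w \in Xi -> w' \in Xi -> key w = key w' ->
   [/\ wnth w 0 = wnth w' 0, wlast w = wlast w' & forall z, z \in s0 -> low w z = low w' z].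
  move=> wX wX'; have [_ a1 b1] := hXi _ wX; have [_ a2 b2] := hXi _ wX'.
  exact: keyP0.
(* Iterations per unit of time and of mass. A closed word has length at most [n + B], so all loops
   together use a share of at most [1 - eta] of the time and [theta < 1]. *)
pose t := (1 - eta) / (n + B)%:R.
have nB0 : 0 < (n + B)%:R :> R by rewrite ltr0n addnS.
have t0 : 0 < t by rewrite divr_gt0// subr_gt0; lra.
have tnB : t * (n + B)%:R = 1 - eta by rewrite divfK ?gt_eqF.
have tn : t * n%:R <= 1 - eta by rewrite -tnB ler_pM2l// ler_nat leq_addr.
have tB : t * B%:R <= eta.
  apply: (@le_trans _ _ (t * (eta * n%:R))).
    by rewrite ler_pM2l// mulrC -ler_pdivrMr.
  by rewrite mulrCA ler_piMr ?(ltW eta0)//; lra.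
have tn1 : t * n.+1%:R = 1 - eta - t * (B%:R - 1).
  by rewrite -tnB -[n.+1%:R]natr1 natrD; ring.
have B1 : 1 <= B%:R :> R by rewrite ler1n.
pose theta kk := \sum_(w <- G kk) t * (n + B)%:R * Q w.
pose v kk z := \sum_(w <- G kk) t * (Q w * ((wcount z w)%:R - n.+1%:R / L.+1%:R)).
pose r kk := \sum_(w <- G kk) t * (Q w * ln (Q w / K w) + Q w * Cb) + t.
have rate kk : kk \in ks ->
    reachable_rate k s0 (st kk) (st kk) (theta kk) (v kk) (r kk).
  move=> kks; have rG := repG kk kks.
  have [rX kr] := GXi _ _ rG.
  have hG w : w \in G kk -> [/\ 0 < Q w, 0 < K w, wnth w 0 = st kk & wlast w = en kk].
    move=> /GXi[wX kw]; have [Qw _ _] := hXi _ wX.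
    have [e1 e2 _] := keyP _ _ wX rX (etrans kw (esym kr)); split => //.
    rewrite lt_def wmass_ge0// andbT; apply: contraTneq Qw => Kw.
    by rewrite (wmass_dominated m0 q0 mq kq Kw) ltxx.
  have [Qr rF1 rF2] := hXi _ rX.
  have [b0 bl bn] := brP (en kk) (st kk) (rch_return Qr).
  have Gn : G kk != [::] by case: (G kk) rG.
  have lowb w z : w \in G kk -> z \in s0 -> low (rep kk) z <= (wcount z w)%:R /\
      (wcount z w)%:R - n.+1%:R / L.+1%:R <= low (rep kk) z.
    move=> /GXi[wX kw] zs; have [_ _ e3] := keyP _ _ wX rX (etrans kw (esym kr)).
    by rewrite -e3//; have [_ ? ?] := quantized_bounds R (wcount z w) n L.
  have low0 z : 0 <= low (rep kk) z.
    by have [? _ _] := quantized_bounds R (wcount z (rep kk)) n L.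
  have := group_rate m01 k0 (filter_uniq _ uXi) Gn hG b0 bl bn low0
    (fun w z wG zs => (lowb w z wG zs).1) (ltW t0).
  apply: reachable_rate_mono => //.
  - rewrite mulr_sumr big_seq [leRHS]big_seq; apply: ler_sum => w /hG[/ltW Qw _ _ _].
    rewrite -mulrA ler_wpM2l ?(ltW t0)// mulrC ler_wpM2r// ler_nat leq_add2l.
    exact: brB.
  - move=> z zs; rewrite /v mulr_sumr big_seq [leRHS]big_seq; apply: ler_sum => w wG.
    have [/ltW Qw _ _ _] := hG _ wG.
    by rewrite ler_wpM2l ?(ltW t0)// ler_wpM2l//; have [] := lowb w z wG zs.
  - have -> : r kk = t * (\sum_(w <- G kk) Q w * ln (Q w / K w) +
        (\sum_(w <- G kk) Q w) * Cb + 1).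
      by rewrite /r -mulr_sumr big_split /= -mulr_suml [in RHS]mulrDr mulr1.
    rewrite ler_wpM2l ?(ltW t0)// addrAC lerD2r lerD2l -mulrN ler_wpM2l ?brC//.
    by rewrite big_seq sumr_ge0// => w /hG[/ltW].
pose le_st kk kk' := `[< rch (st kk) (st kk') >].
have le_total : {in ks &, total le_st}.
  move=> i j /repG/GXi[/hXi[_ i1 _] _] /repG/GXi[/hXi[_ j1 _] _]; apply/orP.
  have [h|h] := rch_total (Fm _ i1) (Fm _ j1); [left|right]; exact/asboolP.
have le_path i j : le_st i j -> exists2 u, 0 < pprod k (st i) u & last (st i) u = st j.
  by move=> /asboolP/rch_path[u [u1 u2 _]]; exists u.
(* Sorting by a total relation makes each starting point reach the next one, which is the order in
   which the loops are run. *)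
pose sks := sort le_st ks.
have psks : perm_eq sks ks by rewrite perm_sort.
have ssks : sorted le_st sks.
  by apply: (sort_sorted_in le_total); apply/allP.
case sksE : sks psks ssks => [|i js] psks ssks.
  have : key ws \in ks by rewrite mem_undup map_f.
  by rewrite -(perm_mem psks).
have hks j : j \in i :: js -> j \in ks by rewrite (perm_mem psks).
have := reachable_rate_chain (st := st) (theta := theta) (v := v) (r := r) le_path ssks
   (fun j hj => rate j (hks j hj)).
rewrite !(perm_big _ psks) /=.
rewrite /theta sum_groups -mulr_sumr tnB.
rewrite big_split /= sum_groups big_const_seq count_predT iter_addr addr0.
move=> h; exists (st i), (st (last i js)); do 3 eexists; split; last exact: h.
- apply: Fm; have := hks i (mem_head _ _) => /repG/GXi[/hXi[_ h1 _] _]; exact: h1.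
- apply: (@le_lt_trans _ _ (1 - eta)); last by rewrite ltrBlDr ltrDl.
  by rewrite ler_piMr// subr_ge0; lra.
- move=> z zs /=; rewrite (perm_big _ psks) /= /v sum_groups -mulr_sumr.
  have cz : n.+1%:R * (m z - 3 * eta) <= \sum_(w <- Xi) Q w * (wcount z w)%:R.
    by apply: le_trans (Xic z) _; apply: ler_sum => w _; rewrite wcount_wsum.
  set A := \sum_(w <- Xi) Q w * (wcount z w)%:R in cz *.
  have -> : \sum_(w <- Xi) Q w * ((wcount z w)%:R - n.+1%:R / L.+1%:R) =
      A - n.+1%:R / L.+1%:R * \sum_(w <- Xi) Q w.
    by rewrite mulr_sumr -sumrB; apply: eq_bigr => w _; rewrite mulrBr [_ * Q w]mulrC.
  apply: (visits_bound t0 _ _ cz) => //; last by have /andP[] := m01 z.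
  + have h9 : 0 <= t * (B%:R - 1) by rewrite mulr_ge0 ?(ltW t0)// subr_ge0.
    by rewrite tn1 -addrA gerDl -opprD oppr_le0 addr_ge0// ltW.
  + have h9 : t * (B%:R - 1) <= eta by apply: le_trans tB; rewrite ler_pM2l// gerBl.
    by rewrite tn1 -addrA lerD2l -opprD lerN2 mulr_natl mulr2n lerD2l.
  + by rewrite Xi2 big_seq sumr_ge0// => w /hXi[/ltW].
- rewrite -mulr_sumr big_split /= -mulr_suml [X in t * (_ + X)]mulrC -mulr_natl.
  have sN : (size ks)%:R * t <= N * t.
    by rewrite ler_wpM2r ?(ltW t0)// ler_nat -(card_uniqP (undup_uniq _)) max_card.
  apply: (@le_trans _ _ (t * (\sum_(w <- Xi) Q w * ln (Q w / K w) +
      Cb * \sum_(w <- Xi) Q w) + N * t)); first by rewrite lerD2l.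
  apply: (rate_bound (n := n%:R)) => //.
  + by apply: le_trans tn _; rewrite gerBl ltW.
  + exact: (rho_ge0 m0 q0 k0 kq rhoE).
  + by rewrite Xi2 big_seq sumr_ge0// => w /hXi[/ltW].
  + by rewrite mulrC -ler_pdivrMr.
  + exact: ltW.
Qed.

End stationary_rate.

(** * Lower bound *)

Section balanced_reachability.
Context d (S : measurableType d) (R : realType).
Hypothesis countS : countable [set: S].
Hypothesis discS : forall A : set S, measurable A.
Variables (beta : probability S R) (p : R.-pker S ~> S) (mu : probability S R).

Lemma reach_path x y : reach p x y ->
  exists u, [/\ 0 < pprod (pmass p) x u, last x u = y & u != [::]].
Proof.
move=> [n [u [n0 <- <- up]]].
suff [s [s0 sl sn]] : exists s, [/\ 0 < pprod (pmass p) (u 0%N) s, last (u 0%N) s = u n & size s = n].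
  by exists s; split => //; rewrite -size_eq0 sn -lt0n.
elim: n up {n0} => [|n IH] up; first by exists [::]; split => //=; exact: ltr01.
have [s [s0 sl sn]] := IH (fun i ni => up i (ltnW ni)).
exists (rcons s (u n.+1)); rewrite last_rcons size_rcons sn; split => //.
by rewrite -cats1 pprod_cat /= mulr1 mulr_gt0// sl pmass_gt0 ?up.
Qed.

Lemma admissible_total x y : admissible beta p mu ->
  (forall z, 0 < mass mu z -> reach p z z) -> 0 < mass mu x -> 0 < mass mu y ->
  reach p x y \/ reach p y x.
Proof.
move=> [_ tot _] rec.
have chg z : 0 < mass mu z -> charged_classes p mu [set t | reach p z t /\ reach p t z].
  move=> mz; split; first exact/irreducible_class_of/rec.
  apply: (@lt_le_trans _ _ (mu [set z])); first by rewrite -massE// lte_fin.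
  by apply: le_measure; rewrite ?inE// => t ->; split; exact: rec.
move=> mx my; have [[a [b [/= [xa ax] [yb by'] ab]]]|[a [b [/= [ya ay] [xb bx] ab]]]] :=
  tot _ _ (chg x mx) (chg y my).
  by left; apply: reach_trans xa _; exact: reach_trans ab by'.
by right; apply: reach_trans ya _; exact: reach_trans ab bx.
Qed.

Lemma admissible_start x : admissible beta p mu -> reach p x x -> 0 < mass mu x ->
  exists2 b, 0 < mass beta b & reach p b x.
Proof.
move=> [_ _ init] xx mx.
have [|y [xy yx] [sy|[b sb bY]]] := init [set t | reach p x t /\ reach p t x].
- split; first exact: irreducible_class_of.
  apply: (@lt_le_trans _ _ (mu [set x])); first by rewrite -massE// lte_fin.
  by apply: le_measure; rewrite ?inE// => t ->.
- by exists y => //; rewrite -lte_fin massE.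
- by exists b; [rewrite -lte_fin massE|exact: reach_trans bY yx].
Qed.

Variable nu : probability (S * S)%type R.
Hypothesis nu1 : marginal1 nu = mu :> (set S -> \bar R).
Hypothesis bal : balanced nu.
Hypothesis dom : forall u, mass mu u.1 * pmass p u.1 u.2 = 0 -> mass nu u = 0.

Let n0 u : 0 <= mass nu u.
Proof. exact: (mass_ge0 (discrete_product countS discS)). Qed.

Lemma charged_pair_step x y : 0 < mass nu (x, y) -> (0 < p x [set y])%E.
Proof.
move=> nxy; rewrite -pmass_gt0// lt_def pmass_ge0// andbT.
by apply: contraTneq nxy => /= h; rewrite dom ?ltxx//= h mulr0.
Qed.

(* The set of points reachable from [y] carries no outgoing flow of [nu], hence
   by balance no incoming flow either. *)
Lemma charged_pair_return x y : 0 < mass nu (x, y) -> reach p y x.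
Proof.
move=> nxy; have pxy := charged_pair_step nxy.
have countSS := countable_product countS; have discSS := discrete_product countS discS.
apply: contrapT => nyx; pose D := [set z | z = y \/ reach p y z].
have Dx : ~ D x by move=> [xy|//]; apply: nyx; rewrite -xy in pxy *; exact: reach_step.
have out0 : nu (D `*` ~` D) = 0%E.
  rewrite (measure_mass countSS discSS) esum1// => -[a b] [/= Da nDb].
  congr EFin; apply/eqP; rewrite eq_le n0 andbT leNgt; apply/negP => /charged_pair_step/reach_step ab.
  by apply: nDb; right; case: Da => [<-//|ya]; exact: reach_trans ya ab.
have le1 : (nu (D `*` [set: S]) <= nu (D `*` D))%E.
  rewrite (_ : D `*` [set: S] = (D `*` D) `|` (D `*` ~` D)).
    apply: (le_trans (measureU2 nu (discSS _) (discSS _))).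
    by rewrite [X in (_ + X <= _)%E]out0 adde0.
  apply/seteqP; split => -[a b] /= => [[Da _]|[] [] //].
  by have [Db|nDb] := pselect (D b); [left|right].
have : (nu (D `*` D) + nu [set (x, y)] <= nu ([set: S] `*` D))%E.
  rewrite -measureU; [|exact: discSS|exact: discSS|].
    apply: le_measure; rewrite ?inE; [exact: discSS|exact: discSS|].
    by move=> [a b] /= [[]//|[_ ->]]; split => //; left.
  by apply/seteqP; split => // -[a b] /= [[Da _] [ax _]]; apply: Dx; rewrite -ax.
rewrite -bal => h; have := le_trans h le1.
have fD : nu (D `*` D) \is a fin_num by apply: fin_num_measure; exact: discSS.
by rewrite -massE// -(fineK fD) -EFinD lee_fin gerDl leNgt nxy.
Qed.

Lemma charged_recurrent x : 0 < mass mu x -> reach p x x.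
Proof.
move=> mx; have [y nxy] : exists y, 0 < mass nu (x, y).
  apply: contrapT => /forallNP h; have := esum_marginal1 countS discS nu1 x.
  rewrite esum1 => [[m0]|y _]; first by rewrite -m0 ltxx in mx.
  by congr EFin; apply/eqP; rewrite eq_le n0 andbT leNgt; apply/negP/h.
apply: (@reach_trans _ _ _ _ _ y); last exact: charged_pair_return.
exact/reach_step/charged_pair_step.
Qed.

(** The conditional law of the second coordinate under [nu]; where [mass mu x = 0] the division
    makes the row zero, so it is stochastic only at charged points. *)
Definition pair_kernel x y : R := mass nu (x, y) / mass mu x.

Lemma pair_kernel_ge0 x y : 0 <= pair_kernel x y.
Proof. by rewrite divr_ge0// mass_ge0. Qed.

Lemma pair_kernelE x y : mass mu x * pair_kernel x y = mass nu (x, y).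
Proof.
have [mx|mx] := eqVneq (mass mu x) 0; last by rewrite mulrC divfK.
have := esum_marginal1 countS discS nu1 x; rewrite mx mul0r => h.
have n0' z : (0 <= (mass nu (x, z))%:E)%E by rewrite lee_fin.
by have [->] := esum_eq0 n0' h (Logic.I : [set: S] y).
Qed.

Lemma esum_pair_kernel x : 0 < mass mu x ->
  (\esum_(y in [set: S]) (pair_kernel x y)%:E = 1)%E.
Proof.
move=> mx; under eq_esum do rewrite /pair_kernel mulrC EFinM.
rewrite esumZl ?invr_ge0 ?(ltW mx)//; last by move=> y; rewrite lee_fin.
by rewrite (esum_marginal1 countS discS nu1) -EFinM mulVf// gt_eqF.
Qed.

(** Every step of the word is charged by [nu] and can be undone by [charged_pair_return]; going back
    step by step leads to the first letter. *)
Lemma charged_word_return n (w : word S n) : 0 < wmass (mass mu) pair_kernel w ->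
  reach p (wlast w) (wnth w 0).
Proof.
elim: n w => [|n IH] w /=; first exact: charged_recurrent.
have w0 : 0 <= wmass (mass mu) pair_kernel w.1.
  by apply: wmass_ge0 => *; [exact: mass_ge0|exact: pair_kernel_ge0].
move=> h; have {}w0 : 0 < wmass (mass mu) pair_kernel w.1.
  by rewrite lt_def w0 andbT; apply: contraTneq h => ->; rewrite mul0r ltxx.
apply: reach_trans (IH _ w0); apply: charged_pair_return.
rewrite lt_def n0 andbT; apply: contraTneq h => n00.
by rewrite /pair_kernel n00 mul0r mulr0 ltxx.
Qed.

Lemma charged_rate (rho : R) (s0 : seq S) (e : R) : admissible beta p mu ->
  R2 p nu = rho%:E -> 0 < e ->
  exists b y theta v r, [/\ 0 < mass beta b, theta < 1,
    forall z, z \in s0 -> mass mu z - e <= v z, r <= rho + e &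
    reachable_rate (pmass p) s0 b y theta v r].
Proof.
move=> adm; rewrite (R2E countS discS _ nu1) asboolT// => rhoE e0.
have m01 x : 0 <= mass mu x <= 1.
  by rewrite mass_ge0// -lee_fin massE// probability_le1.
have mq y : (\esum_(x in [set: S]) (mass mu x * pair_kernel x y)%:E = (mass mu y)%:E)%E.
  rewrite -(esum_marginal2 countS discS nu1 y bal); apply: eq_esum => x _.
  by rewrite pair_kernelE.
have kq x y : mass mu x * pmass p x y = 0 -> mass mu x * pair_kernel x y = 0.
  by rewrite pair_kernelE; exact: (@dom (x, y)).
have {}rhoE : (\esum_(u in [set: S * S]) (entf (mass mu u.1 * pair_kernel u.1 u.2)
    (mass mu u.1 * pmass p u.1 u.2))%:E = rho%:E)%E.
  by rewrite -rhoE; apply: eq_esum => -[x y] _; rewrite pair_kernelE.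
have [x [y [th [v [r [mx th1 vz rr h]]]]]] := stationary_rate m01
  (esum_mass countS discS mu) pair_kernel_ge0 esum_pair_kernel mq
  (pmass_ge0 discS p) (esum_pmass countS discS p) kq rhoE reach_path
  (fun x y => admissible_total adm charged_recurrent) charged_word_return s0 e0.
have [b bb /reach_path[u [u0 ux _]]] := admissible_start adm (charged_recurrent mx) mx.
have h0 := reachable_rate_path s0 u0; rewrite ux in h0.
exists b, y, (0 + th), (fun z => 0 + v z), (0 + r); split.
- exact: bb.
- by rewrite add0r.
- by move=> z /vz; rewrite add0r.
- by rewrite add0r.
- exact: (reachable_rate_cat h0 h).
Qed.

End balanced_reachability.

Section lower_bound.
Context d d' (S : measurableType d) (Omega : measurableType d') (R : realType).
Variables (P : probability Omega R) (X : nat -> {RV P >-> S}).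
Variables (beta : probability S R) (p : R.-pker S ~> S).
Hypothesis countS : countable [set: S].
Hypothesis discS : forall A : set S, measurable A.
Hypothesis chain_X : markov_chain X beta p.

Lemma R1_lower (mu : probability S R) (U : set (probability S R)) a :
  admissible beta p mu -> nbhs mu U -> (R1 p mu < a%:E)%E ->
  \forall n \near \oo, ((expR (- (n.+1%:R * a)))%:E <= P (occupation X n @^-1` U))%E.
Proof.
move=> adm /nbhs_mass[//|//|s [e e0 sU]] /ereal_inf_lt[_ [nu [bal nu1] <-]] Ra.
have := R2E countS discS p nu1; case: asboolP => [dom|_ h]; last by rewrite h in Ra.
move=> RE; have R0 : (0 <= R2 p nu)%E.
  rewrite RE; apply: esum_ge0 => u _; rewrite lee_fin; apply: entf_ge0.
  - by apply: mass_ge0; exact: discrete_product.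
  - by rewrite mulr_ge0// ?mass_ge0// pmass_ge0.
  - exact: dom.
case rhoE : (R2 p nu) R0 Ra => [rho||] // _; rewrite lte_fin => rhoa.
(* Spent twice in each role: [charged_rate] loses [e1] in the masses and in the rate, and
   [reachable_rate_prob] loses it again. *)
pose e1 := Num.min (e / 2) ((a - rho) / 2).
have e10 : 0 < e1 by rewrite lt_min !divr_gt0// subr_gt0.
have [b [y [th [v [r [bb th1 vz rr h]]]]]] :=
  charged_rate countS discS nu1 bal dom s adm rhoE e10.
have := reachable_rate_prob countS discS chain_X h th1 bb e10.
have e1e : e1 <= e / 2 by rewrite ge_min lexx.
have e1a : e1 <= (a - rho) / 2 by rewrite ge_min lexx orbT.
apply: filterS => n rb; apply: (@le_trans _ _ (expR (- (n.+1%:R * (r + e1))))%:E).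
  by rewrite lee_fin ler_expR lerN2 ler_wpM2l//; lra.
apply: le_trans rb _; apply: le_measure; rewrite ?inE; try exact: measurable_occupation.
move=> t /= vt; apply: sU => z zs; apply: le_lt_trans (vt z zs).
by have := vz z zs; lra.
Qed.

End lower_bound.

(** * From local rates to the weak large deviation principle *)

Lemma real_between (R : realType) (x y : \bar R) : (x < y)%E ->
  exists r : R, (x < r%:E < y)%E.
Proof.
case: x y => [a||] [b||] //; rewrite ?lte_fin => ab.
- exists ((a + b) / 2); rewrite !lte_fin; apply/andP; split; lra.
- exists (a + 1); rewrite lte_fin ltry andbT ltrDl//.
- by exists (b - 1); rewrite ltNyr lte_fin ltrBlDr ltrDl ltr01.
- by exists 0; rewrite ltNyr ltry.
Qed.

Section local_rates.
Context d (Omega : measurableType d) (R : realType).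
Variables (P : probability Omega R) (T : topologicalType) (Y : nat -> Omega -> T).
Local Open Scope ereal_scope.

Definition prob_le (A : set T) (a : R) :=
  \forall n \near \oo, P (Y n @^-1` A) <= (expR (- (n.+1%:R * a)))%:E.

Definition prob_ge (A : set T) (a : R) :=
  \forall n \near \oo, (expR (- (n.+1%:R * a)))%:E <= P (Y n @^-1` A).

Lemma prob_ge_le A a b : prob_ge A a -> prob_le A b -> (b <= a)%R.
Proof.
move=> ga lb; have [n [h1 h2]] := filter_ex (filterI ga lb).
by have := le_trans h1 h2; rewrite lee_fin ler_expR lerN2 ler_pM2l.
Qed.

Hypothesis mY : forall n A, measurable (Y n @^-1` A).
Variable I : T -> \bar R.
Hypothesis I0 : forall x, 0 <= I x.
Hypothesis local_upper : forall x a, a%:E < I x -> exists U, [/\ open U, U x & prob_le U a].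
Hypothesis local_lower : forall x U a, nbhs x U -> I x < a%:E -> prob_ge U a.

Lemma compact_upper (K : set T) (a : R) : compact K -> (forall x, K x -> a%:E < I x) ->
  exists C : nat, \forall n \near \oo,
    P (Y n @^-1` K) <= (C%:R * expR (- (n.+1%:R * a)))%:E.
Proof.
move=> cK KI; pose small A := exists C : nat, \forall n \near \oo,
  P (Y n @^-1` A) <= (C%:R * expR (- (n.+1%:R * a)))%:E.
have smallS A B : A `<=` B -> small B -> small A.
  move=> AB [C h]; exists C; apply: filterS h => n; apply: le_trans.
  by apply: le_measure; rewrite ?inE// => t; exact: AB.
have smallU A B : small A -> small B -> small (A `|` B).
  move=> [C h] [D g]; exists (C + D)%N; apply: filterS2 h g => n h g.
  rewrite preimage_setU natrD mulrDl EFinD.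
  by apply: (le_trans (measureU2 P (mY n A) (mY n B))); exact: leeD.
(* The complements in [K] of the small sets would form a filter with a cluster
   point in [K], which has a small neighbourhood. *)
apply: contrapT => nK.
pose F : set_system T := [set B | small (K `\` B)].
have FF : ProperFilter F.
  split; first by rewrite /F /= setD0.
  split.
  - by exists 0%N; apply: nearW => n; rewrite setDT preimage_set0 measure0 mul0r.
  - by move=> A B; rewrite /F /= setDIr; exact: smallU.
  - by move=> A B AB; apply: smallS => x [Kx nB]; split => // /AB.
have FK : F K by exists 0%N; apply: nearW => n; rewrite setDv preimage_set0 measure0 mul0r.
have [x [Kx clx]] := cK F FF FK.
have [U [oU Ux Ua]] := local_upper (KI x Kx).
have FU : F (~` U).
  apply: (@smallS _ U); first by move=> y [_ /contrapT].
  by exists 1%N; apply: filterS Ua => n; rewrite mul1r.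
by have [y []] := clx _ _ FU (open_nbhs_nbhs (conj oU Ux)).
Qed.

(** A point [y] of [U] with [I y <= a] would give [U] a probability of at least [expR (- n * c)]
    with [c < b], against the upper estimate at rate [b]. *)
Lemma local_rates_lsc : lower_semicontinuous I.
Proof.
move=> x a /real_between[b /andP[ab bI]].
have [U [oU Ux Ub]] := local_upper bI.
exists U; first exact: open_nbhs_nbhs.
move=> y Uy; rewrite ltNge; apply/negP => Ia.
have [c /andP[ac cb]] := real_between ab.
have := prob_ge_le (local_lower (open_nbhs_nbhs (conj oU Uy)) (le_lt_trans Ia ac)) Ub.
by rewrite leNgt -lte_fin cb.
Qed.

Lemma local_rates_weak_LDP : hausdorff_space T -> weak_LDP P Y I.
Proof.
have Y0 A n : 0 <= P (Y n @^-1` A) by exact: measure_ge0.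
move=> hT; split.
- by split => // n A _.
- by split => //; exact: local_rates_lsc.
- move=> K cK; rewrite leeNr leNgt; apply/negP => /real_between[a /andP[La aI]].
  (* The room between [a] and [b] absorbs the constant [C] of the finite cover. *)
  have [b /andP[ab bI]] := real_between aI.
  have [C hC] := compact_upper cK (fun x Kx => lt_le_trans bI (ereal_inf_lbound (imageP I Kx))).
  suff : limn_esup (log_prob P Y K) <= (- a)%:E by rewrite EFinN leeNr leNgt La.
  apply: limn_esup_le_near; rewrite lte_fin in ab.
  have : \forall n \near \oo, (C%:R / (b - a) <= n%:R)%R by exact: nbhs_infty_ger.
  apply: filterS2 hC => n hn Cn; rewrite rate_le_expR//; apply: (le_trans hn).
  have -> : (n.+1%:R * - a = n.+1%:R * (b - a) + - (n.+1%:R * b))%R by ring.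
  rewrite lee_fin expRD ler_pM2r ?expR_gt0//.
  rewrite ler_pdivrMr ?subr_gt0// in Cn; apply: (le_trans Cn).
  apply: le_trans (expR_ge1Dx _); rewrite -[n.+1%:R]natr1 mulrDl mul1r.
  by rewrite addrCA lerDl addr_ge0// subr_ge0 ltW.
- move=> U oU; rewrite leeNl leNgt; apply/negP => /ereal_inf_lt[_ [x Ux <-]].
  move=> /real_between[a /andP[Ia aL]].
  suff : (- a)%:E <= limn_einf (log_prob P Y U) by rewrite EFinN leeNl leNgt aL.
  apply: limn_einf_ge_near.
  have := local_lower (open_nbhs_nbhs (conj oU Ux)) Ia.
  by apply: filterS => n hn; rewrite rate_ge_expR// mulrN.
Qed.

End local_rates.

Theorem theorem1p4 (R : realType) (d d' : measure_display)
    (S : measurableType d) (countable_S : countable [set: S])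
    (discrete_S : forall A : set S, measurable A)
    (beta : probability S R) (p : R.-pker S ~> S)
    (Omega : measurableType d') (P : probability Omega R)
    (X : nat -> {RV P >-> S}) (chain_X : markov_chain X beta p) :
  (forall mu : probability S R, admissible beta p mu ->
     Lambda_star X mu = J1 p mu /\ J1 p mu = R1 p mu) /\
  weak_LDP P (occupation X) (rate_function X beta p).
Proof.
have upper mu a : (a%:E < rate_function X beta p mu)%E ->
    exists U, [/\ open U, U mu & prob_le P (occupation X) U a].
  rewrite /rate_function; case: asboolP => [_|nadm _].
    exact: (Lambda_star_upper countable_S discrete_S chain_X).
  have [U [oU Umu U0]] := nonadmissible_upper countable_S discrete_S chain_X nadm.
  exists U; split => //; apply: filterS U0 => n ->.
  by rewrite lee_fin expR_ge0.
have ratesE mu : admissible beta p mu ->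
    Lambda_star X mu = J1 p mu /\ J1 p mu = R1 p mu.
  move=> adm.
  have RJ := R1_le_J1 countable_S discrete_S p mu.
  have JL := J1_le_Lambda_star countable_S discrete_S chain_X mu.
  have LR : (Lambda_star X mu <= R1 p mu)%E.
    (* With [a < b] strictly between the two values, one neighbourhood of [mu] would have
       probability at least [expR (- n * a)] and at most [expR (- n * b)]. *)
    rewrite leNgt; apply/negP => /real_between[a /andP[Ra /real_between[b /andP[ab bL]]]].
    have [|U [oU Umu Ub]] := upper mu b; first by rewrite /rate_function asboolT.
    have := R1_lower countable_S discrete_S chain_X adm (open_nbhs_nbhs (conj oU Umu)) Ra.
    by move=> /prob_ge_le/(_ Ub); rewrite leNgt -lte_fin ab.
  split; apply/eqP; rewrite eq_le; apply/andP; split => //.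
  + exact: le_trans LR RJ.
  + exact: le_trans JL LR.
split=> //; apply: local_rates_weak_LDP => //.
- by move=> n A; exact: measurable_occupation.
- move=> mu; rewrite /rate_function; case: asboolP => // _.
  exact: (Lambda_star_ge0 countable_S discrete_S chain_X mu).
- move=> mu U a Umu; rewrite /rate_function; case: asboolP => // adm.
  have [-> ->] := ratesE mu adm.
  exact: (R1_lower countable_S discrete_S chain_X adm Umu).
- exact: probability_hausdorff.
Qed.
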